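(* Let $(X,\mathcal{X},\mu)$ be a standard non-atomic probability space and let $\mathrm{Aut}(X,\mu)$ be the group of invertible measure preserving transformations of $(X,\mathcal{X},\mu)$ (modulo equality $\mu$-a.e.), endowed with the weak topology. Then there is a residual (comeager) subset $\mathcal{G}\subseteq \mathrm{Aut}(X,\mu)$ such that for every $T\in\mathcal{G}$, every $d\in\mathbb{N}$ and all $f_1,\ldots,f_d\in L^\infty(X,\mathcal{X},\mu)$, the limit $$\lim_{N\to\infty}\frac 1 N\sum_{n=0}^{N-1}f_1(T^nx)f_2(T^{2n}x)\cdots f_d(T^{dn}x)$$ exists for $\mu$-almost every $x\in X$.
   Context: The weak topology on $\mathrm{Aut}(X,\mu)$ is the topology in which $T_n\to T$ if and only if $\mu(T_nA\,\triangle\, TA)\to 0$ for every $A\in\mathcal{X}$; it is a Polish topology. A subset is residual (comeager) if it contains a countable intersection of dense open sets. $\mathbb{N}=\{1,2,\ldots\}$. *)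

(* Defs.v *)
From HB Require Import structures.
From mathcomp Require Import all_boot all_order all_algebra.
From mathcomp Require Import all_classical all_reals all_analysis.
From mathcomp Require Import complex.

Set Implicit Arguments.
Unset Strict Implicit.
Unset Printing Implicit Defensive.

Import Order.TTheory GRing.Theory Num.Theory.
Import numFieldNormedType.Exports.

Local Open Scope classical_set_scope.
Local Open Scope ring_scope.
Local Open Scope quotient_scope.

(* The sigma-algebra of X is the Borel sigma-algebra of a Polish topology,
   the latter being transported along a bijection f from X onto a complete
   separable metric space. *)
Definition standard_borel (R : realType) d (X : measurableType d) : Prop :=
  exists Y : completePseudoMetricType R,
    [/\ hausdorff_space Y, @second_countable Y &
     exists2 f : X -> Y, bijective f &
       forall A : set X, measurable A <->
         exists2 B : set Y, <<s @open Y >> B & A = f @^-1` B].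

Definition nonatomic (R : realType) d (X : measurableType d)
    (mu : {measure set X -> \bar R}) : Prop :=
  forall A : set X, measurable A -> (0 < mu A)%E ->
    exists B : set X,
      [/\ measurable B, B `<=` A, (0 < mu B)%E & (mu B < mu A)%E].

Section automorphisms.
Context (R : realType) d (X : measurableType d) (mu : probability X R).

(* Measure preserving bijections defined at every point; on a standard
   non-atomic space every a.e. invertible measure preserving map agrees a.e.
   with one of these. *)
Record mptrans : Type := Mptrans {
  mptrans_fun :> X -> X;
  mptrans_bij : bijective mptrans_fun;
  mptrans_measurable : measurable_fun setT mptrans_fun;
  mptrans_measurable_image :
    forall A : set X, measurable A -> measurable (mptrans_fun @` A);
  mptrans_preserving :
    forall A : set X, measurable A -> mu (mptrans_fun @^-1` A) = mu A }.

HB.instance Definition _ := gen_eqMixin mptrans.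
HB.instance Definition _ := gen_choiceMixin mptrans.

Lemma idmp_image (A : set X) : measurable A -> measurable (idfun @` A).
Proof. by rewrite image_id. Qed.

Definition idmp : mptrans :=
  Mptrans (Bijective (@frefl _ _ idfun) (@frefl _ _ idfun))
    (@measurable_id _ X setT) idmp_image (fun A _ => erefl (mu A)).

HB.instance Definition _ := isPointed.Build mptrans idmp.

Definition ae_eq_mp (S T : mptrans) : bool := `[< S = T %[ae mu] >].

Lemma ae_eq_mp_refl : reflexive ae_eq_mp.
Proof. by move=> S; apply/asboolP; exact: ae_eq_refl. Qed.

Lemma ae_eq_mp_sym : symmetric ae_eq_mp.
Proof. by move=> S T; apply/idP/idP => /asboolP h; apply/asboolP/ae_eq_sym. Qed.

Lemma ae_eq_mp_trans : transitive ae_eq_mp.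
Proof.
by move=> S T U /asboolP TS /asboolP SU; apply/asboolP/(ae_eq_trans TS SU).
Qed.

Canonical ae_eq_mp_equiv :=
  EquivRel ae_eq_mp ae_eq_mp_refl ae_eq_mp_sym ae_eq_mp_trans.

Definition Aut : Type := {eq_quot ae_eq_mp}.
HB.instance Definition _ := Choice.on Aut.
HB.instance Definition _ := EqQuotient.on Aut.

Definition Aut_class (T : mptrans) : Aut := \pi_Aut T.

(* The classes of the S with mu (S A `+` T A) < e, where `+` is the symmetric
   difference; see weak_ballP for the independence of the representatives. *)
Definition weak_ball (i : set X * mptrans * R) : set Aut :=
  let: (A, T, e) := i in
  Aut_class @` [set S : mptrans | (mu ((S @` A) `+` (T @` A)) < e%:E)%E].

(* The weak topology, generated by the weak balls as a subbase; it is the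
   topology of the convergence mu (T_n A `+` T A) --> 0 for every measurable A,
   see weak_cvgP below. *)
HB.instance Definition _ := @isSubBaseTopological.Build Aut
  (set X * mptrans * R)%type [set i | measurable i.1.1] weak_ball.

Lemma mptrans_image_mu (S : mptrans) (A : set X) :
  measurable A -> mu (S @` A) = mu A.
Proof.
move=> mA; have mSA := mptrans_measurable_image S mA.
rewrite -(mptrans_preserving S mSA); congr (mu _).
apply/seteqP; split=> [x [y Ay /(bij_inj (mptrans_bij S)) <-]//|x Ax].
by exists x.
Qed.

Lemma measurable_symdiff (S T : mptrans) (A : set X) : measurable A ->
  measurable ((S @` A) `+` (T @` A)).
Proof.
by move=> mA; apply: measurableU; apply: measurableD;
  exact: mptrans_measurable_image.
Qed.

Lemma symdiff_sym (S T : mptrans) (A : set X) :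
  mu ((S @` A) `+` (T @` A)) = mu ((T @` A) `+` (S @` A)).
Proof. by rewrite setYC. Qed.

Lemma symdiff_triangle (S T U : mptrans) (A : set X) : measurable A ->
  (mu ((S @` A) `+` (U @` A)) <=
   mu ((S @` A) `+` (T @` A)) + mu ((T @` A) `+` (U @` A)))%E.
Proof.
move=> mA; apply: (le_trans (y := mu (((S @` A) `+` (T @` A)) `|`
   ((T @` A) `+` (U @` A))))); last first.
  by apply: measureU2; exact: measurable_symdiff.
apply: le_measure; rewrite ?inE; first exact: measurable_symdiff.
  by apply: measurableU; exact: measurable_symdiff.
move=> x; rewrite /setY /setD /=; have [?|?] := pselect ((T @` A) x); tauto.
Qed.

Lemma symdiff_ae_eq (S T : mptrans) (A : set X) : measurable A ->
  ae_eq_mp S T -> mu ((S @` A) `+` (T @` A)) = 0%E.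
Proof.
move=> mA /asboolP [N [mN N0 subN]].
have neN x : S x <> T x -> N x by move=> STx; apply: subN => /= /(_ I).
apply/eqP; rewrite eq_le measure_ge0 andbT.
apply: (le_trans (y := mu ((S @` N) `|` (T @` N)))).
  apply: le_measure; rewrite ?inE; first exact: measurable_symdiff.
    by apply: measurableU; exact: mptrans_measurable_image.
  move=> _ [] [[x Ax <-] nx]; [left|right]; exists x => //; apply: neN => e;
  by apply: nx; exists x.
apply: (le_trans (y := (mu (S @` N) + mu (T @` N))%E)).
  by apply: measureU2; exact: mptrans_measurable_image.
by rewrite !mptrans_image_mu// (N0 : mu N = 0%E) adde0.
Qed.

Lemma weak_ballP (S : mptrans) (A : set X) (T : mptrans) (e : R) :
  measurable A ->
  weak_ball (A, T, e) (Aut_class S) <->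
  (mu ((S @` A) `+` (T @` A)) < e%:E)%E.
Proof.
move=> mA; split=> [[S' /= S'e /eqmodP SS']|]; last by exists S.
apply: le_lt_trans S'e.
rewrite (le_trans (symdiff_triangle S S' T mA))// symdiff_sym.
by rewrite symdiff_ae_eq// add0e.
Qed.

Lemma weak_cvgP (Tn : nat -> mptrans) (T : mptrans) :
  (fun n => Aut_class (Tn n)) @ \oo --> Aut_class T <->
  forall A : set X, measurable A ->
    (fun n => mu ((Tn n @` A) `+` (T @` A))) @ \oo --> 0%E.
Proof.
have fin (S U : mptrans) (A : set X) :
    measurable A -> mu ((S @` A) `+` (U @` A)) \is a fin_num.
  by move=> mA; apply: fin_num_measure; exact: measurable_symdiff.
have open_ball (A : set X) (S : mptrans) (e : R) :
    measurable A -> open (weak_ball (A, S, e)).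
  move=> mA; exists [set weak_ball (A, S, e)]; last exact: bigcup_set1.
  by move=> _ ->; exact: (@finI_from1 _ _ _ weak_ball (A, S, e)).
split=> [TnT A mA|TnT].
  apply/fine_cvgP; split; first by apply: nearW => n; exact: fin.
  apply/cvgrPdist_lt => /= e e0.
  have TB : nbhs (Aut_class T) (weak_ball (A, T, e)).
    apply: open_nbhs_nbhs; split; first exact: open_ball.
    by apply/weak_ballP => //; rewrite symdiff_ae_eq ?lte_fin ?ae_eq_mp_refl.
  have : \forall n \near \oo, weak_ball (A, T, e) (Aut_class (Tn n)).
    exact: TnT.
  apply: filterS => n /(weak_ballP _ _ _ mA) Tne /=.
  rewrite sub0r normrN ger0_norm ?fine_ge0 ?measure_ge0//.
  by rewrite -lte_fin fineK ?fin.
move=> U; rewrite nbhsE => -[V [oV VT] VU].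
case: oV => F FD FV; move: VT; rewrite -FV => -[W FW WT].
have [J JD JW] := FD W FW.
suff : \forall n \near \oo, W (Aut_class (Tn n)).
  by apply: filterS => n Wn; apply: VU; rewrite -FV; exists W.
rewrite -JW; apply: (@filter_bigI _ _ J
  (fun i => [set n | weak_ball i (Aut_class (Tn n))])) => -[[A S] e] JA.
have mA : measurable A by move/JD: JA; rewrite inE.
have : weak_ball (A, S, e) (Aut_class T).
  by have : W (Aut_class T) := WT; rewrite -JW => /(_ _ JA).
move=> /(weak_ballP _ _ _ mA) TS.
set c := fine (mu ((T @` A) `+` (S @` A))).
have TSc : mu ((T @` A) `+` (S @` A)) = c%:E by rewrite fineK ?fin.
have ce : 0 < e - c by rewrite subr_gt0 -lte_fin -TSc.
have /fine_cvgP [_ /cvgrPdist_lt /(_ _ ce)] := TnT A mA.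
apply: filterS => n /=; rewrite sub0r normrN => H; apply/weak_ballP => //.
apply: (le_lt_trans (symdiff_triangle (Tn n) T S mA)).
rewrite TSc -(fineK (fin (Tn n) T A mA)) -EFinD lte_fin -ltrBrDr.
by apply: le_lt_trans H; exact: ler_norm.
Qed.

End automorphisms.

Definition residual (T : topologicalType) (G : set T) : Prop :=
  exists U : (set T)^nat,
    (forall n, open (U n) /\ dense (U n)) /\ \bigcap_n U n `<=` G.

(* Representatives of the complex-valued L^oo functions. *)
Definition Linfty (R : realType) d (X : measurableType d)
    (mu : {measure set X -> \bar R}) (f : X -> R[i]) : Prop :=
  [/\ measurable_fun setT (fun x => complex.Re (f x)),
      measurable_fun setT (fun x => complex.Im (f x)) &
      exists M : R, {ae mu, forall x, `|f x| <= (M%:C)%C}].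

(* The factor f j corresponds to f_{j+1} in the usual indexing from 1. *)
Definition multiple_average (R : realType) (X : Type) (T : X -> X) (k : nat)
    (f : 'I_k -> X -> R[i]) (N : nat) (x : X) : R[i] :=
  N%:R^-1 * \sum_(0 <= n < N) \prod_(j < k) f j (iter (j.+1 * n) T x).

(* Main.v *)
From HB Require Import structures.
Require Import Defs.
From mathcomp Require Import all_boot all_order fingroup perm all_algebra.
From mathcomp Require Import all_classical all_reals all_analysis.
From mathcomp Require Import measurable_realfun complex.
From mathcomp Require Import zify ring lra.
Import Order.TTheory GRing.Theory Num.Theory.
Import numFieldNormedType.Exports.

(** Why the theorem is true.

    Fix finitely many sets A_1, ..., A_k and a tolerance eps.  A transformation
    is called flat ([eventually_flat]) when, outside a set of measure eps, the
    averages of the indicators of the A_j stay from some time on within eps of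
    one constant.  If T is flat for all tuples drawn from a countable
    generating pi-system and for all eps, then its averages are Cauchy almost
    everywhere for those tuples, and a monotone class argument carried out one
    position at a time extends this to all bounded functions
    ([bounded_real_average]): replacing one factor by a function close to it
    in L1 changes the averages little at all times at once, by the maximal
    ergodic inequality for a single power of T ([maximal_inequality]).  Only
    countably many conditions are involved, so the theorem reduces to the
    statement that flatness holds on a dense open set ([flat_near]).

    Flatness is an assertion about all large times, while a weak neighbourhood
    controls only finitely many iterates.  The gap is closed by towers whose
    level names are insensitive to independent shifts.  Suppose that T0 permutes
    cyclically the P levels of a tower filling almost all of the space, that
    each A_j is seen through a P-periodic word w of level names, and that
      (1/P) sum_(i < P) prod_j phi_j(w(c_j + j i))
    is within eps of one constant a for ALL shifts c_1, ..., c_k.  If S is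
    close enough to T0, most points follow the tower under S for k P steps.
    In a window of times n, ..., n + P - 1 the points S^(jn) x start at
    some heights c_j; nothing is known about their joint distribution, but the
    window average is close to a whatever they are.  The exceptional times are
    those at which some S^(jn) x lies in a small bad set, and their frequency
    is bounded for all lengths N simultaneously by the maximal inequality
    ([flat_of_windows]).  So every S near T0 is flat, with the same constants.

    Words of this kind exist ([block_word_average]): take distinct large primes
    p_0, ..., p_(q-1) and let the word be periodic of period p_r inside the
    blocks of type r, the types following each other cyclically.  For most times
    i the k times c_j + j i lie well inside blocks of distinct types,
    and then, by the Chinese remainder theorem, the average over a window
    of length p_0 ... p_(q-1) is exactly the product of the separate averages.

    It remains to find T0 in a given weak neighbourhood of S0.  Letters are
    pairs (name of x, name of S0 x); as S0 preserves the measure, these form a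
    balanced flow, hence after rounding a permutation of cells up to few errors
    ([matching_perm]), whose orbits are spliced into a word ([balanced_word]).
    A tower with prescribed levels is built by parametrizing every measurable
    set by an interval up to a null set ([parametrization]).  This is where the
    hypotheses on the space enter: completeness makes the set of codes of points
    measurable in the space of binary sequences, and the absence of atoms makes
    the quantile map on codes injective. *)

Set Implicit Arguments.
Unset Strict Implicit.
Unset Printing Implicit Defensive.

Local Open Scope ring_scope.

(** * Sums of periodic sequences *)

Definition periodic (V : Type) (p : nat) (g : nat -> V) : Prop :=
  forall t, g (t + p)%N = g t.

Lemma periodicM (V : Type) (p : nat) (g : nat -> V) :
  periodic p g -> forall q t, g (t + q * p)%N = g t.
Proof.
by move=> gp; elim=> [|q IH] t; rewrite ?addn0// mulSn addnCA addnC gp IH.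
Qed.

Lemma periodic_mod (V : Type) (p : nat) (g : nat -> V) :
  periodic p g -> forall t, g (t %% p)%N = g t.
Proof.
by move=> gp t; rewrite {2}(divn_eq t p) addnC (periodicM gp).
Qed.

(** Multiplication by a unit modulo [p] permutes the residues, so the speed at
    which a [p]-periodic sequence is read does not affect its sum. *)
Lemma sum_coprime_step (V : nmodType) (p a c : nat) (g : nat -> V) :
  (0 < p)%N -> coprime a p -> periodic p g ->
  \sum_(0 <= l < p) g (c + a * l)%N = \sum_(0 <= l < p) g l.
Proof.
move=> p0 cop gp; rewrite !big_mkord.
have hlt (i : 'I_p) : ((c + a * i) %% p < p)%N by rewrite ltn_mod.
pose h (i : 'I_p) : 'I_p := Ordinal (hlt i).
have hinj : injective h.
  move=> i j /(congr1 val) /= /eqP; rewrite eqn_modDl => ij.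
  apply/val_inj => /=; move: ij.
  wlog le_ij : i j / (i <= j)%N.
    by case: (leqP i j) => [le|/ltnW le] H ij;
      [exact: H|apply/esym/H => //; rewrite eq_sym].
  rewrite eq_sym eqn_mod_dvd ?leq_mul2l ?le_ij ?orbT// -mulnBr.
  rewrite Gauss_dvdr 1?coprime_sym//.
  have : (j - i < p)%N by apply: leq_ltn_trans (leq_subr _ _) (ltn_ord j).
  case: (posnP (j - i)%N) => [|pos lt /(dvdn_leq pos)]; last by rewrite leqNgt lt.
  by move=> /eqP; rewrite subn_eq0 => le_ji _ _; apply/eqP; rewrite eqn_leq le_ij.
rewrite [RHS](reindex_inj hinj) /=.
by apply: eq_bigr => i _; rewrite (periodic_mod gp).
Qed.

Lemma sum_shift_period (V : nmodType) (p c : nat) (g : nat -> V) :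
  (0 < p)%N -> periodic p g ->
  \sum_(0 <= l < p) g (c + l)%N = \sum_(0 <= l < p) g l.
Proof.
move=> p0 gp; rewrite -[RHS](@sum_coprime_step _ _ 1 c)//; last exact: coprime1n.
by apply: eq_bigr => i _; rewrite mul1n.
Qed.

Lemma sum_periods (V : nmodType) (p q : nat) (g : nat -> V) :
  periodic p g ->
  \sum_(0 <= l < q * p) g l = (\sum_(0 <= l < p) g l) *+ q.
Proof.
move=> gp; rewrite big_nat_mul.
rewrite (eq_bigr (fun=> \sum_(0 <= l < p) g l)); last first.
  move=> i _; rewrite -{1}[(i * p)%N]add0n mulSn big_addn addnK.
  by apply: eq_bigr => j _; rewrite (periodicM gp).
by rewrite big_const_nat subn0 iter_addr_0.
Qed.

(** Chinese remainder theorem: the pair of residues of [m] runs over all pairs. *)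
Lemma sum_coprime_mul (K : comPzRingType) (p q : nat) (f g : nat -> K) :
  (0 < q)%N -> coprime p q -> periodic p f -> periodic q g ->
  \sum_(0 <= m < p * q) f m * g m =
  (\sum_(0 <= m < p) f m) * (\sum_(0 <= m < q) g m).
Proof.
move=> q0 pq fp gq; rewrite mulnC big_nat_mul.
rewrite (eq_bigr (fun i => \sum_(0 <= j < p) f j * g (j + i * p)%N)); last first.
  move=> i _; rewrite -{1}[(i * p)%N]add0n mulSn big_addn addnK.
  by apply: eq_bigr => j _; rewrite (periodicM fp).
rewrite exchange_big /= mulr_suml; apply: eq_bigr => j _.
rewrite -mulr_sumr; congr (_ * _).
by rewrite -[RHS](sum_coprime_step j q0 pq gq); apply: eq_bigr => i _; rewrite mulnC.
Qed.

Lemma coprime_prodr (m k : nat) (p : 'I_k -> nat) :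
  (forall i, coprime m (p i)) -> coprime m (\prod_(i < k) p i).
Proof.
move=> h; apply: (big_ind (fun x => coprime m x)) => //; first exact: coprimen1.
by move=> x y; rewrite coprimeMr => -> ->.
Qed.

Lemma sum_coprime_prod (K : comPzRingType) (k : nat) (p : 'I_k -> nat)
    (g : 'I_k -> nat -> K) :
  (forall i, 0 < p i)%N -> (forall i j, i != j -> coprime (p i) (p j)) ->
  (forall i, periodic (p i) (g i)) ->
  \sum_(0 <= m < \prod_i p i) \prod_i g i m =
  \prod_i \sum_(0 <= m < p i) g i m.
Proof.
elim: k p g => [|k IH] p g p0 pco gp.
  by rewrite !big_ord0 big_nat1 big_ord0.
have perP : periodic (\prod_(i < k) p (widen_ord (leqnSn k) i))
    (fun m => \prod_(i < k) g (widen_ord (leqnSn k) i) m).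
  move=> t; apply: eq_bigr => i _.
  rewrite (bigD1 i) //= mulnC (periodicM (gp _)) //.
rewrite !big_ord_recr /= -IH//; last first.
  by move=> i j ij; apply: pco; apply: contra ij => /eqP /(congr1 val) /= h; apply/eqP/val_inj.
rewrite -(@sum_coprime_mul _ _ _ _ (g ord_max))//.
- by apply: eq_bigr => m _; rewrite big_ord_recr.
- rewrite coprime_sym; apply: coprime_prodr => i; apply: pco.
  by apply/eqP => /(congr1 val) /= h; move: (ltn_ord i); rewrite -h ltnn.
Qed.

Lemma dvdn_coprime_prod (k : nat) (p : 'I_k -> nat) (n : nat) :
  (forall i j, i != j -> coprime (p i) (p j)) -> (forall i, p i %| n)%N ->
  (\prod_i p i %| n)%N.
Proof.
elim: k p => [|k IH] p pco pn; first by rewrite big_ord0.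
rewrite big_ord_recr /= Gauss_dvd ?pn ?andbT.
  apply: IH => [i j ij|i]; last exact: pn.
  by apply: pco; apply: contra ij => /eqP /(congr1 val) /= h; apply/eqP/val_inj.
rewrite coprime_sym; apply: coprime_prodr => i; apply: pco.
by apply/eqP => /(congr1 val) /= h; move: (ltn_ord i); rewrite -h ltnn.
Qed.

(** * Words insensitive to independent shifts *)

Lemma norm_prod_sub_le (F : realDomainType) (k : nat) (a b : 'I_k -> F) :
  (forall j, `|a j| <= 1) -> (forall j, `|b j| <= 1) ->
  `|\prod_j a j - \prod_j b j| <= \sum_j `|a j - b j|.
Proof.
elim: k a b => [|k IH] a b a1 b1; first by rewrite !big_ord0 subrr normr0.
rewrite !big_ord_recr /=.
set A := \prod_(i < k) _; set B := \prod_(i < k) _.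
have AB : `|A - B| <= \sum_(i < k) `|a (widen_ord (leqnSn k) i) - b (widen_ord (leqnSn k) i)|.
  exact: IH.
have B1 : `|B| <= 1.
  rewrite normr_prod; apply: prodr_ile1 => i _; by rewrite normr_ge0 b1.
have -> : A * a ord_max - B * b ord_max =
  (A - B) * a ord_max + B * (a ord_max - b ord_max) by ring.
apply: le_trans (ler_normD _ _) _; rewrite !normrM; apply: lerD.
  by apply: le_trans AB; rewrite ler_piMr.
by rewrite ler_piMl.
Qed.

Lemma nat_mulrn (x n : nat) : x *+ n = (n * x)%N.
Proof. by elim: n => [|n IH]; rewrite ?mulr0n ?mulrS ?IH ?mulSn. Qed.

(** [y + (P - x)] stands for the difference [y - x] modulo [P]. *)
Lemma same_block_near (P B x y : nat) :
  (0 < B)%N -> (B <= P)%N -> (x < P)%N -> (y < P)%N -> (x %/ B = y %/ B)%N ->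
  (0 < ((y + (P - x)) %% P < B) + (P < (y + (P - x)) %% P + B))%N.
Proof.
move=> B0 BP xP yP e.
have := ltn_pmod x B0; have := ltn_pmod y B0.
have := divn_eq x B; have := divn_eq y B; rewrite e.
move: (x %% B)%N (y %% B)%N (y %/ B * B)%N => u v D ey ex ly lx.
clear e; have [le_xy|lt_yx] := leqP x y.
  have -> : ((y + (P - x)) %% P = y - x)%N.
    rewrite (_ : y + (P - x) = (y - x) + P)%N; last by lia.
    by rewrite modnDr modn_small//; lia.
  by rewrite (_ : (_ < B)%N = true)//; lia.
rewrite (modn_small (m := (y + (P - x))%N)); last by lia.
by rewrite (_ : (P < _)%N = true) ?addn1//; lia.
Qed.

Section block_word.
Variables (E : Type) (w : nat -> E) (p : nat -> nat) (q h : nat).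

(** A common multiple of all the periods: over a window of this length inside
    blocks of distinct types, the averages of the factors decouple. *)
Definition window_length : nat := \prod_(r < q) p r.
Definition block_length : nat := h * window_length.
Definition super_period : nat := q * block_length.
Definition block_type (t : nat) : nat := (t %/ block_length) %% q.
(** The word of period [p r] in blocks of type [r]; since the block length is a
    multiple of every [p r], the position of [t] inside its run is simply
    [t] modulo [p r]. *)
Definition block_word (t : nat) : E := w (t %% p (block_type t)).

Hypothesis q0 : (0 < q)%N.
Hypothesis h0 : (0 < h)%N.
Hypothesis p0 : forall r, (0 < p r)%N.

Lemma window_gt0 : (0 < window_length)%N.
Proof. by rewrite /window_length; apply: (big_ind (fun x => 0 < x)%N) => // x y; rewrite muln_gt0 => -> ->. Qed.

Lemma block_gt0 : (0 < block_length)%N.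
Proof. by rewrite muln_gt0 h0 window_gt0. Qed.

Lemma super_period_gt0 : (0 < super_period)%N.
Proof. by rewrite muln_gt0 q0 block_gt0. Qed.

Lemma block_type_lt t : (block_type t < q)%N.
Proof. by rewrite ltn_mod. Qed.

Lemma dvdn_window r : (r < q)%N -> (p r %| window_length)%N.
Proof. by move=> rq; rewrite /window_length (bigD1 (Ordinal rq)) //= dvdn_mulr. Qed.

Lemma dvdn_block r : (r < q)%N -> (p r %| block_length)%N.
Proof. by move=> rq; rewrite dvdn_mull// dvdn_window. Qed.

Lemma block_type_periodic : periodic super_period block_type.
Proof.
by move=> t; rewrite /block_type /super_period addnC divnMDl ?block_gt0// modnDl.
Qed.

Lemma block_word_periodic : periodic super_period block_word.
Proof.
move=> t; rewrite /block_word block_type_periodic.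
have /dvdnP[a e] : (p (block_type t) %| super_period)%N.
  by rewrite dvdn_mull// dvdn_block// block_type_lt.
by rewrite e addnC modnMDl.
Qed.


Lemma block_wordD t i : (t %% block_length + i < block_length)%N ->
  block_word (t + i) = w ((t + i) %% p (block_type t)).
Proof.
move=> lt; rewrite /block_word; congr (w (_ %% p _)).
rewrite /block_type {1}(divn_eq t block_length) -addnA divnMDl ?block_gt0//.
by rewrite (divn_small lt) addn0.
Qed.

Lemma block_typeS t : ~~ (p (block_type t.+1) %| t.+1)%N ->
  block_type t.+1 = block_type t.
Proof.
move=> ndvd; have /negbTE B : ~~ (block_length %| t.+1)%N.
  by apply: contra ndvd; apply: dvdn_trans; rewrite dvdn_block// block_type_lt.
by rewrite /block_type divnS ?block_gt0// B.
Qed.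

(** A window of [l] steps crosses the end of a block only when it starts in the
    last [l] places of a block; as [j] is invertible modulo the period, the
    times [c + j m] visit these places exactly as often as they should. *)
Lemma crossing_count (c j l : nat) : coprime j super_period ->
  (\sum_(0 <= m < super_period) (block_length < (c + j * m) %% block_length + l) <= q * l)%N.
Proof.
move=> cop; have qB : super_period = (q * block_length)%N by [].
have per : periodic block_length (fun t => (block_length < t %% block_length + l)%N : nat).
  by move=> t; rewrite modnDr.
have perP : periodic super_period (fun t => (block_length < t %% block_length + l)%N : nat).
  by move=> t; rewrite (periodicM per).
rewrite (@sum_coprime_step nat _ _ _ _ super_period_gt0 cop perP).
rewrite (sum_periods q per) nat_mulrn.
rewrite leq_mul2l; apply/orP; right.
rewrite (eq_big_nat _ _ (F2 := fun t => ((block_length < t + l)%N : nat))); last first.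
  by move=> t /andP[_ tB]; rewrite modn_small.
have [lB|Bl] := leqP l block_length; last first.
  rewrite (leq_trans (n := (\sum_(0 <= t < block_length) 1)%N)) ?leq_sum//.
    by move=> t _; case: (_ < _)%N.
  by rewrite sum_nat_const_nat subn0 muln1 ltnW.
rewrite (@big_cat_nat _ _ _ (block_length - l)%N) ?leq_subr//=.
rewrite big_nat big1 ?add0r ?add0n; last first.
  by move=> t /andP[_ tl]; rewrite ltnNge (_ : t + l <= block_length)%N//; lia.
rewrite (leq_trans (n := (\sum_(block_length - l <= t < block_length) 1)%N)) ?leq_sum//.
  by move=> t _; case: (_ < _)%N.
by rewrite sum_nat_const_nat muln1 subKn.
Qed.

(** If two times lie in blocks of the same type, their difference modulo the
    period is less than a block in absolute value.  This difference moves with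
    speed [j - i], which is invertible modulo the period, so it is that small
    for at most [2 * block_length] of the [q * block_length] values of [m]. *)
Lemma coincidence_count (c c' i j : nat) : (i < j)%N -> coprime (j - i) super_period ->
  (\sum_(0 <= m < super_period)
     (block_type (c + i * m) == block_type (c' + j * m)) <= 2 * block_length)%N.
Proof.
move=> ij cop; set P := super_period; have P0 : (0 < P)%N := super_period_gt0.
pose near t : nat := ((t %% P < block_length) + (P < t %% P + block_length))%N.
have pern : periodic P near by move=> t; rewrite /near modnDr.
(* [a] is the speed of the difference, [P.-1] playing the role of -1 modulo [P]. *)
pose a := ((j - i) + i * P)%N.
have copa : coprime a P by rewrite /coprime /a gcdnC addnC gcdnMDl gcdnC.
apply: (@leq_trans (\sum_(0 <= m < P) near (c' + c * P.-1 + a * m)%N)).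
  apply: leq_sum => m _; case: eqP => // e.
  rewrite /block_type !modn_divl -/P in e.
  set x := (c + i * m)%N in e; set y := (c' + j * m)%N in e.
  set Q := P.-1; have PE : P = Q.+1 by rewrite prednK.
  have -> : (c' + c * Q + a * m = y + x * Q)%N.
    rewrite /y /x /a [in (_ + i * P)%N]PE.
    have [d ->] : exists d, j = (i + d)%N by exists (j - i)%N; lia.
    by rewrite addKn; ring.
  have B0 := block_gt0.
  have BP : (block_length <= P)%N by rewrite leq_pmull.
  have zE : ((y + x * Q) %% P = (y %% P + (P - x %% P)) %% P)%N.
    have xP := ltn_pmod x P0.
    apply/eqP; rewrite -(eqn_modDr (x %% P)); apply/eqP.
    have -> : (y %% P + (P - x %% P) + x %% P = y %% P + P)%N.
      by rewrite -addnA subnK// ltnW.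
    rewrite modnDr modn_mod modnDmr -addnA -mulnSr -PE -modnDmr modnMl addn0//.
  by rewrite /near zE same_block_near ?ltn_mod.
rewrite (@sum_coprime_step nat _ _ _ _ P0 copa pern) /near big_split /= mul2n -addnn.
apply: leq_add.
  rewrite (eq_big_nat _ _ (F2 := fun t => ((t < block_length)%N : nat))); last first.
    by move=> t /andP[_ tB]; rewrite modn_small.
  rewrite (@big_cat_nat _ _ _ block_length) ?leq_pmull//=.
  rewrite [X in _ + X]big_nat [X in _ + X]big1 ?addr0; last first.
    by move=> t /andP[tl _]; rewrite ltnNge tl.
  rewrite (leq_trans (n := (\sum_(0 <= t < block_length) 1)%N)) ?leq_sum//.
    by move=> t _; case: (_ < _)%N.
  by rewrite sum_nat_const_nat subn0 muln1.
rewrite (eq_big_nat _ _ (F2 := fun t => ((P < t + block_length)%N : nat))); last first.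
  by move=> t /andP[_ tB]; rewrite modn_small.
have BP : (block_length <= P)%N by rewrite leq_pmull.
rewrite (@big_cat_nat _ _ _ (P - block_length)%N) ?leq_subr//=.
rewrite big_nat big1 ?add0r ?add0n; last first.
  by move=> t /andP[_ tl]; rewrite ltnNge (_ : t + block_length <= P)%N//; lia.
rewrite (leq_trans (n := (\sum_(P - block_length <= t < P) 1)%N)) ?leq_sum//.
  by move=> t _; case: (_ < _)%N.
by rewrite sum_nat_const_nat muln1 subKn.
Qed.


(** Inside blocks of pairwise distinct types the factors are periodic with
    pairwise coprime periods, and they are independent over a common multiple
    of these periods. *)
Lemma good_window_sum (F : realFieldType) (k : nat) (phi : 'I_k -> E -> F)
    (t : 'I_k -> nat) :
  (forall r r', (r < q)%N -> (r' < q)%N -> r != r' -> coprime (p r) (p r')) ->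
  (forall j, (0 < j <= k)%N -> coprime j super_period) ->
  (forall j : 'I_k, (t j %% block_length + j.+1 * window_length <= block_length)%N) ->
  injective (fun j => block_type (t j)) ->
  (\sum_(0 <= i < window_length) \prod_j phi j (block_word (t j + j.+1 * i))) / window_length%:R =
  \prod_j ((\sum_(0 <= i < p (block_type (t j))) phi j (w i)) /
            (p (block_type (t j)))%:R).
Proof.
move=> pco kco tB tinj.
pose pt j := p (block_type (t j)).
pose g (j : 'I_k) i := phi j (w ((t j + j.+1 * i) %% pt j)%N).
have gper j : periodic (pt j) (g j).
  by move=> i; rewrite /g mulnDr addnA -modnDmr modnMl addn0.
have ptco i j : i != j -> coprime (pt i) (pt j).
  by move=> ij; apply: pco; rewrite ?block_type_lt//; apply: contra ij => /eqP/tinj ->.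
have /dvdnP[d Ed] : (\prod_j pt j %| window_length)%N.
  by apply: dvdn_coprime_prod => // j; apply: dvdn_window; exact: block_type_lt.
rewrite (eq_big_nat _ _ (F2 := fun i => \prod_j g j i)); last first.
  move=> i /andP[_ iw]; apply: eq_bigr => j _; rewrite block_wordD//.
  by apply: leq_trans (tB j); rewrite ltn_add2l ltn_pmul2l.
have gprod : periodic (\prod_j pt j) (fun i => \prod_j g j i).
  move=> i; apply: eq_bigr => j _.
  by rewrite (bigD1 j) //= mulnC (periodicM (gper _)).
rewrite {1}Ed (sum_periods d gprod) sum_coprime_prod//; last by move=> j; exact: p0.
have d0 : (d%:R : F) != 0.
  by rewrite pnatr_eq0; apply: contraTN window_gt0 => /eqP d0; rewrite Ed d0.
rewrite -[_ *+ d]mulr_natr {1}Ed natrM invfM -mulrA mulVKf//.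
rewrite natr_prod -prodfV -big_split /=; apply: eq_bigr => j _.
congr (_ / _).
have jco : coprime j.+1 (pt j).
  have := kco j.+1 (ltn_ord j).
  have /dvdnP[e ->] : (pt j %| super_period)%N.
    by rewrite dvdn_mull// dvdn_block// block_type_lt.
  by rewrite coprimeMr => /andP[].
have per : periodic (pt j) (fun i => phi j (w (i %% pt j)%N)).
  by move=> i; rewrite modnDr.
have pt0 : (0 < pt j)%N by exact: p0.
rewrite /g (@sum_coprime_step F (pt j) j.+1 (t j) (fun i => phi j (w (i %% pt j)%N)))//.
by apply: eq_big_nat => i /andP[_ ip]; rewrite modn_small.
Qed.

(** Average over all windows: a window contributes the product of the
    frequencies, except when one of the times crosses the end of a block or two
    of them have the same type.  The proportion of exceptional windows is small
    uniformly in the shifts [c], which is the whole point. *)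
Lemma block_word_average (F : realFieldType) (k : nat) (phi : 'I_k -> E -> F)
    (a : 'I_k -> F) (delta : F) (c : 'I_k -> nat) :
  (forall r r', (r < q)%N -> (r' < q)%N -> r != r' -> coprime (p r) (p r')) ->
  (forall j, (0 < j <= k)%N -> coprime j super_period) ->
  (forall j e, `|phi j e| <= 1) -> (forall j, `|a j| <= 1) ->
  (forall j r, (r < q)%N ->
     `|(\sum_(0 <= i < p r) phi j (w i)) / (p r)%:R - a j| <= delta) ->
  `|(\sum_(0 <= m < super_period)
       \prod_j phi j (block_word (c j + j.+1 * m))) / super_period%:R -
    \prod_j a j| <= k%:R * delta + 2 * ((k * k)%:R * (h%:R^-1 + 2 * q%:R^-1)).
Proof.
move=> pco kco phi1 a1 adelta.
set P := super_period; have P0 : (0 < P)%N := super_period_gt0.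
have W0 : (0 < window_length)%N := window_gt0.
have w0 : 0 < window_length%:R :> F by rewrite ltr0n.
pose G m := \prod_j phi j (block_word (c j + j.+1 * m)).
have G1 m : `|G m| <= 1.
  by rewrite normr_prod; apply: prodr_ile1 => j _; rewrite normr_ge0 phi1.
have Gper : periodic P G.
  move=> m; apply: eq_bigr => j _.
  by rewrite mulnDr addnA (periodicM block_word_periodic).
pose cross m := (\sum_(j < k) (block_length < (c j + j.+1 * m) %% block_length + j.+1 * window_length))%N.
pose meet m := (\sum_(ij : 'I_k * 'I_k | (ij.1 < ij.2)%N)
  (block_type (c ij.1 + ij.1.+1 * m) == block_type (c ij.2 + ij.2.+1 * m)))%N.
have avg1 (f : nat -> F) n : (0 < n)%N -> (forall i, `|f i| <= 1) ->
    `|(\sum_(0 <= i < n) f i) / n%:R| <= 1.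
  move=> n0 f1; rewrite normrM normfV [ `|n%:R| ]ger0_norm// ler_pdivrMr ?ltr0n// mul1r.
  apply: le_trans (ler_norm_sum _ _ _) _.
  apply: (@le_trans _ _ (\sum_(0 <= i < n) 1)); first exact: ler_sum.
  by rewrite big_const_nat subn0 iter_addr_0.
have pa1 : `|\prod_j a j| <= 1.
  by rewrite normr_prod; apply: prodr_ile1 => j _; rewrite normr_ge0 a1.
have pointwise m :
    `|(\sum_(0 <= i < window_length) G (m + i)%N) / window_length%:R - \prod_j a j| <=
    k%:R * delta + 2 * (cross m + meet m)%:R.
  have [bad|] := posnP (cross m + meet m)%N; last first.
    move=> bad; apply: (@le_trans _ _ 2).
      by rewrite (le_trans (ler_normB _ _))// lerD// avg1.
    have [->|k0] := posnP k.
      by rewrite mul0r add0r ler_peMr// ler1n.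
    have d0 : 0 <= delta.
      by apply: le_trans (adelta (Ordinal k0) 0%N q0).
    by rewrite ler_wpDl ?mulr_ge0// ler_peMr// ler1n.
  have /andP[/eqP cross0 /eqP meet0] : (cross m == 0%N) && (meet m == 0%N).
    by rewrite -addn_eq0; apply/eqP.
  rewrite cross0 meet0 addn0 mulr0 addr0.
  have cB j : ((c j + j.+1 * m) %% block_length + j.+1 * window_length <= block_length)%N.
    move/eqP: cross0; rewrite sum_nat_eq0 => /forallP/(_ j) /=.
    by rewrite eqb0 -leqNgt.
  have cinj : injective (fun j : 'I_k => block_type (c j + j.+1 * m)).
    have lt_neq (i j : 'I_k) : (i < j)%N ->
        block_type (c i + i.+1 * m) != block_type (c j + j.+1 * m).
      move=> ij; move/eqP: meet0; rewrite sum_nat_eq0 => /forallP/(_ (i, j)) /=.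
      by rewrite ij /= eqb0.
    move=> i j /eqP eij; apply/val_inj; case: (ltngtP i j) => // ij; move: eij.
      by rewrite (negbTE (lt_neq _ _ ij)).
    by rewrite eq_sym (negbTE (lt_neq _ _ ij)).
  rewrite (eq_big_nat _ _ (F2 := fun i =>
     \prod_j phi j (block_word (c j + j.+1 * m + j.+1 * i)))); last first.
    by move=> i _; apply: eq_bigr => j _; rewrite mulnDr addnA.
  rewrite good_window_sum//.
  apply: le_trans (norm_prod_sub_le _ a1) _; first by move=> j; apply: avg1.
  apply: (@le_trans _ _ (\sum_(j < k) delta)).
    by apply: ler_sum => j _; apply: adelta; exact: block_type_lt.
  by rewrite sumr_const card_ord -[_ *+ _]mulr_natl.
have sumG : \sum_(0 <= m < P) G m =
    \sum_(0 <= m < P) (\sum_(0 <= i < window_length) G (m + i)%N) / window_length%:R.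
  have -> : \sum_(0 <= m < P) (\sum_(0 <= i < window_length) G (m + i)%N) / window_length%:R =
      (\sum_(0 <= i < window_length) \sum_(0 <= m < P) G (i + m)%N) / window_length%:R.
    rewrite -mulr_suml exchange_big /=; congr (_ / _).
    by apply: eq_bigr => i _; apply: eq_bigr => m _; rewrite addnC.
  rewrite [in RHS](eq_bigr (fun=> \sum_(0 <= m < P) G m)); last first.
    by move=> i _; apply: sum_shift_period.
  by rewrite big_const_nat subn0 iter_addr_0 -[_ *+ window_length]mulr_natr mulfK// gt_eqF.
have Pr0 : 0 < P%:R :> F by rewrite ltr0n.
have -> : (\sum_(0 <= m < P) G m) / P%:R - \prod_j a j =
   (\sum_(0 <= m < P) ((\sum_(0 <= i < window_length) G (m + i)%N) / window_length%:R - \prod_j a j)) / P%:R.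
  rewrite sumrB -sumG mulrBl; congr (_ - _).
  by rewrite big_const_nat subn0 iter_addr_0 -[_ *+ P]mulr_natr mulfK// gt_eqF.
rewrite normrM normfV [ `|P%:R| ]gtr0_norm// ler_pdivrMr//.
apply: le_trans (ler_norm_sum _ _ _) _.
apply: le_trans (ler_sum _ (fun m _ => pointwise m)) _.
rewrite big_split /= big_const_nat subn0 iter_addr_0 -mulr_sumr -natr_sum -[_ *+ P]mulr_natr [X in _ <= X]mulrDl.
rewrite lerD2l -mulrA ler_wpM2l//.
have crossP : (\sum_(0 <= m < P) cross m <= k * (q * (k * window_length)))%N.
  rewrite exchange_big /=; apply: (@leq_trans (\sum_(j < k) q * (k * window_length))%N).
    apply: leq_sum => j _; apply: leq_trans (crossing_count _ _ (kco j.+1 (ltn_ord j))) _.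
    by rewrite !leq_mul2l leq_mul2r ltn_ord !orbT.
  by rewrite sum_nat_const card_ord.
have meetP : (\sum_(0 <= m < P) meet m <= k * k * (2 * block_length))%N.
  rewrite exchange_big /=; apply: (@leq_trans (\sum_(ij : 'I_k * 'I_k) 2 * block_length)%N).
    rewrite big_mkcond /=; apply: leq_sum => -[i j] _ /=; case: ifP => // ij.
    apply: coincidence_count => //; apply: kco; rewrite subSS subn_gt0 ij /=.
    by apply: leq_trans (leq_subr _ _) _; apply: ltnW.
  by rewrite sum_nat_const card_prod card_ord.
have bad : (\sum_(0 <= m < P) (cross m + meet m) <= k * (q * (k * window_length)) + k * k * (2 * block_length))%N.
  by rewrite big_split /= leq_add.
apply: (@le_trans _ _ (k * (q * (k * window_length)) + k * k * (2 * block_length))%:R).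
  by rewrite ler_nat.
have hr0 : h%:R != 0 :> F by rewrite pnatr_eq0 -lt0n.
have qr0 : q%:R != 0 :> F by rewrite pnatr_eq0 -lt0n.
rewrite /P /super_period /block_length !natrD !natrM.
by rewrite le_eqVlt; apply/orP; left; apply/eqP; field; apply/andP; split.
Qed.

End block_word.

(** * Words following a permutation *)

(** A permutation with the largest number of matched points works.  If [v] is
    unmatched and its label [l] occurs as [alpha (pi u)] at an unmatched [u],
    swapping [u] and [v] improves the matching; so every occurrence
    of [l] in [alpha] is already used, and the unmatched points of label [l] are
    only those in excess. *)
Lemma matching_perm (V L : finType) (alpha beta : V -> L) :
  exists pi : {perm V},
    (#|[pred v | alpha (pi v) != beta v]| <=
     \sum_l (#|[pred v | beta v == l]| - #|[pred v | alpha v == l]|))%N.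
Proof.
pose matched (pi : {perm V}) := #|[pred v | alpha (pi v) == beta v]|.
have [pi _ pimax] := @arg_maxnP _ (1%g : {perm V}) predT matched isT.
exists pi.
rewrite -sum1_card (partition_big beta predT) //=; apply: leq_sum => l _.
rewrite sum1_card.
have [u /andP[/eqP au bu]|none] := pickP [pred u | (alpha (pi u) == l) && (beta u != l)].
  rewrite (eq_card0 (A := [pred v | (alpha (pi v) != beta v) && (beta v == l)]))// => v.
  apply/negbTE/negP => /andP[/= av /eqP bv].
  have uv : u != v by apply: contraNneq bu => ->; rewrite bv.
  have := pimax (tperm u v * pi)%g isT; rewrite /geq /= leqNgt => /negP; apply.
  rewrite /matched [X in (_ < X)%N](cardD1 v) inE /= permM tpermR au bv eqxx /= ltnS.
  apply: subset_leq_card; apply/fintype.subsetP => x; rewrite !inE => ax.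
  have xv : x != v by apply: contraNneq av => <-.
  have xu : x != u by apply: contraNneq bu => xu; rewrite -xu -(eqP ax) xu au.
  by rewrite xv permM tpermD ?ax// eq_sym.
have -> : #|[pred v | alpha v == l]| = #|[pred v | (alpha (pi v) == l) && (beta v == l)]|.
  rewrite -[RHS](card_imset _ (@perm_inj _ pi)); apply: eq_card => y; apply/idP/imsetP => /=.
    rewrite inE => ay; exists ((pi^-1)%g y); last by rewrite permKV.
    by have /= := none ((pi^-1)%g y); rewrite inE permKV ay /= => /negbFE.
  by move=> [x /andP[ax _] ->]; rewrite inE.
rewrite leq_subRL; last by apply: subset_leq_card; apply/fintype.subsetP => x; rewrite !inE => /andP[].
rewrite -[X in (_ <= X)%N](cardID [pred v | alpha (pi v) == l]) leq_add//.
  by apply: subset_leq_card; apply/fintype.subsetP => x; rewrite !inE => /andP[-> ->].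
apply: subset_leq_card; apply/fintype.subsetP => x; rewrite !inE => /andP[ax /eqP bx].
by rewrite -bx eqxx andbT; move: ax; rewrite ?inE.
Qed.

Lemma primes_above (M : nat) : exists p : nat -> nat,
  [/\ forall r, prime (p r), forall r, (M < p r)%N & injective p].
Proof.
pose next m := s2val (prime_above m).
have lt_next m : (m < next m)%N by rewrite /next; case: prime_above.
have pr_next m : prime (next m) by rewrite /next; case: prime_above.
pose p r := iter r.+1 next M.
have mono : {homo p : a b / (a < b)%N} by apply: homo_ltn => [? ? ?|r]; [exact: ltn_trans|exact: lt_next].
exists p; split=> [r|r|a b e]; first exact: pr_next.
- by elim: r => [|r IH]; [exact: lt_next|exact: ltn_trans IH (lt_next _)].
- by case: (ltngtP a b) => // /mono; rewrite e ltnn.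
Qed.

(** Only the last incomplete period contributes to the difference. *)
Lemma periodic_average (F : realFieldType) (n p : nat) (f : nat -> F) :
  (0 < n)%N -> (0 < p)%N -> periodic n f -> (forall i, `|f i| <= 1) ->
  `|(\sum_(0 <= i < p) f i) / p%:R - (\sum_(0 <= i < n) f i) / n%:R| <=
  (2 * n)%:R / p%:R.
Proof.
move=> n0 p0 fn f1.
have sum1 m : `|\sum_(0 <= i < m) f i| <= m%:R.
  apply: le_trans (ler_norm_sum _ _ _) _.
  apply: (@le_trans _ _ (\sum_(0 <= i < m) 1)); first exact: ler_sum.
  by rewrite big_const_nat subn0 iter_addr_0.
set a := (p %/ n)%N; set b := (p %% n)%N.
have pE : p = (a * n + b)%N by exact: divn_eq.
have bn : (b < n)%N by rewrite ltn_mod.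
set S := \sum_(0 <= i < n) f i.
have -> : \sum_(0 <= i < p) f i = S *+ a + \sum_(0 <= i < b) f i.
  rewrite pE (@big_cat_nat _ _ _ (a * n)%N) ?leq_addr//= sum_periods//; congr (_ + _).
  rewrite -{1}[(a * n)%N]add0n big_addn addKn.
  by apply: eq_bigr => i _; rewrite periodicM.
set T := \sum_(0 <= i < b) f i.
have nr0 : n%:R != 0 :> F by rewrite pnatr_eq0 -lt0n.
have pr0 : p%:R != 0 :> F by rewrite pnatr_eq0 -lt0n.
have -> : (S *+ a + T) / p%:R - S / n%:R = (T - b%:R * (S / n%:R)) / p%:R.
  have : p%:R = a%:R * n%:R + b%:R :> F by rewrite -natrM -natrD -pE.
  rewrite -[S *+ a]mulr_natl => e; set X := S / n%:R; have SE : S = X * n%:R by rewrite divfK.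
  by apply: (mulIf pr0); rewrite mulrBl !divfK// e SE; ring.
rewrite normrM normfV [ `|p%:R| ]ger0_norm// ler_wpM2r ?invr_ge0 ?ler0n// mul2n -addnn natrD.
apply: le_trans (ler_normB _ _) _; apply: lerD.
  by apply: le_trans (sum1 b) _; rewrite ler_nat ltnW.
rewrite normrM ger0_norm// normrM normfV [ `|n%:R| ]ger0_norm//.
rewrite -[leRHS]mulr1; apply: ler_pM.
- exact: ler0n.
- by rewrite divr_ge0// ?normr_ge0 ?ler0n.
- by rewrite ler_nat ltnW.
- by rewrite ler_pdivrMr ?ltr0n// mul1r sum1.
Qed.
(** Run [K] steps of [pi] from each point of [V] in turn.  Each step
    [v |-> pi^s v] is a bijection, so every point is visited exactly [K] times,
    and the word breaks with [pi] only once in [K] steps; the orbits of [pi]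
    need not be known.  This word is then read in blocks with prime periods. *)
Lemma perm_word (F : archiRealFieldType) (V : finType) (x0 : V) (pi : {perm V})
    (k : nat) (phi : 'I_k -> V -> F) (eps : F) :
  0 < eps -> (forall j v, `|phi j v| <= 1) ->
  exists (P : nat) (u : nat -> V),
    [/\ (0 < P)%N, periodic P u,
     forall x, `|(\sum_(0 <= t < P) (u t == x)%:R) / P%:R - #|V|%:R^-1| <= eps,
     (\sum_(0 <= t < P) (u t.+1 != pi (u t))%:R) / P%:R <= eps &
     forall c : 'I_k -> nat,
       `|(\sum_(0 <= m < P) \prod_j phi j (u (c j + j.+1 * m)%N)) / P%:R -
         \prod_j ((\sum_v phi j v) / #|V|%:R)| <= eps].
Proof.
move=> eps0 phi1.
set N := #|V|; have N0 : (0 < N)%N by apply/card_gt0P; exists x0.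
have [K K0 Keps] : exists2 K, (0 < K)%N & K%:R^-1 <= eps / 2.
  exists (Num.truncn (2 / eps)).+1 => //.
  rewrite invf_ple ?posrE ?divr_gt0 ?ltr0n// invf_div ltW//.
  exact: truncnS_gt.
set n := (N * K)%N; have n0 : (0 < n)%N by rewrite muln_gt0 N0.
pose k' := k.+1.
have [M [M0 Mk Meps]] : exists M, [/\ (0 < M)%N, (k' < M)%N &
    k'%:R * ((2 * n)%:R / M%:R) + 2 * ((k' * k')%:R * (M%:R^-1 + 2 * M%:R^-1)) <= eps / 2].
  pose A : F := k'%:R * (2 * n)%:R + 6 * (k' * k')%:R.
  exists (Num.truncn (2 * A / eps) + k'.+1)%N; rewrite addnS; split=> //.
    by rewrite ltnS leq_addl.
  set M := (_ + k').+1; have M0 : M%:R != 0 :> F by rewrite pnatr_eq0.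
  have -> : k'%:R * ((2 * n)%:R / M%:R) + 2 * ((k' * k')%:R * (M%:R^-1 + 2 * M%:R^-1)) =
     A / M%:R by rewrite /A; field.
  rewrite ler_pdivrMr ?ltr0n//.
  have : 2 * A / eps <= M%:R.
    apply: ltW; apply: (lt_le_trans (truncnS_gt _)).
    by rewrite ler_nat ltnS leq_addr.
  rewrite ler_pdivrMr// => h.
  by rewrite mulrAC ler_pdivlMr// mulrC [eps * _]mulrC.
have [p [pp Mp pinj]] := primes_above M.
pose q := p 0%N.
have p0 r : (0 < p r)%N by rewrite prime_gt0.
pose w i := (pi ^+ (i %% K))%g (nth x0 (enum V) ((i %/ K) %% N)).
pose P := super_period p q q.
have P0 : (0 < P)%N by apply: super_period_gt0 => *; exact: p0.
pose pos := block_word id p q q.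
have posper : periodic P pos by apply: block_word_periodic => *; exact: p0.
have wper : periodic n w.
  move=> t; rewrite /w /n addnC modnMDl.
  by rewrite divnMDl// modnDl.
have sumw (f : V -> F) : \sum_(0 <= i < n) f (w i) = (\sum_v f v) *+ K.
  rewrite big_nat_mul.
  rewrite (eq_big_nat _ _ (F2 := fun a => \sum_(0 <= b < K)
      f ((pi ^+ b)%g (nth x0 (enum V) a)))); last first.
    move=> a /andP[_ aN]; rewrite -{1}[(a * K)%N]add0n mulSn big_addn addnK.
    apply: eq_big_nat => b /andP[_ bK]; rewrite /w addnC modnMDl modn_small//.
    by rewrite divnMDl// divn_small// addn0 modn_small.
  rewrite exchange_big /= (eq_bigr (fun=> \sum_v f v)); last first.
    move=> b _.
    rewrite /N cardE -(big_nth x0 predT (fun v => f ((pi ^+ b)%g v))) big_enum /=.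
    by rewrite [RHS](reindex_inj (@perm_inj _ (pi ^+ b)%g)).
  by rewrite big_const_nat subn0 iter_addr_0.
have Nr0 : N%:R != 0 :> F by rewrite pnatr_eq0 -lt0n.
have Kr0 : K%:R != 0 :> F by rewrite pnatr_eq0 -lt0n.
have avgw (f : V -> F) :
    (\sum_(0 <= i < n) f (w i)) / n%:R = (\sum_v f v) / N%:R.
  by rewrite sumw -[_ *+ K]mulr_natr natrM; field; rewrite Nr0.
have pco r r' : (r < q)%N -> (r' < q)%N -> r != r' -> coprime (p r) (p r').
  move=> _ _ rr'; rewrite prime_coprime// dvdn_prime2//.
  by apply: contra rr' => /eqP/pinj ->.
have copP j : (0 < j <= k')%N -> coprime j P.
  move=> /andP[j0 jk]; have copj r : coprime j (p r).
    rewrite coprime_sym prime_coprime//; apply/negP => /(dvdn_leq j0).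
    by rewrite leqNgt (leq_ltn_trans jk)// (ltn_trans Mk)// Mp.
  rewrite /P /super_period /block_length /window_length !coprimeMr !copj /=.
  by apply: coprime_prodr => r.
pose delta : F := (2 * n)%:R / M%:R.
have stat k0 (psi : 'I_k0 -> nat -> F) (c : 'I_k0 -> nat) : (k0 <= k')%N ->
    (forall j, periodic n (psi j)) -> (forall j i, `|psi j i| <= 1) ->
    `|(\sum_(0 <= m < P) \prod_j psi j (pos (c j + j.+1 * m)%N)) / P%:R -
      \prod_j ((\sum_(0 <= i < n) psi j i) / n%:R)| <= eps / 2.
  move=> k0k psin psi1.
  apply: le_trans (@block_word_average _ id p q q (p0 0%N) (p0 0%N) p0 _ _ psi _ delta c pco _ psi1 _ _) _.
  - by move=> j /andP[j0 jk]; apply: copP; rewrite j0 (leq_trans jk).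
  - move=> j; rewrite normrM normfV [ `|n%:R| ]ger0_norm// ler_pdivrMr ?ltr0n// mul1r.
    apply: le_trans (ler_norm_sum _ _ _) _.
    apply: (@le_trans _ _ (\sum_(0 <= i < n) 1)); first exact: ler_sum.
    by rewrite big_const_nat subn0 iter_addr_0.
  - move=> j r _; apply: le_trans (periodic_average n0 (p0 r) (psin j) (psi1 j)) _.
    rewrite ler_wpM2l ?ler0n// lef_pV2 ?posrE ?ltr0n// ler_nat.
    exact: ltnW.
  - apply: le_trans Meps; have qM : q%:R^-1 <= M%:R^-1 :> F.
      by rewrite lef_pV2 ?posrE ?ltr0n ?(p0 0%N)// ler_nat ltnW// Mp.
    apply: lerD; first by rewrite ler_wpM2r ?divr_ge0// ler_nat.
    rewrite ler_wpM2l// ler_pM ?addr_ge0 ?mulr_ge0 ?invr_ge0 ?ler0n//.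
      by rewrite ler_nat leq_mul.
    by rewrite lerD// ler_wpM2l.
have stat1 (psi : nat -> F) : periodic n psi -> (forall i, `|psi i| <= 1) ->
    `|(\sum_(0 <= m < P) psi (pos m)) / P%:R - (\sum_(0 <= i < n) psi i) / n%:R| <= eps / 2.
  move=> psin psi1.
  have := @stat 1%N (fun=> psi) (fun=> 0%N) isT (fun=> psin) (fun=> psi1).
  rewrite !big_ord1; under eq_bigr do rewrite big_ord1 add0n mul1n.
  by [].
have le_eps : eps / 2 <= eps by rewrite [leRHS]splitr lerDl divr_ge0 ?ltW.
have b1 (b : bool) : `|b%:R| <= 1 :> F by case: b; rewrite ?normr0 ?normr1.
exists P, (w \o pos); split=> //.
- by move=> t /=; rewrite posper.
- move=> x.
  have := stat1 (fun i => (w i == x)%:R) _ (fun=> b1 _).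
  have sumx : \sum_v (v == x)%:R = 1 :> F.
    by rewrite (bigD1 x)//= eqxx big1 ?addr0// => v /negbTE ->.
  rewrite (avgw (fun v => (v == x)%:R)) sumx.
  rewrite mul1r => h; apply: le_trans (h _) le_eps.
  by move=> t; rewrite wper.
- pose psi i : F := (K %| i)%:R.
  have psin : periodic n psi by move=> i; rewrite /psi dvdn_addl// dvdn_mull.
  have psisum : (\sum_(0 <= i < n) psi i) / n%:R = K%:R^-1.
    have psiK : periodic K psi by move=> i; rewrite /psi dvdn_addl.
    rewrite (sum_periods N psiK) big_ltn// {1}/psi dvdn0 big_nat big1 ?addr0; last first.
      by move=> i /andP[i0 iK]; rewrite /psi gtnNdvd.
    by rewrite /= -[_ *+ N]mulr_natr natrM mulr1n invfM mul1r mulrA divff ?mul1r.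
  have := stat1 psi psin (fun=> b1 _); rewrite psisum => h.
  have : (\sum_(0 <= t < P) psi (pos t)) / P%:R <= eps.
    move: h; rewrite ler_norml => /andP[_]; rewrite lerBlDr => h.
    by apply: le_trans h _; rewrite [leRHS]splitr lerD2l.
  apply: le_trans; rewrite ler_wpM2r ?invr_ge0 ?ler0n//.
  have posP : periodic P (fun t => psi (pos t)) by move=> t; rewrite posper.
  rewrite -[leRHS](sum_shift_period 1 P0 posP) /=; apply: ler_sum => t _.
  rewrite add1n; apply: le_trans (_ : _ <= psi (pos t.+1)) _ => //.
  rewrite /psi ler_nat; case: (boolP (K %| _)%N) => [_|Kpos]; first by case: (_ != _).
  have pos0 : (pos t.+1 != 0)%N by apply: contraNneq Kpos => ->; rewrite dvdn0.
  have pdvd : ~~ (p (block_type p q q t.+1) %| t.+1)%N.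
    by move: pos0; rewrite /pos /block_word /dvdn.
  have bt : block_type p q q t.+1 = block_type p q q t.
    by apply: block_typeS => // *; exact: p0.
  have posS : pos t.+1 = (pos t).+1.
    by rewrite /pos /block_word /id modnS (negbTE pdvd) bt.
  rewrite posS /= in Kpos *; rewrite /w modnS divnS// (negbTE Kpos) add0n.
  by rewrite expgSr permM eqxx.
- move=> c.
  have := @stat k (fun j i => phi j (w i)) c (leqnSn k) _ (fun j i => phi1 j _).
  under [X in `|_ - X|]eq_bigr do rewrite (avgw (phi _)).
  move=> h; apply: le_trans (h _) le_eps.
  by move=> j t; rewrite wper.
Qed.

(** * Words with prescribed letter frequencies *)

Lemma card_tag_pred (I : finType) (n : I -> nat) (Q : pred I) :
  #|[pred v : {i : I & 'I_(n i)} | Q (tag v)]| = (\sum_(i | Q i) n i)%N.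
Proof.
rewrite -sum1_card.
transitivity (\sum_(i | Q i) \sum_(j : 'I_(n i)) 1)%N.
  rewrite sig_big_dep /=; apply: eq_bigl => v.
  by rewrite !inE andbT.
by apply: eq_bigr => i _; rewrite sum_nat_const card_ord muln1.
Qed.

(** The cells are [truncn (N1 * m e)] copies of each letter [e]; balance of
    [m] bounds by [#|L|] the excess of cells with second label [l] over those
    with first label [l], so the matching leaves few cells unmatched.  [eta] is the measure to be given to each level of the tower; it is
    chosen slightly too small, so that no letter is used more than its
    measure [m e] allows. *)
Lemma balanced_word (F : archiRealFieldType) (L : finType) (m : L * L -> F)
    (k : nat) (phi : 'I_k -> L -> F) (eps : F) :
  0 < eps -> (forall e, 0 <= m e) -> \sum_e m e = 1 ->
  (forall a, \sum_b m (a, b) = \sum_b m (b, a)) ->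
  (forall j a, `|phi j a| <= 1) ->
  exists (P : nat) (e : nat -> L * L) (eta a : F),
    [/\ [/\ (0 < P)%N, 0 < eta & `|a| <= 1], periodic P e,
      forall x, (\sum_(0 <= t < P) (e t == x)%:R) * eta <= m x,
      1 - eps <= P%:R * eta /\
      (\sum_(0 <= t < P) ((e t).2 != (e t.+1).1)%:R) * eta <= eps &
      forall c : 'I_k -> nat,
       `|(\sum_(0 <= i < P) \prod_j phi j (e (c j + j.+1 * i)%N).1) / P%:R - a|
         <= eps].
Proof.
move=> eps0 m0 m1 mbal phi1.
pose D := (#|L| * #|L|)%N.
pose N1 := (D + (Num.truncn (4 * D%:R / eps)).+1)%N.
pose n e := Num.truncn (m e * N1%:R).
have mN0 e : 0 <= m e * N1%:R by rewrite mulr_ge0.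
have n_le e : (n e)%:R <= m e * N1%:R by case/andP: (truncn_itv (mN0 e)).
have n_ge e : m e * N1%:R <= (n e)%:R + 1.
  by case/andP: (truncn_itv (mN0 e)) => _ /ltW; rewrite -natr1.
pose V := {e : L * L & 'I_(n e)}.
pose N := #|{: V}|.
have NE : N = (\sum_e n e)%N.
  rewrite /N -(@card_tag_pred (L * L)%type n predT); by apply: eq_card.
have N_le : N%:R <= N1%:R :> F.
  rewrite NE natr_sum; apply: (@le_trans _ _ (\sum_e m e * N1%:R)); first exact: ler_sum.
  by rewrite -mulr_suml m1 mul1r.
have N_ge : N1%:R <= N%:R + D%:R :> F.
  have -> : N1%:R = \sum_e m e * N1%:R by rewrite -mulr_suml m1 mul1r.
  rewrite NE natr_sum.
  apply: (@le_trans _ _ (\sum_e ((n e)%:R + 1))).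
    by apply: ler_sum => e _; exact: n_ge.
  by rewrite big_split /= sumr_const card_prod.
have N_gt : 4 * D%:R / eps < N%:R.
  apply: (lt_le_trans (truncnS_gt _)).
  by move: N_ge; rewrite /N1 natrD addrC lerD2r.
have N0 : (0 < N)%N.
  by rewrite -(ltr0n F); apply: le_lt_trans N_gt; rewrite divr_ge0// ?mulr_ge0// ltW.
have [x0 _] : exists x0 : V, x0 \in predT by apply/card_gt0P.
have Nr : 0 < N%:R :> F by rewrite ltr0n.
have N1r : 0 < N1%:R :> F by apply: lt_le_trans N_le.
have N1ge1 : 1 <= N1%:R :> F by rewrite ler1n -(ltr0n F).
have DN : D%:R / N%:R <= eps / 4.
  rewrite ler_pdivrMr// mulrAC ler_pdivlMr//; move: N_gt.
  by rewrite ltr_pdivrMr// => /ltW; rewrite mulrC [eps * _]mulrC.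
have DN1 : D%:R <= N1%:R :> F by rewrite ler_nat leq_addr.
pose tl (v : V) := (tag v).1; pose hd (v : V) := (tag v).2.
have [pi pibad] := matching_perm tl hd.
have badD : (#|[pred v | tl (pi v) != hd v]| <= D)%N.
  apply: leq_trans pibad _; apply: (@leq_trans (\sum_(l : L) #|L|)%N); last first.
    by rewrite sum_nat_const.
  apply: leq_sum => l _; rewrite leq_subLR.
  rewrite (@card_tag_pred (L * L)%type n (fun e => e.2 == l)).
  rewrite (@card_tag_pred (L * L)%type n (fun e => e.1 == l)).
  rewrite -(ler_nat F) natrD !natr_sum.
  have pr1 (f : L * L -> F) : \sum_(e | e.1 == l) f e = \sum_b f (l, b).
    transitivity (\sum_(a | a == l) \sum_b f (a, b)); last by rewrite big_pred1_eq.
    by rewrite pair_big /=; apply: eq_big => [[a b]|[a b]] //=; rewrite andbT.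
  have pr2 (f : L * L -> F) : \sum_(e | e.2 == l) f e = \sum_b f (b, l).
    transitivity (\sum_a \sum_(b | b == l) f (a, b)).
      by rewrite pair_big /=; apply: eq_big => [[a b]|[a b]].
    by apply: eq_bigr => a _; rewrite big_pred1_eq.
  rewrite pr1 pr2; apply: (@le_trans _ _ (\sum_b m (b, l) * N1%:R)); first exact: ler_sum.
  rewrite -mulr_suml -mbal mulr_suml.
  apply: (@le_trans _ _ (\sum_b ((n (l, b))%:R + 1))).
    by apply: ler_sum => b _; exact: n_ge.
  by rewrite big_split /= sumr_const lerD2l// -cardE.
(* Frequencies are multiplied by N1 in the end, whence the factor N1. *)
pose eps1 := eps / (8 * N1%:R).
have eps10 : 0 < eps1 by rewrite divr_gt0// mulr_gt0.
have N1eps1 : N1%:R * eps1 = eps / 8 by rewrite /eps1; field; rewrite gt_eqF.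
have Deps1 : D%:R * eps1 <= eps / 8 by rewrite -N1eps1 ler_wpM2r// ltW.
have eps1_le : eps1 <= eps / 8 by rewrite -N1eps1 ler_peMl// ltW.
have [P [u [P0 uper ucount utrans uavg]]] :=
  @perm_word F V x0 pi k (fun j v => phi j (tl v)) eps1 eps10 (fun j v => phi1 j _).
have Pr : 0 < P%:R :> F by rewrite ltr0n.
set Q : F := N1%:R * (N%:R^-1 + eps1).
have Q0 : 0 < Q by rewrite mulr_gt0// addr_gt0 ?invr_gt0.
have NN1 : N1%:R / N%:R <= 1 + eps / 4.
  apply: le_trans (_ : 1 + D%:R / N%:R <= _); last by rewrite lerD2l.
  by rewrite ler_pdivrMr// mulrDl mul1r divfK ?gt_eqF.
have Q1 : 1 <= Q.
  rewrite /Q mulrDr N1eps1; apply: (@le_trans _ _ (N1%:R / N%:R)).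
    by rewrite ler_pdivlMr// mul1r.
  by rewrite lerDl divr_ge0 ?ltW.
have Qe : Q <= 1 + eps.
  rewrite /Q mulrDr N1eps1.
  by apply: le_trans (lerD NN1 (lexx _)) _; lra.
(* A letter [e] has at most N1 * m e cells, each visited at most
   P * (1 / N + eps1) times. *)
pose eta := (P%:R * Q)^-1.
have eta0 : 0 < eta by rewrite invr_gt0 mulr_gt0.
have Peta : P%:R * eta = Q^-1.
  by rewrite /eta invfM mulrA divff ?mul1r// gt_eqF.
have Qi1 : Q^-1 <= 1 by rewrite invf_le1.
have ucount1 (x : V) : \sum_(0 <= t < P) (u t == x)%:R <= P%:R * (N%:R^-1 + eps1).
  have := ucount x; rewrite ler_norml => /andP[_]; rewrite lerBlDl ler_pdivrMr//.
  by rewrite [X in _ <= X]mulrC.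
have ucountA (A : pred V) : \sum_(0 <= t < P) (A (u t))%:R <= #|A|%:R * (P%:R * (N%:R^-1 + eps1)).
  have -> : \sum_(0 <= t < P) (A (u t))%:R = \sum_(x in A) \sum_(0 <= t < P) (u t == x)%:R :> F.
    rewrite exchange_big /=; apply: eq_bigr => t _.
    have [Au|Au] := boolP (A (u t)).
      rewrite (bigD1 (u t)) //= eqxx big1 ?addr0// => x /andP[_].
      by rewrite eq_sym => /negbTE ->.
    rewrite big1// => x Ax; case: eqP => // e; move: Au.
    by rewrite e; move: Ax; rewrite unfold_in => ->.
  apply: le_trans (ler_sum _ (fun x _ => ucount1 x)) _.
  by rewrite sumr_const -[_ *+ #|_|]mulr_natl.
exists P, (fun t => tag (u t)), eta, (\prod_(j < k) ((\sum_v phi j (tl v)) / N%:R)).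
split.
- split=> //; rewrite normr_prod; apply: prodr_ile1 => j _; rewrite normr_ge0 /=.
  rewrite normrM normfV [ `|N%:R| ]gtr0_norm// ler_pdivrMr// mul1r.
  apply: le_trans (ler_norm_sum _ _ _) _.
  apply: (@le_trans _ _ (\sum_(v : V) 1)); first by apply: ler_sum => v _; exact: phi1.
  by rewrite sumr_const.
- by move=> t /=; rewrite uper.
- move=> x; have := ucountA (fun v => tag v == x).
  rewrite -[#|_|]/#|[pred v : V | (fun e => e == x) (tag v)]| card_tag_pred big_pred1_eq => h.
  apply: le_trans (ler_wpM2r (ltW eta0) h) _.
  have -> : (n x)%:R * (P%:R * (N%:R^-1 + eps1)) * eta = (n x)%:R / N1%:R.
    rewrite /eta /Q; field.
    by rewrite !gt_eqF//= ?addr_gt0 ?invr_gt0// mulr_gt0.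
  by rewrite ler_pdivrMr.
- rewrite Peta; split.
    apply: (@le_trans _ _ (1 + eps)^-1); last by rewrite lef_pV2 ?posrE// ltr_wpDl ?ltW.
    rewrite -[leRHS]mul1r ler_pdivlMr ?addr_gt0//.
    by rewrite -subr_ge0 (_ : _ - _ = eps * eps); [rewrite mulr_ge0 ?ltW|ring].
  have : \sum_(0 <= t < P) ((tag (u t)).2 != (tag (u t.+1)).1)%:R <=
     \sum_(0 <= t < P) (u t.+1 != pi (u t))%:R +
     \sum_(0 <= t < P) (tl (pi (u t)) != hd (u t))%:R :> F.
    rewrite -big_split /=; apply: ler_sum => t _; rewrite -natrD ler_nat.
    have [->|_] := eqVneq (u t.+1) (pi (u t)); first by rewrite eq_sym.
    by rewrite addSn; case: (_ != _).
  move=> h; apply: le_trans (ler_wpM2r (ltW eta0) h) _.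
  have h1 : \sum_(0 <= t < P) (u t.+1 != pi (u t))%:R <= P%:R * eps1.
    by move: utrans; rewrite ler_pdivrMr// mulrC.
  have h2 := ucountA (fun v => tl (pi v) != hd v).
  have h3 : #|(fun v => tl (pi v) != hd v)|%:R * (P%:R * (N%:R^-1 + eps1)) <=
     P%:R * (D%:R * (N%:R^-1 + eps1)).
    rewrite mulrCA ler_pM2l// ler_pM2r ?ler_nat// addr_gt0 ?invr_gt0//.
  apply: le_trans (ler_wpM2r (ltW eta0) (lerD h1 (le_trans h2 h3))) _.
  rewrite -mulrDr mulrAC Peta.
  apply: (@le_trans _ _ (eps1 + D%:R * (N%:R^-1 + eps1))).
    rewrite ler_piMl//; apply: addr_ge0; first exact: ltW.
    by rewrite mulr_ge0// addr_ge0 ?invr_ge0 ?ltW.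
  rewrite mulrDr; apply: le_trans (lerD eps1_le (lerD DN Deps1)) _; lra.
- move=> c; apply: le_trans (uavg c) _.
  by apply: le_trans eps1_le _; lra.
Qed.

Local Open Scope classical_set_scope.

(** * The quantile map on binary sequences *)

(** The first [n] digits, last digit first, so that adding a digit is a [cons]. *)
Fixpoint bits (b : nat -> bool) (n : nat) : seq bool :=
  if n is n'.+1 then b n' :: bits b n' else [::].

Lemma size_bits b n : size (bits b n) = n.
Proof. by elim: n => //= n ->. Qed.

Lemma eq_bits (b b' : nat -> bool) : (forall n, bits b n = bits b' n) -> b = b'.
Proof. by move=> h; apply/funext => n; have [] := h n.+1. Qed.

Lemma drop_bits b m n : (n <= m)%N -> drop (m - n) (bits b m) = bits b n.
Proof.
move=> nm; rewrite -{2}(subnK nm); move: (m - n)%N => k.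
by elim: k => [|k IH]; rewrite ?drop0.
Qed.

Definition cylinder (s : seq bool) : set (nat -> bool) :=
  [set b | bits b (size s) = s].

Lemma bits_cylinder b n : cylinder (bits b n) b.
Proof. by rewrite /cylinder /= size_bits. Qed.

Lemma cylinder_cons c s : cylinder (c :: s) = cylinder s `&` [set b | b (size s) = c].
Proof.
apply/seteqP; split=> b; rewrite /cylinder /= => -[e1 e2]; first by split.
by rewrite e1 e2.
Qed.

Lemma cylinder_nil : cylinder [::] = setT.
Proof. by apply/seteqP; split. Qed.

(** The empty set is added to make the cylinders a pi-system. *)
Definition cylinders : set (set (nat -> bool)) :=
  [set D | D = set0 \/ exists s, D = cylinder s].

Definition code : Type := g_sigma_algebraType cylinders.
HB.instance Definition _ := Measurable.on code.

Lemma code_measurableE : @measurable _ code = <<s cylinders >>.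
Proof. by []. Qed.

Lemma measurable_cylinder s : measurable (cylinder s : set code).
Proof. by apply: sub_sigma_algebra; right; exists s. Qed.

Lemma cylinders_setI : setI_closed cylinders.
Proof.
move=> A B [->|[s ->]]; first by rewrite set0I; left.
move=> [->|[t ->]]; first by rewrite setI0; left.
have key s' t' : (size s' <= size t')%N -> cylinders (cylinder s' `&` cylinder t').
  move: s' t' => {}s {}t st; have [e|ne] := eqVneq (drop (size t - size s) t) s.
    right; exists t; apply/setIidPr => b /= bt.
    by rewrite /cylinder /= -(drop_bits b st) [bits b (size t)]bt.
  left; apply/seteqP; split=> // b [/= bs bt]; move/eqP: ne; apply.
  by rewrite -[RHS]bs -(drop_bits b st) [bits b (size t)]bt.
by have [/key//|/ltnW/key] := leqP (size s) (size t); rewrite setIC.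
Qed.

Lemma measurable_digit n : measurable ([set b : nat -> bool | b n] : set code).
Proof.
rewrite (_ : [set b : nat -> bool | b n] =
    \bigcup_(s : seq bool) (if size s == n then cylinder (true :: s) else set0)).
  apply: countable_bigcupT_measurable => //= s.
  by case: ifP => // _; exact: measurable_cylinder.
apply/seteqP; split=> [b /= bn|b [s _]].
  by exists (bits b n) => //=; rewrite size_bits eqxx cylinder_cons size_bits; split=> //; exact: bits_cylinder.
by case: eqP => // sn; rewrite cylinder_cons sn => -[].
Qed.

Section quantile.
Context (R : realType) (nu : {measure set code -> \bar R}).
Hypothesis nu_fin : (nu setT < +oo)%E.

Definition mass s : R := fine (nu (cylinder s)).

(** The total mass of the cylinders preceding [cylinder s] in the lexicographic
    order among those of the same depth. *)
Fixpoint lower (s : seq bool) : R :=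
  if s is c :: s' then lower s' + (if c then mass (false :: s') else 0) else 0.

Fixpoint quantile_bits (t : R) (n : nat) : seq bool :=
  if n is n'.+1 then let s := quantile_bits t n' in (lower (true :: s) <= t) :: s
  else [::].

(** The inverse of the distribution function of [nu] for the lexicographic
    order: [t] is sent to the sequence whose cylinders [s] all satisfy
    [lower s <= t < lower s + mass s]. *)
Definition quantile (t : R) : code :=
  fun n => lower (true :: quantile_bits t n) <= t.

Definition total_mass : R := mass [::].

Lemma fin_num_code (D : set code) : measurable D -> nu D \is a fin_num.
Proof.
move=> mD; rewrite ge0_fin_numE ?measure_ge0//.
by apply: le_lt_trans nu_fin; apply: le_measure; rewrite ?inE.
Qed.

Lemma mass_ge0 s : 0 <= mass s.
Proof. by rewrite fine_ge0 ?measure_ge0. Qed.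

Lemma mass_split s : mass s = mass (false :: s) + mass (true :: s).
Proof.
have mc := measurable_cylinder.
rewrite /mass -fineD ?fin_num_code//; congr fine.
rewrite -measureU//.
  congr (nu _); rewrite !cylinder_cons -setIUr; apply/esym/setIidPl => b _ /=.
  by case: (b _); [right|left].
by apply/seteqP; split=> // b; rewrite !cylinder_cons => -[[_ /= ->] []].
Qed.

Lemma lower_le s c : lower s <= lower (c :: s).
Proof. by rewrite lerDl; case: c => //=; rewrite mass_ge0. Qed.

Lemma lower_mass_le s : lower s + mass s <= total_mass.
Proof.
elim: s => [|c s IH]; first by rewrite add0r.
apply: le_trans IH; rewrite (mass_split s) /=; case: c; first by rewrite addrA.
by rewrite addr0 lerD2l lerDl mass_ge0.
Qed.

Lemma quantile_bitsE t n : bits (quantile t) n = quantile_bits t n.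
Proof. by elim: n => //= n ->. Qed.

Lemma quantile_cylinder s :
  `[0, total_mass[ `&` quantile @^-1` (cylinder s) = `[lower s, lower s + mass s[%classic.
Proof.
elim: s => [|c s IH].
  by rewrite cylinder_nil preimage_setT setIT/= add0r.
rewrite cylinder_cons preimage_setI setIA IH.
have qE t : `[lower s, lower s + mass s[%classic t ->
    quantile t (size s) = (lower s + mass (false :: s) <= t).
  by rewrite -IH => -[_ qs]; rewrite /quantile -quantile_bitsE [bits _ _]qs.
have m0 := mass_ge0 (false :: s); have m1 := mass_ge0 (true :: s).
have ms := mass_split s.
apply/seteqP; split=> t.
  move=> [st /=]; rewrite (qE _ st) => <- /=; move: st; rewrite /= !in_itv /=.
  by move=> /andP[h1 h2]; case: (leP (lower s + mass (false :: s)) t) => ht; apply/andP; split; lra.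
move=> ht; have st : `[lower s, lower s + mass s[%classic t.
  by move: ht; rewrite /= !in_itv /=; case: c => /andP[h1 h2]; apply/andP; split; lra.
split=> //; rewrite /= (qE _ st); move: ht; rewrite /= in_itv /=.
by case: c => /andP[h1 h2]; [apply/idP; lra|apply/negbTE; rewrite -ltNge; lra].
Qed.

Lemma measurable_quantile : measurable_fun setT quantile.
Proof.
apply: (@measurability _ _ _ code _ _ cylinders) => // _ [_ [->|[s ->]] <-].
  by rewrite preimage_set0 setI0.
rewrite setTI; elim: s => [|c s IH]; first by rewrite cylinder_nil preimage_setT.
rewrite cylinder_cons preimage_setI.
rewrite (_ : _ `&` _ = quantile @^-1` cylinder s `&`
    (if c then `[lower (true :: s), +oo[ else `]-oo, lower (true :: s)[)%classic).
  by apply: measurableI => //; case: (c).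
apply/seteqP; split=> t [st /=] h; split=> //; move: h; rewrite /quantile -quantile_bitsE;
  rewrite [bits _ _]st; case: c => /=; rewrite in_itv /= ?andbT.
- by move=> ->.
- by move=> /negbT; rewrite -ltNge.
- by move=> ->.
- by move=> h; apply/negbTE; rewrite -ltNge.
Qed.

(** Both sides are measures in [D] which agree on cylinders, where the
    left-hand side is the length of an interval. *)
Lemma quantile_measure (D : set code) : measurable D ->
  lebesgue_measure (`[0, total_mass[ `&` quantile @^-1` D) = nu D.
Proof.
move=> mD.
have mI : measurable (`[0, total_mass[%classic : set (measurableTypeR R)) by exact: measurable_itv.
pose m1 : {measure set code -> \bar R} :=
  measure_function_pushforward__canonical__measure_function_Measure
    (mrestr (@lebesgue_measure R) mI) measurable_quantile.
have m1E (A : set code) : m1 A = lebesgue_measure (`[0, total_mass[ `&` quantile @^-1` A).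
  by rewrite /m1 /= /pushforward /mrestr setIC.
have cyl s : m1 (cylinder s) = nu (cylinder s).
  rewrite m1E quantile_cylinder lebesgue_measure_itv /= lte_fin ltrDl.
  rewrite -(fineK (fin_num_code (measurable_cylinder s))) -/(mass s).
  have := mass_ge0 s; rewrite le_eqVlt => /orP[/eqP <-|->].
    by rewrite ltxx.
  by rewrite -EFinB addrAC subrr add0r.
rewrite -m1E.
have cT (k : nat) : cylinders setT by right; exists [::]; rewrite cylinder_nil.
have UT : \bigcup_(k : nat) [set: nat -> bool] = setT by rewrite bigcup_const//; exists 0%N.
apply: (@measure_unique _ R code cylinders (fun=> setT) code_measurableE
  cylinders_setI cT UT m1 nu) => //.
- by move=> A [->|[s ->]]; rewrite ?measure0.
- by move=> _; rewrite -[X in m1 X]cylinder_nil cyl cylinder_nil.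
Qed.

Hypothesis nu_atomless : forall b : code, nu [set b] = 0%E.

Lemma measurable_code1 (b : code) : measurable [set b].
Proof.
rewrite (_ : [set b] = \bigcap_n cylinder (bits b n)).
  by apply: bigcapT_measurable => n; exact: measurable_cylinder.
apply/seteqP; split=> [_ -> n _|c h]; first exact: bits_cylinder.
apply: eq_bits => n; have := h n I.
by rewrite /cylinder /= size_bits.
Qed.

(** The cylinders around [b] shrink to the point [b], which has no mass. *)
Lemma mass_bits_cvg0 (b : code) : mass (bits b n) @[n --> \oo] --> (0 : R).
Proof.
have mc n : measurable (cylinder (bits b n) : set code) by exact: measurable_cylinder.
have E : \bigcap_n cylinder (bits b n) = [set b].
  apply/seteqP; split=> [c h|_ -> n _]; last exact: bits_cylinder.
  apply: eq_bits => n; have := h n I.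
  by rewrite /cylinder /= size_bits.
have : (nu \o (fun n => cylinder (bits b n))) n @[n --> \oo] --> nu (\bigcap_n cylinder (bits b n)).
  apply: nonincreasing_cvg_mu => //.
  - by rewrite /= cylinder_nil.
  - by rewrite E; exact: measurable_code1.
  - apply/nonincreasing_seqP => n; apply/subsetPset.
    by rewrite [bits b n.+1]/= cylinder_cons => c [].
rewrite E nu_atomless => /fine_cvgP[_] /=.
exact.
Qed.

(** The left inverse of [quantile] on its domain; the absence of atoms makes the intervals
    attached to the cylinders around a sequence shrink to a point. *)
Definition code_rank (b : code) : R := limn (fun n => lower (bits b n)).

Lemma lower_bits_cvg (b : code) : lower (bits b n) @[n --> \oo] --> code_rank b.
Proof.
apply: nondecreasing_is_cvgn.
  by apply/nondecreasing_seqP => n; exact: lower_le.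
exists total_mass => _ [n _ <-].
by apply: le_trans (lower_mass_le (bits b n)); rewrite lerDl mass_ge0.
Qed.

Lemma measurable_code_rank : measurable_fun setT code_rank.
Proof.
apply: (@measurable_realfun.measurable_fun_cvg _ code R setT (fun n b => lower (bits b n)) code_rank); last first.
  by move=> b _; exact: lower_bits_cvg.
move=> n _ Y mY; rewrite setTI.
rewrite (_ : _ @^-1` _ = \bigcup_(s : seq bool)
   (if (size s == n) && `[< Y (lower s) >] then cylinder s else set0)).
  apply: countable_bigcupT_measurable => // s.
  by case: ifP => // _; exact: measurable_cylinder.
apply/seteqP; split=> [b /= Yb|b [s _]].
  exists (bits b n) => //=; rewrite size_bits eqxx asboolT//.
  exact: bits_cylinder.
case: ifP => // /andP[/eqP sn /asboolP Ys]; rewrite /cylinder /= sn => e.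
by rewrite e.
Qed.

Lemma quantileK t : 0 <= t < total_mass -> code_rank (quantile t) = t.
Proof.
move=> t0; have tI n : lower (bits (quantile t) n) <= t <
    lower (bits (quantile t) n) + mass (bits (quantile t) n).
  have : (`[0, total_mass[ `&` quantile @^-1` (cylinder (bits (quantile t) n))) t.
    by split; [rewrite /= in_itv|exact: bits_cylinder].
  by rewrite quantile_cylinder /= in_itv.
apply: cvg_lim => //.
apply: (@squeeze_cvgr _ _ _ _ (fun n => t - mass (bits (quantile t) n)) (cst t)).
- by apply: nearW => n; have /andP[h1 h2] := tI n; rewrite h1 andbT lerBlDr ltW.
- by rewrite -[X in _ --> X]subr0; apply: cvgB; [exact: cvg_cst|exact: mass_bits_cvg0].
- exact: cvg_cst.
Qed.

(** For sequences whose rank lies in the domain, the equation singles out the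
    range of [quantile]; this makes images under [quantile] measurable. *)
Lemma measurable_quantile_fixed : measurable [set b : code | quantile (code_rank b) = b].
Proof.
rewrite (_ : [set _ | _] = \bigcap_n
   (([set b : nat -> bool | b n] `&` (quantile \o code_rank) @^-1` [set b : nat -> bool | b n]) `|`
    (~` [set b : nat -> bool | b n] `&` (quantile \o code_rank) @^-1` (~` [set b : nat -> bool | b n])))).
  have mqr : measurable_fun setT (quantile \o code_rank).
    exact: measurableT_comp measurable_quantile measurable_code_rank.
  have mp (D : set code) : measurable D -> measurable ((quantile \o code_rank) @^-1` D).
    by move=> mD; rewrite -[X in measurable X]setTI; exact: mqr.
  apply: bigcapT_measurable => n; have md := measurable_digit n.
  apply: measurableU; apply: measurableI.
  - exact: md.
  - exact: mp.
  - exact: measurableC.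
  - by apply: mp; exact: measurableC.
apply/seteqP; split=> [b /= e n _|b h].
  by rewrite /= /preimage /= e; have [bn|bn] := pselect (b n); [left|right].
apply/funext => n; have := h n I; rewrite /preimage /=.
by case: (quantile _ n) (b n) => [] [] [] [].
Qed.

End quantile.

(** * Codes of points of a complete separable space *)

Lemma measurable_code_forall (P : nat -> code -> Prop) :
  (forall n, measurable [set b | P n b]) -> measurable [set b | forall n, P n b].
Proof.
move=> mP; rewrite (_ : [set _ | _] = \bigcap_n [set b | P n b]).
  exact: bigcapT_measurable.
by apply/seteqP; split=> b h; [move=> n _; exact: h|move=> n; exact: h n I].
Qed.

Lemma measurable_code_exists (P : nat -> code -> Prop) :
  (forall n, measurable [set b | P n b]) -> measurable [set b | exists n, P n b].
Proof.
move=> mP; rewrite (_ : [set _ | _] = \bigcup_n [set b | P n b]).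
  exact: bigcupT_measurable.
by apply/seteqP; split=> b [n]; [exists n|move=> _; exists n].
Qed.

Lemma measurable_code_prop (Q : Prop) : measurable [set b : code | Q].
Proof.
have [q|nq] := pselect Q.
  by rewrite (_ : [set _ | _] = setT); [exact: measurableT|apply/seteqP; split].
by rewrite (_ : [set _ | _] = set0); [exact: measurable0|apply/seteqP; split].
Qed.

Lemma measurable_code_and (P Q : code -> Prop) :
  measurable [set b | P b] -> measurable [set b | Q b] -> measurable [set b | P b /\ Q b].
Proof. by move=> mP mQ; exact: measurableI. Qed.

Lemma measurable_code_imply (P Q : code -> Prop) :
  measurable [set b | P b] -> measurable [set b | Q b] -> measurable [set b | P b -> Q b].
Proof.
move=> mP mQ; rewrite (_ : [set _ | _] = ~` [set b | P b] `|` [set b | Q b]).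
  by apply: measurableU => //; exact: measurableC.
apply/seteqP; split=> b /=; first by have [Pb PQ|nPb _] := pselect (P b); [right; exact: PQ|left].
by case.
Qed.

Section image.
Context (R : realType) (Y : completePseudoMetricType R) (U : nat -> set Y).
Hypothesis oU : forall n, open (U n).
Hypothesis basisU : forall (y : Y) (e : R), 0 < e -> exists n, U n y /\ U n `<=` ball y e.

Let small k n := forall x y, U n x -> U n y -> ball x (k.+1%:R^-1 : R) y.
Let meets m n := exists x, U m x /\ U n x.
Let inside m n := exists2 e : R, 0 < e & forall x, U m x -> ball x e `<=` U n.

Definition base_code (y : Y) : code := fun n => `[< U n y >].

(** The first two conditions say that the selected sets have points which
    form a Cauchy sequence; the last two say that a basic set is selected
    exactly when it contains, with some room, a selected set, hence exactly when
    it contains the limit.  Only countably many conditions on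
    digits occur. *)
Definition base_code_image : set code :=
  [set b | (forall k, exists n, small k n /\ b n) /\
    (forall m n, b m -> b n -> meets m n) /\
    (forall n, b n -> exists m, inside m n /\ b m) /\
    (forall m n, inside m n -> b m -> b n)].

Lemma measurable_base_code_image : measurable base_code_image.
Proof.
have md n : measurable [set b : code | b n] := measurable_digit n.
apply: measurable_code_and.
  apply: measurable_code_forall => k; apply: measurable_code_exists => n.
  by apply: measurable_code_and => //; exact: measurable_code_prop.
apply: measurable_code_and.
  do 2 (apply: measurable_code_forall => ?).
  do 2 (apply: measurable_code_imply => //).
  exact: measurable_code_prop.
apply: measurable_code_and.
  apply: measurable_code_forall => n; apply: measurable_code_imply => //.
  apply: measurable_code_exists => m.
  by apply: measurable_code_and => //; exact: measurable_code_prop.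
do 2 (apply: measurable_code_forall => ?).
apply: measurable_code_imply; first exact: measurable_code_prop.
exact: measurable_code_imply.
Qed.

Lemma small_radius (e : R) : 0 < e -> exists k : nat, k.+1%:R^-1 < e.
Proof.
move=> e0; exists (Num.truncn e^-1).
by rewrite invf_plt ?posrE//; exact: truncnS_gt.
Qed.

(** This is the only use of completeness, and it replaces the theorem that
    injective Borel images of Polish spaces are Borel. *)
Lemma base_code_imageP (b : code) : base_code_image b <-> exists y, b = base_code y.
Proof.
split; last first.
  move=> [y ->]; split; [|split; [|split]].
  - move=> k; have e0 : 0 < (k.+1%:R^-1 / 2 : R) by rewrite divr_gt0// invr_gt0 ltr0n.
    have [n [ny nb]] := basisU y e0; exists n; split; last exact/asboolP.
    move=> x x' /nb h /nb h'; rewrite (splitr k.+1%:R^-1).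
    by apply: (pseudometric_structure.ball_triangle _ h'); exact: pseudometric_structure.ball_sym.
  - by move=> m n /asboolP my /asboolP ny; exists y.
  - move=> n /asboolP ny.
    have /nbhs_ballP[e /= e0 eU] : nbhs y (U n) by exact: open_nbhs_nbhs.
    have e20 : 0 < e / 2 by rewrite divr_gt0.
    have [m [my mb]] := basisU y e20; exists m; split; last exact/asboolP.
    exists (e / 2) => // x /mb yx z xz; apply: eU.
    by rewrite (splitr e); exact: pseudometric_structure.ball_triangle xz.
  - move=> m n [e e0 mn] /asboolP my; apply/asboolP.
    by apply: (mn _ my); exact: ballxx.
move=> [bsmall [bmeet [bin bout]]].
have [nk nkP] := choice bsmall.
have exx k : exists z, U (nk k) z.
  by have [_ bk] := nkP k; have [z [zk _]] := bmeet _ _ bk bk; exists z.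
have [x xP] := choice exx.
have near_x k m : b m -> exists z, U m z /\ ball z (k.+1%:R^-1 : R) (x k).
  move=> bm; have [sk bk] := nkP k; have [z [zm zk]] := bmeet _ _ bm bk.
  by exists z; split=> //; exact: sk.
have harm (e : R) : 0 < e -> \forall k \near \oo, (k.+1%:R^-1 : R) < e.
  move=> e0; have [k0 h] := small_radius e0; exists k0 => // k /= k0k.
  by apply: le_lt_trans h; rewrite lef_pV2 ?posrE ?ltr0n// ler_nat.
have cx : cauchy (x @ \oo).
  apply: (@cauchy_exP R Y) => e e0.
  have e20 : 0 < e / 2 by rewrite divr_gt0.
  have [K _ hK] := harm _ e20; exists (x K); exists K => // l /= Kl.
  have [sK bK] := nkP K; have [sl bl] := nkP l.
  have [z [zK zl]] := bmeet _ _ bK bl.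
  rewrite (splitr e); apply: (@pseudometric_structure.ball_triangle _ _ z).
    by apply: pseudometric_structure.le_ball (sK _ _ (xP K) zK); apply/ltW/hK => /=.
  by apply: pseudometric_structure.le_ball (sl _ _ zl (xP l)); apply/ltW/hK.
have xy : x @ \oo --> (lim (x @ \oo) : Y) by exact: cauchy_cvg cx.
set y : Y := lim _ in xy.
have {}xy (e : R) : 0 < e -> \forall k \near \oo, ball y e (x k).
  by move=> e0; have /cvg_ballP := xy; exact.
exists y; apply/funext => n; apply/idP/asboolP.
  move=> /bin[m [[e e0 mn] bm]].
  have e20 : 0 < e / 2 by rewrite divr_gt0.
  have [k [h1 h2]] : exists k, (k.+1%:R^-1 : R) < e / 2 /\ ball y (e / 2) (x k).
    have [k _ hk] : \forall k \near \oo, (k.+1%:R^-1 : R) < e / 2 /\ ball y (e / 2) (x k).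
      by apply: filterS2 (harm _ e20) (xy _ e20) => k.
    by exists k; apply: (hk k) => /=.
  have [z [zm zx]] := near_x k m bm.
  apply: (mn z zm); rewrite (splitr e).
  apply: (pseudometric_structure.ball_triangle (y := x k)).
    exact: pseudometric_structure.le_ball (ltW h1) _ zx.
  exact: pseudometric_structure.ball_sym.
move=> ny; have /nbhs_ballP[e /= e0 eU] : nbhs y (U n) by exact: open_nbhs_nbhs.
have e20 : 0 < e / 2 by rewrite divr_gt0.
have e40 : 0 < e / 2 / 2 by rewrite divr_gt0.
have [k [h1 h2]] : exists k, (k.+1%:R^-1 : R) < e / 2 / 2 /\ ball y (e / 2 / 2) (x k).
  have [k _ hk] : \forall k \near \oo, (k.+1%:R^-1 : R) < e / 2 / 2 /\ ball y (e / 2 / 2) (x k).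
    by apply: filterS2 (harm _ e40) (xy _ e40) => k.
  by exists k; apply: (hk k) => /=.
have [sk bk] := nkP k; apply: bout bk; exists (e / 2) => // z zk w zw.
apply: eU; rewrite (splitr e); apply: pseudometric_structure.ball_triangle zw.
rewrite (splitr (e / 2)); apply: (pseudometric_structure.ball_triangle h2).
exact: pseudometric_structure.le_ball (ltW h1) _ (sk _ _ (xP k) zk).
Qed.

End image.

(** * Parametrizing measurable sets by intervals *)

Definition set_code (X : Type) (A : nat -> set X) (x : X) : code :=
  fun n => `[< A n x >].

(** The sets of this form constitute a sigma-algebra containing every [A n]. *)
Lemma set_code_preimage (X : Type) (A : nat -> set X) (D : set X) :
  <<s range A >> D -> exists2 E : set code, measurable E & set_code A @^-1` E = D.
Proof.
move: D; suff : <<s range A >> `<=`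
    [set D | exists2 E : set code, measurable E & set_code A @^-1` E = D] by [].
apply: smallest_sub; last first.
  move=> _ [n _ <-]; exists [set b : nat -> bool | b n]; first exact: measurable_digit.
  by apply/seteqP; split=> x /asboolP.
split.
- by exists set0; [exact: measurable0|rewrite preimage_set0].
- move=> B [E mE <-]; exists (~` E); first exact: measurableC.
  by rewrite setTD preimage_setC.
- move=> F FE.
  have [E EP] := choice (P := fun n E => measurable E /\ set_code A @^-1` E = F n)
    (fun n => let: ex_intro2 E mE eE := FE n in ex_intro _ E (conj mE eE)).
  exists (\bigcup_n E n); first by apply: bigcupT_measurable => n; case: (EP n).
  by rewrite preimage_bigcup; apply: eq_bigcupr => n _; case: (EP n).
Qed.

Lemma standard_borel_code (R : realType) d (X : measurableType d) :
  standard_borel R X -> exists (A : nat -> set X) (Img : set code),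
    [/\ @measurable d X = <<s range A >>,
        forall x y, set_code A x = set_code A y -> x = y,
        measurable Img &
        forall b, Img b <-> exists x, b = set_code A x].
Proof.
move=> [Y [hY [B /countable_injP[h hinj] [oB cB]] [f [g fK gK] fmeas]]].
pose U n := \bigcup_(V in [set V | B V /\ h V = n]) V.
have UE V : B V -> U (h V) = V.
  move=> BV; apply/seteqP; split=> y; last by exists V.
  by move=> [W [BW hW] Wy]; rewrite -(hinj W V) ?inE.
have oU n : open (U n) by apply: bigcup_open => V [BV _]; exact: oB.
have basisU (y : Y) (O : set Y) : nbhs y O -> exists n, U n y /\ U n `<=` O.
  by move=> /cB[V [BV Vy] VO]; exists (h V); rewrite UE.
have opensU : <<s @open Y >> = <<s range U >>.
  apply/seteqP; split; apply: smallest_sub; try exact: smallest_sigma_algebra.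
    move=> O oO; rewrite (_ : O = \bigcup_(n in [set n | U n `<=` O]) U n).
      rewrite bigcup_mkcond; apply: sigma_algebra_bigcup => n.
      case: ifP => _; last exact: sigma_algebra0.
      by apply: sub_sigma_algebra; exists n.
    apply/seteqP; split=> y; last by move=> [n /= nO ny]; exact: nO.
    by move=> Oy; have [n [ny nO]] := basisU y O (open_nbhs_nbhs (conj oO Oy)); exists n.
  by move=> _ [n _ <-]; apply: sub_sigma_algebra; exact: oU.
have measE : @measurable d X = <<s range (fun n => f @^-1` U n) >>.
  apply/seteqP; split=> D.
    move=> /fmeas[E]; rewrite opensU => sE ->; move: E sE.
    suff : <<s range U >> `<=` [set E | <<s range (fun n => f @^-1` U n) >> (f @^-1` E)] by [].
    apply: smallest_sub; last first.
      by move=> _ [n _ <-]; apply: sub_sigma_algebra; exists n.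
    split=> /=.
    - by rewrite preimage_set0; exact: sigma_algebra0.
    - by move=> E hE; rewrite setTD preimage_setC; exact: sigma_algebraC.
    - by move=> F hF; rewrite preimage_bigcup; exact: sigma_algebra_bigcup.
  apply: smallest_sub; first exact: sigma_algebra_measurable.
  move=> _ [n _ <-]; apply/fmeas; exists (U n) => //.
  by rewrite opensU; apply: sub_sigma_algebra; exists n.
exists (fun n => f @^-1` U n), (base_code_image U); split=> //.
- move=> x x' e; rewrite -(fK x) -(fK x'); congr g; apply: hY => O O' /basisU[n [nx nO]] nO'.
  exists (f x'); split; last exact: nbhs_singleton nO'.
  apply: nO; have := congr1 (fun b => b n) e; rewrite /set_code /= => h'.
  by apply/asboolP; rewrite -[`[< _ >]]h'; exact/asboolP.
- exact: measurable_base_code_image.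
- move=> b; rewrite base_code_imageP//; last first.
    by move=> y e e0; apply: basisU; exact: pseudometric_structure.nbhsx_ballx.
  split=> [[y ->]|[x ->]]; last by exists (f x).
  by exists (g y); apply/funext => n; rewrite /base_code /set_code /preimage /= gK.
Qed.

(** Push the measure restricted to [C] to the space of codes and pull it
    back to an interval by the quantile map.  [I] consists of the parameters whose
    code is the code of a point of [C]; it has full measure because the
    codes of points form a measurable set.  Images are measurable because the
    quantile map has the measurable left inverse [code_rank]. *)
Lemma parametrization (R : realType) d (X : measurableType d) (mu : probability X R)
    (C : set X) :
  standard_borel R X -> nonatomic mu -> measurable C ->
  exists (c : R -> X) (I : set (measurableTypeR R)),
    [/\ measurable I, I `<=` `[0, fine (mu C)[, lebesgue_measure I = mu C,
        (forall s, I s -> C (c s)) /\ {in I &, injective c} &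
        (forall D, measurable D -> measurable (I `&` c @^-1` D)) /\
        (forall B, measurable B -> B `<=` I ->
           measurable (c @` B) /\ mu (c @` B) = lebesgue_measure B)].
Proof.
move=> sX nmu mC.
have [A [Img [mE inj mImg ImgP]]] := standard_borel_code sX.
have mA n : measurable (A n) by rewrite mE; apply: sub_sigma_algebra; exists n.
pose phi : X -> code := set_code A.
have mphi : measurable_fun setT phi.
  apply: (@measurability _ _ _ code _ _ cylinders) => // _ [_ [->|[s ->]] <-].
    by rewrite preimage_set0 setI0.
  rewrite setTI; elim: s => [|c s IH]; first by rewrite cylinder_nil preimage_setT.
  rewrite cylinder_cons preimage_setI; apply: measurableI => //.
  have -> : phi @^-1` [set b | b (size s) = c] = if c then A (size s) else ~` A (size s).
    apply/seteqP; split=> x; rewrite /preimage /phi /set_code /=; case: c => /=.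
    - by move=> /asboolP.
    - by move=> /negbT/asboolPn.
    - by move=> h; apply/asboolP.
    - by move=> h; apply/negbTE/asboolPn.
  by case: c => //; exact: measurableC.
pose nu : {measure set code -> \bar R} :=
  measure_function_pushforward__canonical__measure_function_Measure (mrestr mu mC) mphi.
have nuE D : nu D = mu (C `&` phi @^-1` D).
  by rewrite /nu /= /pushforward /mrestr setIC.
have nuT : nu setT = mu C by rewrite nuE preimage_setT setIT.
have nu_fin : (nu setT < +oo)%E by rewrite nuT ltey_eq fin_num_measure.
have mX1 (x : X) : measurable [set x].
  rewrite (_ : [set x] = phi @^-1` [set phi x]); last first.
    by apply/seteqP; split=> [_ ->//|y /inj].
  by rewrite -[X in measurable X]setTI; apply: (mphi) => //; exact: measurable_code1.
have mu1 (x : X) : mu [set x] = 0%E.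
  apply/eqP; apply: contraT => nz.
  have [|B [mB Bx B0 Blt]] := nmu _ (mX1 x); first by rewrite lt_neqAle eq_sym nz measure_ge0.
  exfalso; move: B0 Blt; have [Bxx|nBx] := pselect (B x).
    have -> : B = [set x] by apply/seteqP; split=> // _ ->.
    by rewrite ltxx.
  have -> : B = set0 by apply/seteqP; split=> // y By; apply: nBx; rewrite -(Bx _ By).
  by rewrite measure0 ltxx.
have nu1 (b : code) : nu [set b] = 0%E.
  rewrite nuE; have [[x bx]|nx] := pselect (exists x, b = phi x).
    apply/eqP; rewrite eq_le measure_ge0 andbT -(mu1 x).
    apply: le_measure; rewrite ?inE//.
      apply: measurableI => //; rewrite -[X in measurable X]setTI.
      by apply: (mphi) => //; exact: measurable_code1.
    by move=> y [_]; rewrite /preimage /= bx => /inj.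
  rewrite (_ : _ `&` _ = set0) ?measure0//.
  by apply/seteqP; split=> // y [_ yb]; apply: nx; exists y.
have totE : total_mass nu = fine (mu C) by rewrite /total_mass /mass cylinder_nil nuT.
have [DC mDC DCE] : exists2 E : set code, measurable E & phi @^-1` E = C.
  by apply: set_code_preimage; rewrite -mE.
pose c (s : R) : X := xget point [set x | quantile nu s = phi x].
have cP s : Img (quantile nu s) -> phi (c s) = quantile nu s.
  move=> /ImgP[x qx]; rewrite /c; case: xgetP => [y _ <-//|/(_ x)].
  by case.
have mq (D : set code) : measurable D -> measurable (quantile nu @^-1` D : set (measurableTypeR R)).
  by move=> mD; rewrite -[X in measurable X]setTI; apply: measurable_quantile.
have mI0 : measurable (`[0, total_mass nu[%classic : set (measurableTypeR R)) by exact: measurable_itv.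
pose I : set (measurableTypeR R) := `[0, total_mass nu[ `&` quantile nu @^-1` (Img `&` DC).
have mI : measurable I by apply: measurableI => //; apply: mq; exact: measurableI.
have cphi s : I s -> phi (c s) = quantile nu s by move=> [_ [/cP]].
have qK s : I s -> code_rank nu (quantile nu s) = s.
  by move=> [s0 _]; apply: quantileK => //; move: s0; rewrite /= in_itv.
have preI D E : phi @^-1` E = D -> I `&` c @^-1` D = I `&` quantile nu @^-1` E.
  by move=> ED; apply/seteqP; split=> s [Is]; rewrite -ED /preimage /= cphi.
have mpre D : measurable D -> measurable (I `&` c @^-1` D).
  move=> mD; have [E mE' ED] : exists2 E : set code, measurable E & phi @^-1` E = D.
    by apply: set_code_preimage; rewrite -mE.
  by rewrite (preI _ _ ED); apply: measurableI => //; exact: mq.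
have lebI D E : measurable D -> measurable E -> phi @^-1` E = D ->
    lebesgue_measure (I `&` c @^-1` D) = mu (C `&` D).
  move=> mD mE' ED; rewrite (preI _ _ ED) /I -setIA -preimage_setI quantile_measure//; last first.
    by do 2 apply: measurableI => //.
  rewrite nuE; congr (mu _); rewrite !preimage_setI ED DCE.
  apply/seteqP; split=> x; first by case=> Cx [] [].
  by case=> Cx Dx; split=> //; split=> //; split=> //; apply/ImgP; exists x.
have lebI' D : measurable D -> lebesgue_measure (I `&` c @^-1` D) = mu (C `&` D).
  move=> mD; have [E mE' ED] : exists2 E : set code, measurable E & phi @^-1` E = D.
    by apply: set_code_preimage; rewrite -mE.
  exact: lebI mE' ED.
have cinj : {in I &, injective c}.
  move=> s t; rewrite !inE => Is It e.
  by rewrite -(qK _ Is) -(qK _ It) -!cphi// e.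
exists c, I; split=> //.
- by rewrite -totE => s [].
- by have := lebI' setT measurableT; rewrite preimage_setT !setIT.
- split=> // s Is; rewrite -DCE /preimage /= cphi//.
  by case: Is => _ [].
- split=> // B mB BI.
  have E : c @` B = phi @^-1` ((code_rank nu @^-1` B) `&` [set b : code | quantile nu (code_rank nu b) = b]).
    apply/seteqP; split=> [_ [s Bs <-]|x [/= Bx qx]].
      rewrite /preimage /= cphi; last exact: BI.
      by rewrite qK//; exact: BI.
    exists (code_rank nu (phi x)) => //; apply: inj.
    by rewrite -[LHS]/(phi _) cphi; [exact: qx|exact: BI].
  have mcB : measurable (c @` B).
    rewrite E -[X in measurable X]setTI; apply: (mphi) => //; apply: measurableI.
      by rewrite -[X in measurable X]setTI; apply: measurable_code_rank.
    exact: measurable_quantile_fixed.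
  split=> //.
  have := lebI' _ mcB.
  have -> : I `&` c @^-1` (c @` B) = B.
    apply/seteqP; split=> [s [Is [t Bt e]]|s Bs]; last by split; [exact: BI|exists s].
    by rewrite -(cinj t s)// inE//; exact: BI.
  move=> ->; congr (mu _); apply/esym/setIidPr => _ [s Bs <-].
  have Is := BI _ Bs; rewrite -DCE /preimage /= cphi//.
  by case: Is => _ [].
Qed.

(** * Cyclic towers *)

Lemma lebesgue_full_subset (R : realType) (I J : set (measurableTypeR R)) (M : R) :
  0 <= M -> measurable I -> measurable J -> I `<=` `[0, M[ -> J `<=` `[0, M[ ->
  lebesgue_measure I = M%:E -> lebesgue_measure (I `&` J) = lebesgue_measure J.
Proof.
move=> M0 mI mJ IM JM LI.
have mM : measurable (`[0, M[%classic : set (measurableTypeR R)) by exact: measurable_itv.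
have LM : lebesgue_measure (`[0, M[%classic : set (measurableTypeR R)) = M%:E.
  rewrite lebesgue_measure_itv /= lte_fin -EFinB subr0.
  by move: M0; rewrite le_eqVlt => /orP[/eqP <-|->//]; rewrite ltxx.
have z : lebesgue_measure (J `\` I) = 0%E.
  apply/eqP; rewrite eq_le measure_ge0 andbT.
  apply: (@le_trans _ _ (lebesgue_measure (`[0, M[%classic `\` I))).
    apply: le_measure; rewrite ?inE; [exact: measurableD|exact: measurableD|].
    by move=> s [/JM h nI].
  rewrite measureD//; last by rewrite [X in (X < _)%E]LM ltry.
  have -> : `[0, M[ `&` I = I by apply/setIidPr.
  by rewrite [X in (X - _)%E]LM [X in (_ - X)%E]LI subee.
have := @measureDI _ _ _ (@lebesgue_measure R) J I mJ mI.
by rewrite [X in (X + _)%E]z add0e setIC => ->.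
Qed.

Lemma bigcup_ord (T : Type) (P : nat) (F : 'I_P -> set T) :
  \big[setU/set0]_(t < P) F t = \bigcup_t F t.
Proof. by rewrite -(bigcup_pred predT); apply: eq_bigcupl; split. Qed.

Section cut.
Context (R : realType) d (X : measurableType d) (mu : probability X R).
Hypotheses (sX : standard_borel R X) (nmu : nonatomic mu).

(** Cut the parameter interval of [C] into intervals of length [eta]. *)
Lemma equal_cut (C : set X) (n : nat) (eta : R) :
  measurable C -> 0 <= eta -> (((n%:R * eta)%:E <= mu C)%E) ->
  exists D : nat -> set X, [/\ forall i, (i < n)%N -> measurable (D i),
    forall i, (i < n)%N -> D i `<=` C,
    forall i, (i < n)%N -> mu (D i) = eta%:E &
    trivIset [set i | (i < n)%N] D].
Proof.
move=> mC eta0 nC; have [c [I [mI IC LI [cC cinj] [cm cB]]]] := parametrization sX nmu mC.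
have finC : mu C \is a fin_num by exact: fin_num_measure.
pose K i : set (measurableTypeR R) := `[i%:R * eta, i.+1%:R * eta[%classic.
have mK i : measurable (K i) by exact: measurable_itv.
have LK i : lebesgue_measure (K i) = eta%:E.
  rewrite lebesgue_measure_itv /= lte_fin -EFinB -mulrBl -natrB// subSnn mul1r.
  case: ltP => //; rewrite -subr_ge0 -mulrBl -opprB -natrB// subSnn mulN1r oppr_ge0 => e.
  by apply/eqP; rewrite eqe eq_le eta0 e.
have mIK i : measurable (I `&` K i) by exact: measurableI.
exists (fun i => c @` (I `&` K i)); split=> [i i_n|i _ _ [s [Is _] <-]|i i_n|i j i_n j_n].
- by have [] := cB _ (mIK i) (@subIsetl _ _ _).
- exact: cC.
- have [_ ->] := cB _ (mIK i) (@subIsetl _ _ _).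
  rewrite (@lebesgue_full_subset _ I (K i) (fine (mu C)))//.
  + by rewrite fine_ge0.
  + move=> s; rewrite /K /= !in_itv /= => /andP[h1 h2]; apply/andP; split.
      by apply: le_trans h1; rewrite mulr_ge0.
    apply: lt_le_trans h2 _; apply: (@le_trans _ _ (n%:R * eta)).
      by rewrite ler_wpM2r// ler_nat.
    by rewrite -lee_fin fineK.
  + by rewrite fineK.
- move=> [_ [[s [Is Ks] <-] [t [It Kt] e]]].
  have st : t = s by apply: cinj; rewrite ?inE.
  move: Ks Kt; rewrite st /K /= !in_itv /= => /andP[a1 a2] /andP[b1 b2].
  have ep : 0 < eta.
    by rewrite lt_neqAle eta0 andbT; apply: contraTneq (le_lt_trans a1 a2) => <-; rewrite !mulr0 ltxx.
  apply/eqP; rewrite eqn_leq; apply/andP; split.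
    have := le_lt_trans a1 b2; rewrite ltr_pM2r// ltr_nat ltnS//.
  have := le_lt_trans b1 a2; rewrite ltr_pM2r// ltr_nat ltnS//.
Qed.

End cut.

Section tower_map.
Context (R : realType) d (X : measurableType d) (mu : probability X R).
Variables (P : nat) (gam : 'I_P -> R -> X) (J : set (measurableTypeR R)).
Hypothesis mJ : measurable J.
Hypothesis gam_inj : forall t t' s s', J s -> J s' -> gam t s = gam t' s' -> t = t' /\ s = s'.
Hypothesis gam_pre : forall t D, measurable D -> measurable (J `&` gam t @^-1` D).
Hypothesis gam_im : forall t B, measurable B -> B `<=` J ->
  measurable (gam t @` B) /\ mu (gam t @` B) = lebesgue_measure B.

Definition level t : set X := gam t @` J.
Definition towerset : set X := \bigcup_t level t.

(** The map sending the point of parameter [s] in level [t] to the point of the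
    same parameter in level [sigma t], and fixing the points outside the levels:
    an everywhere defined bijection, whatever null sets were lost in the
    parametrizations. *)
Definition level_shift (sigma : 'I_P -> 'I_P) (x : X) : X :=
  xget x [set y | exists t s, [/\ J s, x = gam t s & y = gam (sigma t) s]].

Lemma level_shift_in sigma t s : J s -> level_shift sigma (gam t s) = gam (sigma t) s.
Proof.
move=> Js; rewrite /level_shift; case: xgetP => [y _ [t' [s' [Js' e ->]]]|/(_ (gam (sigma t) s))].
  by have [-> ->] := gam_inj Js Js' e.
by case; exists t, s.
Qed.

Lemma level_shift_out sigma x : ~ towerset x -> level_shift sigma x = x.
Proof.
move=> nx; rewrite /level_shift; case: xgetP => // y _ [t [s [Js e _]]].
by exfalso; apply: nx; exists t => //; exists s.
Qed.

Lemma towersetP x : towerset x <-> exists t s, J s /\ x = gam t s.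
Proof.
split=> [[t _ [s Js <-]]|[t [s [Js ->]]]]; first by exists t, s.
by exists t => //; exists s.
Qed.

Lemma level_shiftK sigma sigma' : cancel sigma sigma' -> cancel (level_shift sigma) (level_shift sigma').
Proof.
move=> h x; have [/towersetP[t [s [Js ->]]]|nx] := pselect (towerset x).
  by rewrite !level_shift_in// h.
by rewrite !level_shift_out// ?level_shift_out.
Qed.

Lemma level_shift_preimage sigma A :
  level_shift sigma @^-1` A =
  (\big[setU/set0]_(t < P) (gam t @` (J `&` gam (sigma t) @^-1` A))) `|` (A `\` towerset).
Proof.
rewrite bigcup_ord; apply/seteqP; split=> [x Ax|x [[t _ [s [Js As] <-]]|[Ax nx]]].
- have [/towersetP[t [s [Js e]]]|nx] := pselect (towerset x).
    by left; exists t => //; exists s => //; split=> //; move: Ax; rewrite /preimage /= e level_shift_in.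
  by right; split=> //; move: Ax; rewrite /preimage /= level_shift_out.
- by rewrite /preimage /= level_shift_in.
- by rewrite /preimage /= level_shift_out.
Qed.

Lemma measurable_level t : measurable (level t).
Proof. by have [] := gam_im t mJ (@subset_refl _ J). Qed.

Lemma measurable_towerset : measurable towerset.
Proof. by rewrite /towerset -bigcup_ord; apply: bigsetU_measurable => t _; exact: measurable_level. Qed.

(** The right-hand side does not change when the summation index is permuted,
    so comparing [sigma] with the identity shows that measure is preserved. *)
Lemma level_shift_preimage_measure sigma A : measurable A ->
  measurable (level_shift sigma @^-1` A) /\
  mu (level_shift sigma @^-1` A) =
  (\sum_(t < P) lebesgue_measure (J `&` gam (sigma t) @^-1` A) + mu (A `\` towerset))%E.
Proof.
move=> mA; rewrite level_shift_preimage.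
have im t := gam_im t (gam_pre (sigma t) mA) (@subIsetl _ _ _).
have mU : measurable (\big[setU/set0]_(t < P) (gam t @` (J `&` gam (sigma t) @^-1` A))).
  by apply: bigsetU_measurable => t _; case: (im t).
have mR : measurable (A `\` towerset) by apply: measurableD => //; exact: measurable_towerset.
split; first exact: measurableU.
rewrite measureU//; last first.
  rewrite bigcup_ord; apply/seteqP; split=> // x [[t _ [s [Js _] <-]] [_ nx]].
  by apply: nx; apply/towersetP; exists t, s.
congr (_ + _)%E; rewrite measure_bigsetU_ord.
- by apply: eq_bigr => t _; case: (im t).
- by move=> t; case: (im t).
- move=> t t' _ _ [x [[s [Js _] <-] [s' [Js' _]]]] e.
  by have [] := gam_inj Js' Js e.
Qed.

Lemma level_shift_preserving sigma sigma' A : cancel sigma sigma' -> cancel sigma' sigma ->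
  measurable A -> mu (level_shift sigma @^-1` A) = mu A.
Proof.
move=> h h' mA; have [_ ->] := level_shift_preimage_measure sigma mA.
have [_] := level_shift_preimage_measure id mA.
have -> : level_shift id @^-1` A = A.
  have e x : level_shift id x = x.
    have [/towersetP[t [s [Js ->]]]|nx] := pselect (towerset x); first by rewrite level_shift_in.
    by rewrite level_shift_out.
  by apply/seteqP; split=> x; rewrite /preimage /= e.
move=> ->; congr (_ + _)%E.
by rewrite [RHS](reindex sigma)//; exists sigma'.
Qed.

Lemma level_shift_image sigma sigma' A : cancel sigma sigma' -> cancel sigma' sigma ->
  level_shift sigma @` A = level_shift sigma' @^-1` A.
Proof.
move=> h h'; apply/seteqP; split=> [_ [x Ax <-]|x Ax].
  by rewrite /preimage /= (level_shiftK h).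
by exists (level_shift sigma' x) => //; rewrite (level_shiftK h').
Qed.

Lemma tower_mptrans (sigma sigma' : 'I_P -> 'I_P) :
  cancel sigma sigma' -> cancel sigma' sigma ->
  exists T : mptrans mu, forall t, T @` level t = level (sigma t).
Proof.
move=> h h'.
have bij : bijective (level_shift sigma) by exists (level_shift sigma'); exact: level_shiftK.
have meas : measurable_fun setT (level_shift sigma).
  by move=> _ A mA; rewrite setTI; have [] := level_shift_preimage_measure sigma mA.
have im A : measurable A -> measurable (level_shift sigma @` A).
  by move=> mA; rewrite (level_shift_image A h h'); have [] := level_shift_preimage_measure sigma' mA.
have pres A : measurable A -> mu (level_shift sigma @^-1` A) = mu A.
  exact: level_shift_preserving h h'.
exists (Mptrans bij meas im pres) => t /=.
apply/seteqP; split=> [_ [_ [s Js <-] <-]|_ [s Js <-]].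
  by rewrite level_shift_in//; exists s.
by exists (gam t s); [exists s|rewrite level_shift_in].
Qed.

End tower_map.

Section tower.
Context (R : realType) d (X : measurableType d) (mu : probability X R).
Hypotheses (sX : standard_borel R X) (nmu : nonatomic mu).

(** All the [D t] are parametrized by subsets of full measure of the same
    interval; the common part [J] of these subsets parametrizes the levels. *)
Lemma cyclic_tower (P : nat) (D : 'I_P -> set X) (eta : R) :
  (0 < P)%N -> 0 <= eta -> (forall t, measurable (D t)) ->
  (forall t, mu (D t) = eta%:E) -> trivIset setT D ->
  exists (T : mptrans mu) (F : 'I_P -> set X),
    [/\ forall t, measurable (F t), forall t, F t `<=` D t,
        forall t, mu (F t) = eta%:E &
        forall t, T @` F t = F (ordS t)].
Proof.
move=> P0 eta0 mD muD tD.
have [gam gamP] := choice (fun t => parametrization sX nmu (mD t)).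
have [I IP] := choice gamP.
have gP t : [/\ measurable (I t), I t `<=` `[0, eta[, lebesgue_measure (I t) = eta%:E,
        (forall s, I t s -> D t (gam t s)) /\ {in I t &, injective (gam t)} &
        (forall A, measurable A -> measurable (I t `&` gam t @^-1` A)) /\
        (forall B, measurable B -> B `<=` I t ->
           measurable (gam t @` B) /\ mu (gam t @` B) = lebesgue_measure B)].
  by have := IP t; rewrite muD.
pose J : set (measurableTypeR R) := \bigcap_t I t.
have mJ : measurable J.
  rewrite /J -(setCK (\bigcap_t I t)) setC_bigcap -bigcup_ord; apply: measurableC.
  by apply: bigsetU_measurable => t _; apply: measurableC; case: (gP t).
have JI t : J `<=` I t by move=> s /(_ t); exact.
have LJ : lebesgue_measure J = eta%:E.
  have key (r : seq 'I_P) :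
      let K : set (measurableTypeR R) := (\big[setI/setT]_(t <- r) I t) `&` (`[0, eta[%classic : set R) in
      measurable K /\ lebesgue_measure K = eta%:E.
    elim: r => [|t r [mK LK]] /=.
      rewrite big_nil setTI; split; first exact: measurable_itv.
      rewrite lebesgue_measure_itv /= lte_fin -EFinB subr0.
      by move: eta0; rewrite le_eqVlt => /orP[/eqP <-|->//]; rewrite ltxx.
    have [mIt Ib LI _ _] := gP t.
    rewrite big_cons -setIA; split; first exact: measurableI.
    by rewrite (@lebesgue_full_subset _ _ _ eta)//; exact: subIsetr.
  have [_ <-] := key (index_enum 'I_P); congr (lebesgue_measure _).
  have -> : \big[setI/setT]_t I t = J.
    by rewrite /J -[LHS]setCK setC_bigsetI bigcup_ord -setC_bigcap setCK.
  apply/esym/setIidPl => s Js; have [_ Ib _ _ _] := gP (Ordinal P0).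
  by apply: Ib; exact: JI.
have ginj t t' s s' : J s -> J s' -> gam t s = gam t' s' -> t = t' /\ s = s'.
  move=> Js Js' e.
  have [_ _ _ [Dt it] _] := gP t; have [_ _ _ [Dt' _] _] := gP t'.
  have tt' : t = t'.
    apply: tD => //; exists (gam t s); split; first by apply: Dt; exact: JI.
    by rewrite e; apply: Dt'; exact: JI.
  split=> //; move: e; rewrite -tt' => e; apply: it => //; rewrite inE; exact: JI.
have gpre t A : measurable A -> measurable (J `&` gam t @^-1` A).
  move=> mA; have [_ _ _ _ [h _]] := gP t.
  have <- : J `&` I t = J by apply/setIidPl; exact: JI.
  by rewrite -setIA; apply: measurableI => //; exact: h.
have gim t B : measurable B -> B `<=` J ->
    measurable (gam t @` B) /\ mu (gam t @` B) = lebesgue_measure B.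
  move=> mB BJ; have [_ _ _ _ [_ h]] := gP t; apply: h => //.
  exact: subset_trans BJ (JI t).
have [T TF] := tower_mptrans mJ ginj gpre gim (@ordSK P) (@ord_predK P).
exists T, (level gam J); split=> [t|t _ [s Js <-]|t|//].
- by have [] := gim t J mJ (@subset_refl _ J).
- by have [_ _ _ [h _] _] := gP t; apply: h; exact: JI.
- by have [_ ->] := gim t J mJ (@subset_refl _ J).
Qed.

End tower.

(** * The maximal ergodic inequality *)

Section maximal.
Context (R : realType) d (X : measurableType d) (mu : probability X R).
Variable T : X -> X.
Hypothesis mT : measurable_fun setT T.
Hypothesis muT : forall A, measurable A -> mu (T @^-1` A) = mu A.

Lemma integral_preserving (f : X -> R) : measurable_fun setT f -> (forall x, 0 <= f x) ->
  (\int[mu]_x (f (T x))%:E = \int[mu]_x (f x)%:E)%E.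
Proof.
move=> mf f0.
have mEf : measurable_fun setT (EFin \o f) by exact/measurable_EFinP.
have := @ge0_integral_pushforward _ _ X X R T mT mu setT (EFin \o f) measurableT mEf.
rewrite preimage_setT => <-; last by move=> x _; rewrite lee_fin.
by apply: eq_measure_integral => A mA _; rewrite /= /pushforward muT.
Qed.

(** The maximum of the partial sums of length at most [N] along the orbit, the
    empty sum included. *)
Fixpoint max_sum (h : X -> R) (N : nat) (x : X) : R :=
  if N is N'.+1 then Num.max 0 (h x + max_sum h N' (T x)) else 0.

Lemma max_sum_ge0 h N x : 0 <= max_sum h N x.
Proof. by case: N => //= N; rewrite le_max lexx. Qed.

Lemma max_sum_le h N x : max_sum h N x <= max_sum h N.+1 x.
Proof.
elim: N x => [|N IH] x; first exact: max_sum_ge0.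
rewrite /= ge_max le_max lexx /= le_max; apply/orP; right.
by rewrite lerD2l; exact: IH.
Qed.

Lemma sum_le_max_sum h N x : \sum_(0 <= n < N) h (iter n T x) <= max_sum h N x.
Proof.
elim: N x => [|N IH] x; first by rewrite big_geq.
rewrite big_nat_recl//= le_max; apply/orP; right; rewrite lerD2l.
by rewrite (eq_bigr (fun n => h (iter n T (T x))))// => n _; rewrite -iterSr.
Qed.

Lemma measurable_max_sum h N : measurable_fun setT h -> measurable_fun setT (max_sum h N).
Proof.
move=> mh; elim: N => [|N IH] /=; first exact: measurable_cst.
apply: measurable_maxr; first exact: measurable_cst.
by apply: measurable_funD => //; exact: measurableT_comp mT.
Qed.

(** Garsia's argument: with [M] the maximal sum of [g - lam], one has
    [M + lam 1_(M > 0) <= g + M o T] everywhere, and the integrals of [M] and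
    [M o T] cancel. *)
Lemma maximal_inequality (g : X -> R) (C lam : R) :
  measurable_fun setT g -> (forall x, 0 <= g x <= C) -> 0 < lam ->
  exists W : set X, [/\ measurable W, (lam%:E * mu W <= \int[mu]_x (g x)%:E)%E &
    forall x, ~ W x -> forall N, \sum_(0 <= n < N) g (iter n T x) <= lam * N%:R].
Proof.
move=> mg gC lam0.
have g0 x : 0 <= g x by case/andP: (gC x).
pose h x := g x - lam.
have mh : measurable_fun setT h by apply: measurable_funB => //; exact: measurable_cst.
pose M := max_sum h; pose E N := M N @^-1` `]0, +oo[.
have mM N : measurable_fun setT (M N) := measurable_max_sum N mh.
have mE N : measurable (E N) by rewrite -[X in measurable X]setTI; apply: (mM).
have M0 N x : 0 <= M N x := max_sum_ge0 h N x.
have iM N : (\int[mu]_x (M N x)%:E < +oo)%E.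
  have Mle x : M N x <= N%:R * C.
    rewrite /M; elim: (N) (x) => [|n IH] y /=; first by rewrite mul0r.
    have C0 : 0 <= C by case/andP: (gC y) => a; apply: le_trans a.
    rewrite ge_max mulr_ge0//= -natr1 mulrDl mul1r addrC lerD//.
    rewrite /h lerBlDr; case/andP: (gC y) => _ gy; apply: le_trans gy _.
    by rewrite lerDl ltW.
  apply: (@le_lt_trans _ _ (\int[mu]_x (cst (N%:R * C)%:E x))%E).
    apply: ge0_le_integral => //.
    - by move=> x _; rewrite lee_fin.
    - exact/measurable_EFinP.
    - by move=> x _; rewrite lee_fin.
  by rewrite integral_cst//= probability_setT mule1 ltry.
have EN N : (lam%:E * mu (E N) <= \int[mu]_x (g x)%:E)%E.
  have pw x : M N x + lam * \1_(E N) x <= g x + M N (T x).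
    rewrite indicE; have [Ex|/negP nEx] := boolP (x \in E N); last first.
      have -> : M N x = 0.
        apply/eqP; rewrite eq_le M0 andbT leNgt; apply/negP => Mx; apply: nEx.
        by rewrite inE /E /= in_itv /= Mx.
      by rewrite mulr0 addr0 addr_ge0.
    rewrite mulr1; move: Ex; rewrite inE /E /= in_itv /= andbT.
    have := max_sum_le h N (T x); rewrite -/(M N (T x)).
    case: N => [|n]; first by rewrite /M /= ltxx.
    have -> : M n.+1 x = Num.max 0 (h x + M n (T x)) by [].
    move=> _; rewrite lt_max ltxx /= => hp.
    rewrite max_r; last exact: ltW.
    rewrite {1}/h addrAC subrK lerD2l.
    exact: max_sum_le.
  have mE' : measurable_fun setT (fun x => (\1_(E N) x : R)) by exact: measurable_indic.
  have : (\int[mu]_x ((M N x)%:E + lam%:E * (\1_(E N) x)%:E) <=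
      \int[mu]_x ((g x)%:E + (M N (T x))%:E))%E.
    apply: ge0_le_integral => //.
    - by move=> x _; rewrite -EFinM -EFinD lee_fin addr_ge0// mulr_ge0// ltW.
    - apply: emeasurable_funD; first exact/measurable_EFinP.
      by apply: measurable_funeM; exact/measurable_EFinP.
    - apply: emeasurable_funD; apply/measurable_EFinP => //.
      exact: measurableT_comp mT.
    - by move=> x _; rewrite -EFinM -!EFinD lee_fin.
  rewrite ge0_integralD//; last 4 first.
  - by move=> x _; rewrite lee_fin.
  - exact/measurable_EFinP.
  - by move=> x _; rewrite -EFinM lee_fin mulr_ge0// ltW.
  - by apply: measurable_funeM; exact/measurable_EFinP.
  rewrite ge0_integralD//; last 4 first.
  - by move=> x _; rewrite lee_fin.
  - exact/measurable_EFinP.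
  - by move=> x _; rewrite lee_fin.
  - by apply/measurable_EFinP; exact: measurableT_comp mT.
  rewrite integral_preserving// ge0_integralZl//; last 2 first.
  - exact/measurable_EFinP.
  - by rewrite lee_fin ltW.
  rewrite integral_indic// setIT addeC leeD2rE// ge0_fin_numE//.
  by apply: integral_ge0 => x _; rewrite lee_fin.
exists (\bigcup_N E N); split.
- exact: bigcupT_measurable.
- have cv : (mu \o E) N @[N --> \oo] --> mu (\bigcup_N E N).
    apply: nondecreasing_cvg_mu => //; first exact: bigcupT_measurable.
    apply/nondecreasing_seqP => N; apply/subsetPset => x; rewrite /E /= !in_itv /= !andbT.
    by move=> h1; apply: lt_le_trans h1 _; exact: max_sum_le.
  have := cvgeZl (y := lam%:E) (erefl _) cv.
  by apply: cvge_le; apply: nearW => N; exact: EN.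
- move=> x nW N; have : M N x <= 0.
    rewrite leNgt; apply/negP => Mx; apply: nW; exists N => //.
    by rewrite /E /= in_itv /= Mx.
  move=> Mx; have := le_trans (sum_le_max_sum h N x) Mx.
  rewrite /h sumrB subr_le0 => hs; apply: le_trans hs _.
  by rewrite big_const_nat subn0 iter_addr_0 -[_ *+ _]mulr_natr.
Qed.

End maximal.

(** * From windows to all times *)

Definition real_average (R : realType) (X : Type) (T : X -> X) (k : nat)
    (f : 'I_k -> X -> R) (N : nat) (x : X) : R :=
  N%:R^-1 * \sum_(0 <= n < N) \prod_(j < k) f j (iter (j.+1 * n) T x).

(** One constant serves for all points and all large times; its value is left
    open, because closeness to some constant already gives a Cauchy criterion. *)
Definition eventually_flat (R : realType) d (X : measurableType d)
    (mu : probability X R) (T : X -> X) (k : nat) (f : 'I_k -> X -> R) (eps : R) :=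
  exists (c : R) (M : nat) (W : set X),
    [/\ measurable W, (mu W <= eps%:E)%E &
      forall x, ~ W x -> forall N, (M <= N)%N -> `|real_average T f N x - c| <= eps].

Lemma sum_shift_le (R : realDomainType) (G : nat -> R) (N i : nat) :
  (forall n, `|G n| <= 1) ->
  `|\sum_(0 <= n < N) G (n + i)%N - \sum_(0 <= n < N) G n| <= 2 * i%:R.
Proof.
move=> G1; elim: i => [|i IH].
  by under eq_bigr do rewrite addn0; rewrite subrr normr0 mulr0.
have -> : \sum_(0 <= n < N) G (n + i.+1)%N =
    \sum_(0 <= n < N) G (n + i)%N + (G (N + i)%N - G i).
  elim: N {IH} => [|N IHN]; first by rewrite !big_geq// add0n subrr addr0.
  by rewrite !big_nat_recr//= IHN addSnnS; ring.
rewrite addrAC; apply: le_trans (ler_normD _ _) _.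
rewrite -[i.+1%:R]natr1 mulrDr mulr1; apply: lerD => //.
by apply: le_trans (ler_normB _ _) _; apply: lerD.
Qed.

Section windows.
Context (R : realType) d (X : measurableType d) (mu : probability X R).
Variables (T : X -> X) (k : nat) (f : 'I_k -> X -> R).
Hypothesis mT : measurable_fun setT T.
Hypothesis muT : forall A, measurable A -> mu (T @^-1` A) = mu A.
Hypothesis f1 : forall j x, `|f j x| <= 1.

Lemma measurable_iter n : measurable_fun setT (iter n T).
Proof.
elim: n => [|n IH]; first exact: measurable_id.
exact: (measurableT_comp mT IH).
Qed.

Lemma iter_preserving n A : measurable A -> mu (iter n T @^-1` A) = mu A.
Proof.
move=> mA; elim: n => [//|n IH]; rewrite -IH -[in RHS]muT.
  by congr (mu _); apply/seteqP; split=> x; rewrite /preimage /= -iterSr.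
by rewrite -[X in measurable X]setTI; exact: measurable_iter.
Qed.

(** The maximal inequality for the indicator of [E] under each power [T^(j+1)]. *)
Lemma visit_bound (E : set X) (lam : R) : measurable E -> 0 < lam ->
  exists W : set X, [/\ measurable W, (lam%:E * mu W <= k%:R%:E * mu E)%E &
    forall x, ~ W x -> forall N, \sum_(0 <= n < N) \sum_(j < k) \1_E (iter (j.+1 * n) T x) <=
      k%:R * lam * N%:R].
Proof.
move=> mE lam0.
have h (j : 'I_k) : exists W : set X, [/\ measurable W, (lam%:E * mu W <= mu E)%E &
    forall x, ~ W x -> forall N, \sum_(0 <= n < N) \1_E (iter (j.+1 * n) T x) <= lam * N%:R].
  have m1 : measurable_fun setT (fun x => (\1_E x : R)) by exact: measurable_indic.
  have b1 x : 0 <= (\1_E x : R) <= 1 by rewrite indicE; case: (_ \in _); rewrite ?lexx ?ler01.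
  have [W [mW Wle Wout]] := maximal_inequality (measurable_iter j.+1) (iter_preserving j.+1) m1 b1 lam0.
  exists W; split=> //; first by move: Wle; rewrite integral_indic// setIT.
  move=> x nW N; apply: le_trans (Wout x nW N).
  by rewrite le_eqVlt; apply/orP; left; apply/eqP; apply: eq_bigr => n _; rewrite -iterM mulnC.
have [W WP] := choice h.
exists (\big[setU/set0]_(j < k) W j); split.
- by apply: bigsetU_measurable => j _; case: (WP j).
- have le1 : (mu (\big[setU/set0]_(j < k) W j) <= \sum_(j < k) mu (W j))%E.
    have mW (j : 'I_k) : measurable (W j) by case: (WP j).
    elim: (index_enum _) => [|j r IH]; first by rewrite !big_nil measure0.
    rewrite !big_cons; apply: (@le_trans _ _ (mu (W j) + mu (\big[setU/set0]_(i <- r) W i))%E).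
      by apply: measureU2 => //; exact: bigsetU_measurable.
    exact: leeD.
  apply: (@le_trans _ _ (lam%:E * \sum_(j < k) mu (W j))%E).
    by apply: lee_wpmul2l => //; rewrite lee_fin ltW.
  rewrite ge0_sume_distrr; last by move=> *; exact: measure_ge0.
  apply: (@le_trans _ _ (\sum_(j < k) mu E)%E).
    by apply: lee_sum => j _; case: (WP j).
  have fE : mu E \is a fin_num by exact: fin_num_measure.
  by rewrite -(fineK fE) sumEFin sumr_const card_ord -EFinM mulr_natl.
- move=> x nW N; rewrite exchange_big /= -mulrA mulr_natl.
  apply: (@le_trans _ _ (\sum_(j < k) lam * N%:R)); last by rewrite sumr_const card_ord.
  apply: ler_sum => j _; case: (WP j) => _ _; apply.
  by move=> Wx; apply: nW; rewrite (bigD1 j)//=; left.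
Qed.

(** Replace each term by the average of the next [P] terms, which costs at
    most [2 P] in total.  The term at time [n] is then within [delta] of [a],
    except if one of the points [T^((j+1) n) x] lies in [E]; the points
    [y j] in the hypothesis are unrelated because nothing is known about the
    joint position of these points. *)
Lemma flat_of_windows (P : nat) (a delta lam : R) (E : set X) :
  (0 < P)%N -> measurable E -> 0 < lam -> `|a| <= 1 -> 0 <= delta ->
  (forall y : 'I_k -> X, (forall j, ~ E (y j)) ->
    `|(\sum_(0 <= i < P) \prod_j f j (iter (j.+1 * i) T (y j))) / P%:R - a| <= delta) ->
  exists W : set X, [/\ measurable W, (lam%:E * mu W <= k%:R%:E * mu E)%E &
    forall x, ~ W x -> forall N, (0 < N)%N ->
      `|real_average T f N x - a| <= 2 * P%:R / N%:R + delta + 2 * (k%:R * lam)].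
Proof.
move=> P0 mE lam0 a1 delta0 win.
have [W [mW Wle Wout]] := visit_bound mE lam0; exists W; split=> // x nW N N0.
pose G n := \prod_j f j (iter (j.+1 * n) T x).
have G1 n : `|G n| <= 1.
  by rewrite normr_prod; apply: prodr_ile1 => j _; rewrite normr_ge0 f1.
have Pr : 0 < P%:R :> R by rewrite ltr0n.
have Nr : 0 < N%:R :> R by rewrite ltr0n.
pose v n : R := \sum_(j < k) \1_E (iter (j.+1 * n) T x).
have v0 n : 0 <= v n by apply: sumr_ge0 => j _; rewrite indicE.
have wn n : `|(\sum_(0 <= i < P) G (n + i)%N) / P%:R - a| <= delta + 2 * v n.
  have [inE|nE] := pselect (exists j : 'I_k, E (iter (j.+1 * n) T x)).
    have [j Ej] := inE.
    have v1 : 1 <= v n.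
      rewrite /v (bigD1 j)//= indicE mem_set//= lerDl; apply: sumr_ge0 => i _.
      by rewrite indicE.
    apply: (@le_trans _ _ 2); last by rewrite -[leLHS]add0r lerD// ler_peMr.
    apply: le_trans (ler_normB _ _) _; apply: lerD => //.
    rewrite normrM normfV [ `|P%:R| ]gtr0_norm// ler_pdivrMr// mul1r.
    apply: le_trans (ler_norm_sum _ _ _) _.
    apply: (@le_trans _ _ (\sum_(0 <= i < P) 1)); first exact: ler_sum.
    by rewrite big_const_nat subn0 iter_addr_0.
  apply: le_trans (_ : delta <= _); last by rewrite lerDl mulr_ge0.
  have := win (fun j => iter (j.+1 * n) T x) (fun j Ej => nE (ex_intro _ j Ej)).
  congr (`|_ / _ - _| <= _); apply: eq_bigr => i _; apply: eq_bigr => j _.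
  by rewrite -iterD mulnDr addnC.
have vsum : \sum_(0 <= n < N) v n <= k%:R * lam * N%:R by exact: Wout.
pose A := \sum_(0 <= n < N) G n.
pose B := \sum_(0 <= n < N) (\sum_(0 <= i < P) G (n + i)%N) / P%:R.
have AB : `|A - B| <= 2 * P%:R.
  have -> : A - B = (\sum_(0 <= i < P) (A - \sum_(0 <= n < N) G (n + i)%N)) / P%:R.
    rewrite sumrB mulrBl big_const_nat subn0 iter_addr_0 -[_ *+ P]mulr_natr mulfK ?gt_eqF//.
    by rewrite /B -mulr_suml exchange_big.
  rewrite normrM normfV [ `|P%:R| ]gtr0_norm// ler_pdivrMr//.
  apply: le_trans (ler_norm_sum _ _ _) _.
  apply: (@le_trans _ _ (\sum_(0 <= i < P) 2 * P%:R)); last first.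
    by rewrite big_const_nat subn0 iter_addr_0 -[_ *+ P]mulr_natr.
  rewrite big_nat [leRHS]big_nat; apply: ler_sum => i /andP[_ iP].
  rewrite distrC; apply: le_trans (sum_shift_le _ _ G1) _.
  by rewrite ler_wpM2l// ler_nat ltnW.
have Ba : `|B - N%:R * a| <= N%:R * delta + 2 * (k%:R * lam * N%:R).
  have -> : B - N%:R * a = \sum_(0 <= n < N) ((\sum_(0 <= i < P) G (n + i)%N) / P%:R - a).
    by rewrite sumrB big_const_nat subn0 iter_addr_0 mulr_natl.
  apply: le_trans (ler_norm_sum _ _ _) _.
  apply: le_trans (ler_sum _ (fun n _ => wn n)) _.
  rewrite big_split /= big_const_nat subn0 iter_addr_0 mulr_natl lerD2l -mulr_sumr.
  by rewrite ler_wpM2l.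
rewrite /real_average -/(A) -[X in `|X - _|]/(N%:R^-1 * A).
have -> : N%:R^-1 * A - a = N%:R^-1 * ((A - B) + (B - N%:R * a)).
  by rewrite addrA subrK mulrBr mulKf// gt_eqF.
rewrite normrM normfV [ `|N%:R| ]gtr0_norm// [X in X <= _]mulrC ler_pdivrMr//.
apply: le_trans (ler_normD _ _) _; apply: le_trans (lerD AB Ba) _.
have Nn : N%:R != 0 :> R by rewrite gt_eqF.
by rewrite le_eqVlt; apply/orP; left; apply/eqP; field.
Qed.

End windows.

(** * Transformations close to a tower *)

Lemma periodic_tower (R : realType) d (X : measurableType d) (mu : probability X R)
    (P : nat) (D : nat -> set X) (eta : R) :
  standard_borel R X -> nonatomic mu -> (0 < P)%N -> 0 <= eta ->
  (forall t, (t < P)%N -> measurable (D t)) ->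
  (forall t, (t < P)%N -> mu (D t) = eta%:E) ->
  trivIset [set t | (t < P)%N] D ->
  exists (T : mptrans mu) (F : nat -> set X),
    [/\ periodic P F, forall t, measurable (F t), forall t, (t < P)%N -> F t `<=` D t,
        forall t, mu (F t) = eta%:E & forall t, T @` F t = F t.+1].
Proof.
move=> sX nmu P0 eta0 mD muD tD.
have [|||T [F [mF FD muF TF]]] := cyclic_tower (D := fun t : 'I_P => D t) sX nmu P0 eta0.
- by move=> t; exact: mD.
- by move=> t; exact: muD.
- move=> t t' _ _ h; apply/val_inj; apply: tD => //=.
exists T, (fun t => F (Ordinal (ltn_pmod t P0))); split.
- by move=> t; congr F; apply/val_inj; rewrite /= modnDr.
- by move=> t; exact: mF.
- by move=> t tP; apply: subset_trans (FD _) _; rewrite /= modn_small.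
- by move=> t; exact: muF.
- move=> t; rewrite TF; congr F; apply/val_inj.
  by rewrite /= -addn1 modnDml addn1.
Qed.

Section near_tower.
Context (R : realType) d (X : measurableType d) (mu : probability X R).
Variables (S T0 : mptrans mu) (P : nat) (F : nat -> set X).
Hypothesis P0 : (0 < P)%N.
Hypothesis Fper : periodic P F.
Hypothesis mF : forall t, measurable (F t).
Hypothesis T0F : forall t, T0 @` F t = F t.+1.

(** The points of the tower that [S] fails to send to the next level. *)
Definition off_step : set X := \big[setU/set0]_(t < P) (F t `\` S @^-1` F t.+1).
Definition off_tower : set X := ~` \big[setU/set0]_(t < P) F t.

Lemma in_tower x : ~ off_tower x -> exists t, F t x.
Proof. by move=> /contrapT; rewrite bigcup_ord => -[t _ Ft]; exists t. Qed.

Lemma measurable_preimage_mp (A : set X) : measurable A -> measurable (S @^-1` A).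
Proof. by move=> mA; rewrite -[X in measurable X]setTI; exact: (mptrans_measurable S). Qed.

Lemma measurable_off_step : measurable off_step.
Proof.
apply: bigsetU_measurable => t _; apply: measurableD => //.
exact: measurable_preimage_mp.
Qed.

Lemma off_step_measure (delta : R) :
  (forall t, (t < P)%N -> (mu ((S @` F t) `+` (T0 @` F t)) <= delta%:E)%E) ->
  (mu off_step <= (P%:R * delta)%:E)%E.
Proof.
move=> near.
have step t : (t < P)%N -> (mu (F t `\` S @^-1` F t.+1) <= delta%:E)%E.
  move=> tP; have mFS : measurable (F t `\` S @^-1` F t.+1).
    by apply: measurableD => //; exact: measurable_preimage_mp.
  rewrite -(mptrans_image_mu S mFS); apply: le_trans (near t tP).
  apply: le_measure; rewrite ?inE; [exact: mptrans_measurable_image|exact: measurable_symdiff|].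
  move=> _ [x [Fx nF] <-]; left; split; first by exists x.
  by rewrite T0F.
have mS t : measurable (F t `\` S @^-1` F t.+1).
  by apply: measurableD => //; exact: measurable_preimage_mp.
apply: (@le_trans _ _ (\sum_(t < P) mu (F t `\` S @^-1` F t.+1))%E).
  rewrite /off_step; elim: (index_enum _) => [|j r IH]; first by rewrite !big_nil measure0.
  rewrite !big_cons.
  apply: (@le_trans _ _ (mu (F j `\` S @^-1` F j.+1) +
     mu (\big[setU/set0]_(i <- r) (F i `\` S @^-1` F i.+1)))%E).
    by apply: measureU2 => //; apply: bigsetU_measurable.
  exact: leeD.
apply: (@le_trans _ _ (\sum_(t < P) delta%:E)%E).
  by apply: lee_sum => t _; exact: step.
by rewrite sumEFin sumr_const card_ord mulr_natl.
Qed.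

Lemma follow_tower n x t : (forall i, (i < n)%N -> ~ off_step (iter i S x)) -> F t x ->
  F (t + n) (iter n S x).
Proof.
elim: n => [|n IH] h Ft; first by rewrite addn0.
have Fn : F (t + n) (iter n S x) by apply: IH => // i iln; apply: h; rewrite ltnW.
have := h n (ltnSn n); rewrite /off_step bigcup_ord => nZ.
apply: contrapT => nF; apply: nZ.
exists (Ordinal (ltn_pmod (t + n) P0)) => //=; split.
  by rewrite (periodic_mod Fper).
move=> Fs; apply: nF; rewrite addnS iterS.
have <- : F ((t + n) %% P).+1 = F (t + n).+1.
  by rewrite -[LHS](periodic_mod Fper) -[RHS](periodic_mod Fper) -addn1 modnDml addn1.
exact: Fs.
Qed.

(** The bad set consists of the points outside the tower and of those which
    leave it in the wrong way within [k P] steps; its measure is small as soon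
    as [S] moves each level almost as [T0] does. *)
Lemma near_tower_windows (k : nat) (f : 'I_k -> X -> R) (w : 'I_k -> nat -> R)
    (a delta eps1 delta1 : R) :
  (forall j t x, F t x -> f j x = w j t) ->
  (mu off_tower <= eps1%:E)%E ->
  (forall c : 'I_k -> nat,
    `|(\sum_(0 <= i < P) \prod_j w j (c j + j.+1 * i)%N) / P%:R - a| <= delta) ->
  (forall t, (t < P)%N -> (mu ((S @` F t) `+` (T0 @` F t)) <= delta1%:E)%E) ->
  exists E : set X, [/\ measurable E,
    (mu E <= (eps1 + (k * P)%:R * (P%:R * delta1))%:E)%E &
    forall y : 'I_k -> X, (forall j, ~ E (y j)) ->
    `|(\sum_(0 <= i < P) \prod_j f j (iter (j.+1 * i) S (y j))) / P%:R - a| <= delta].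
Proof.
move=> fw off1 word near.
have mS : measurable_fun setT S by exact: mptrans_measurable.
have pS A : measurable A -> mu (S @^-1` A) = mu A by exact: mptrans_preserving.
have mo : measurable off_tower.
  by apply: measurableC; apply: bigsetU_measurable => t _.
pose Z i := iter i S @^-1` off_step.
have mZ i : measurable (Z i).
  rewrite -[X in measurable X]setTI; apply: (measurable_iter mS) => //.
  exact: measurable_off_step.
exists (off_tower `|` \big[setU/set0]_(i < k * P) Z i); split.
- by apply: measurableU => //; apply: bigsetU_measurable => i _.
- rewrite EFinD; apply: (@le_trans _ _ (mu off_tower + mu (\big[setU/set0]_(i < k * P) Z i))%E).
    by apply: measureU2 => //; apply: bigsetU_measurable => i _.
  apply: leeD => //.
  apply: (@le_trans _ _ (\sum_(i < k * P) mu (Z i))%E).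
    elim: (index_enum _) => [|j r IH]; first by rewrite !big_nil measure0.
    rewrite !big_cons; apply: (@le_trans _ _ (mu (Z j) + mu (\big[setU/set0]_(i <- r) Z i))%E).
      by apply: measureU2 => //; apply: bigsetU_measurable.
    exact: leeD.
  apply: (@le_trans _ _ (\sum_(i < k * P) (P%:R * delta1)%:E)%E).
    apply: lee_sum => i _; rewrite /Z (iter_preserving mS pS) ?off_step_measure//.
    exact: measurable_off_step.
  by rewrite sumEFin sumr_const card_ord [in leRHS]mulr_natl.
- move=> y yE.
  have ex j : exists t, F t (y j).
    by apply: in_tower => h; apply: (yE j); left.
  have [c cP] := choice ex.
  have := word c; congr (`|_ / _ - _| <= _).
  apply: eq_big_nat => i /andP[_ iP]; apply: eq_bigr => j _.
  rewrite (fw j (c j + j.+1 * i)%N)//; apply: follow_tower => // n nl off.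
  apply: (yE j); right; rewrite bigcup_ord.
  have nk : (n < k * P)%N.
    apply: leq_trans nl _; apply: leq_mul; [exact: ltn_ord|exact: ltnW].
  by exists (Ordinal nk).
Qed.

End near_tower.

(** * Towers approximating a given transformation *)

Definition indicators (X : Type) n (B : 'I_n -> set X) (x : X) : {ffun 'I_n -> bool} :=
  [ffun i => `[< B i x >]].

Lemma measurable_indicators d (X : measurableType d) n (B : 'I_n -> set X) v :
  (forall i, measurable (B i)) -> measurable [set x | indicators B x = v].
Proof.
move=> mB; rewrite (_ : [set _ | _] =
    ~` \big[setU/set0]_(i < n) (if v i then ~` B i else B i)).
  apply: measurableC; apply: bigsetU_measurable => i _.
  by case: ifP => // _; exact: measurableC.
rewrite bigcup_ord; apply/seteqP; split=> x /=.
  move=> <- [i _]; rewrite ffunE; case: ifP => [/asboolP//|/negbT/asboolPn//].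
move=> h; apply/ffunP => i; rewrite ffunE.
case vi : (v i).
  by apply/asboolP; apply: contrapT => nB; apply: h; exists i => //; rewrite vi.
by apply/negbTE/asboolPn => Bi; apply: h; exists i => //; rewrite vi.
Qed.

(** Finite additivity along the fibers of [g]. *)
Lemma fiber_measure_sum (R : realType) d (X : measurableType d) (mu : probability X R)
    (I : finType) (g : X -> I) (A : set X) :
  (forall i, measurable [set x | g x = i]) -> measurable A ->
  \sum_i fine (mu (A `&` [set x | g x = i])) = fine (mu A).
Proof.
move=> mg mA.
have key (r : seq I) : uniq r ->
    measurable (A `&` [set x | g x \in r]) /\
    \sum_(i <- r) fine (mu (A `&` [set x | g x = i])) = fine (mu (A `&` [set x | g x \in r])).
  elim: r => [|i r IH] /=.
    move=> _; rewrite (_ : A `&` _ = set0) ?big_nil ?measure0; last by apply/seteqP; split=> // x [].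
    by split=> //; exact: measurable0.
  case/andP=> ir /IH[mr Hr]; rewrite big_cons Hr.
  have mi : measurable (A `&` [set x | g x = i]) by exact: measurableI.
  have -> : A `&` [set x | g x \in i :: r] =
      (A `&` [set x | g x = i]) `|` (A `&` [set x | g x \in r]).
    apply/seteqP; split=> x /=.
      by rewrite inE => -[Ax /orP[/eqP gx|gx]]; [left|right].
    by rewrite inE => -[[Ax ->]|[Ax gx]]; split=> //; rewrite ?eqxx// gx orbT.
  split; first exact: measurableU.
  rewrite measureU//; first by rewrite fineD// fin_num_measure.
  apply/seteqP; split=> // x [[_ /= gi] [_ /= gr]].
  by move: ir; rewrite -gi gr.
have [_ ->] := key _ (index_enum_uniq I); congr (fine (mu _)).
by apply/setIidPl => x _ /=; rewrite mem_index_enum.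
Qed.

Lemma prior_count_lt (T : eqType) (e : nat -> T) (t t' : nat) : (t < t')%N ->
  e t = e t' -> (\sum_(0 <= s < t) (e s == e t) < \sum_(0 <= s < t') (e s == e t'))%N.
Proof.
move=> tt' ett'; rewrite -ett' (@big_cat_nat _ _ _ t.+1 0 t')//= big_nat_recr//= eqxx addn1.
by rewrite addSn ltnS leq_addr.
Qed.

Section approximating_tower.
Context (R : realType) d (X : measurableType d) (mu : probability X R).
Hypotheses (sX : standard_borel R X) (nmu : nonatomic mu).

(** Cut the set of points with [(lab x, lab (S0 x)) = e] into pieces of
    measure [eta], one for each occurrence of the letter [e] in a balanced word,
    and stack the pieces in the order of the word.  Where consecutive letters
    fit together, [T0 x] has the label of [S0 x]. *)
Lemma word_tower (L : finType) (lab : X -> L) (S0 : mptrans mu) (k : nat)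
    (phi : 'I_k -> L -> R) (eps : R) :
  (forall a, measurable [set x | lab x = a]) -> 0 < eps ->
  (forall j a, `|phi j a| <= 1) ->
  exists (T0 : mptrans mu) (P : nat) (F : nat -> set X) (w : nat -> L) (a : R),
    [/\ [/\ (0 < P)%N, periodic P F, forall t, measurable (F t),
            forall t, T0 @` F t = F t.+1 & `|a| <= 1],
        forall t x, F t x -> lab x = w t,
        (mu (off_tower P F) <= eps%:E)%E,
        exists Q : set X, [/\ measurable Q, (mu Q <= (2 * eps)%:E)%E &
          forall x, ~ Q x -> lab (T0 x) = lab (S0 x)] &
        forall c : 'I_k -> nat,
          `|(\sum_(0 <= i < P) \prod_j phi j (w (c j + j.+1 * i)%N)) / P%:R - a| <= eps].
Proof.
move=> mlab eps0 phi1.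
have mS0 a : measurable [set x | lab (S0 x) = a].
  by rewrite -[X in measurable X]setTI; exact: (mptrans_measurable S0 measurableT (mlab a)).
pose C (e : L * L) : set X := [set x | lab x = e.1] `&` [set x | lab (S0 x) = e.2].
have mC e : measurable (C e) by exact: measurableI.
have m0 e : 0 <= fine (mu (C e)) by rewrite fine_ge0.
have m1 : \sum_e fine (mu (C e)) = 1.
  have := @fiber_measure_sum _ _ _ mu _ (fun x => (lab x, lab (S0 x))) setT _ measurableT.
  rewrite probability_setT /= => <-.
    apply: eq_bigr => -[a b] _; congr (fine (mu _)); rewrite setTI.
    by apply/seteqP; split=> x /=; [by case=> /= -> ->|by case=> e1 e2; split].
  move=> [a b]; rewrite (_ : [set x | _] = C (a, b))//.
  by apply/seteqP; split=> x /=; [by case=> e1 e2; split|by case=> /= -> ->].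
have mbal a : \sum_b fine (mu (C (a, b))) = \sum_b fine (mu (C (b, a))).
  rewrite /C /= (fiber_measure_sum _ mS0 (mlab a)).
  transitivity (fine (mu [set x | lab (S0 x) = a])).
    by congr fine; exact: esym (mptrans_preserving S0 (mlab a)).
  rewrite -(fiber_measure_sum _ mlab (mS0 a)).
  by apply: eq_bigr => b _; rewrite setIC.
have [P [e [eta [a [[P0 eta0 a1] eper ecount [Peta ebad] eavg]]]]] :=
  balanced_word eps0 m0 m1 mbal phi1.
pose cnt x := (\sum_(0 <= t < P) (e t == x))%N.
have cutex x : exists D : nat -> set X, [/\ forall i, (i < cnt x)%N -> measurable (D i),
    forall i, (i < cnt x)%N -> D i `<=` C x,
    forall i, (i < cnt x)%N -> mu (D i) = eta%:E &
    trivIset [set i | (i < cnt x)%N] D].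
  apply: (equal_cut sX nmu (mC x) (ltW eta0)).
  rewrite -[leRHS]fineK; last exact: fin_num_measure.
  by rewrite lee_fin; apply: le_trans (ecount x); rewrite natr_sum.
have [cut cutP] := choice cutex.
(* The number of earlier occurrences of the letter [e t]: the index of the piece
   assigned to [t]. *)
pose rk t := (\sum_(0 <= s < t) (e s == e t))%N.
have rk_lt t : (t < P)%N -> (rk t < cnt (e t))%N.
  move=> tP; rewrite /rk /cnt (@big_cat_nat _ _ _ t.+1 0 P)//= big_nat_recr//= eqxx addn1.
  by rewrite addSn ltnS leq_addr.
pose D t := cut (e t) (rk t).
have DC t : (t < P)%N -> D t `<=` C (e t).
  by move=> tP; have [_ h _ _] := cutP (e t); apply: h; exact: rk_lt.
have tD : trivIset [set t | (t < P)%N] D.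
  move=> t t' /= tP t'P [x [Dt Dt']].
  have ett' : e t = e t'.
    have [/= h1 h2] := DC t tP x Dt; have [/= h3 h4] := DC t' t'P x Dt'.
    by rewrite [LHS]surjective_pairing [RHS]surjective_pairing -h1 -h2 -h3 -h4.
  have rr : rk t = rk t'.
    have [_ _ _ tr] := cutP (e t); apply: tr => /=; first exact: rk_lt.
      by rewrite ett'; exact: rk_lt.
    by exists x; split=> //; rewrite ett'.
  case: (ltngtP t t') => // tt'.
    by have := prior_count_lt tt' ett'; rewrite -/(rk t) -/(rk t') rr ltnn.
  by have := prior_count_lt tt' (esym ett'); rewrite -/(rk t) -/(rk t') rr ltnn.
have [|||T0 [F [Fper mF FD muF T0F]]] := @periodic_tower _ _ _ mu P D eta sX nmu P0 (ltW eta0).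
- by move=> t tP; have [h _ _ _] := cutP (e t); apply: h; exact: rk_lt.
- by move=> t tP; have [_ _ h _] := cutP (e t); apply: h; exact: rk_lt.
- exact: tD.
have FC t : F t `<=` C (e t).
  rewrite -(periodic_mod Fper t) -(periodic_mod eper t).
  by apply: subset_trans (FD _ _) (DC _ _); rewrite ltn_mod.
have muU (q : pred 'I_P) : mu (\big[setU/set0]_(t < P | q t) F t) = ((\sum_(t < P | q t) 1) * eta)%:E.
  rewrite measure_bigsetU_ord//.
    transitivity (\sum_(t < P | q t) eta%:E)%E; first by apply: eq_bigr => t _; exact: muF.
    by rewrite sumEFin mulr_suml; congr EFin; apply: eq_bigr => t _; rewrite mul1r.
  move=> t t' _ _ [x [Ft Ft']]; apply/val_inj; apply: tD => /=; [exact: ltn_ord|exact: ltn_ord|].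
  by exists x; split; apply: FD.
have off : (mu (off_tower P F) <= eps%:E)%E.
  rewrite /off_tower probability_setC; last by apply: bigsetU_measurable => t _.
  by rewrite (muU predT) sumr_const card_ord -EFinB lee_fin lerBlDl -lerBlDr.
exists T0, P, F, (fun t => (e t).1), a; split=> //.
- by move=> t x /FC[].
- pose bad (t : 'I_P) := (e t).2 != (e t.+1).1.
  have mo : measurable (off_tower P F).
    by apply: measurableC; apply: bigsetU_measurable => t _.
  exists (off_tower P F `|` \big[setU/set0]_(t < P | bad t) F t); split.
  + by apply: measurableU => //; apply: bigsetU_measurable => t _.
  + apply: (@le_trans _ _ (mu (off_tower P F) + mu (\big[setU/set0]_(t < P | bad t) F t))%E).
      by apply: measureU2 => //; apply: bigsetU_measurable => t _.
    rewrite mulr_natl mulr2n EFinD; apply: leeD => //.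
    rewrite muU lee_fin; apply: le_trans ebad; rewrite ler_pM2r// big_mkord big_mkcond /=.
    by apply: ler_sum => t _; rewrite /bad; case: (_ != _).
  + move=> x nQ; have [t Ft] : exists t, F t x.
      by apply: (in_tower (P := P)) => h; apply: nQ; left.
    rewrite -(periodic_mod Fper t) in Ft.
    set s := (t %% P)%N in Ft; have sP : (s < P)%N by rewrite ltn_mod.
    have [_ /= ->] := FC _ _ Ft.
    have Fs : F s.+1 (T0 x) by rewrite -T0F; exists x.
    have [/= -> _] := FC _ _ Fs.
    apply/eqP; rewrite eq_sym; apply: contraT => badt; exfalso; apply: nQ; right.
    rewrite -(bigcup_pred [pred t | bad t]); exists (Ordinal sP) => //=.
Qed.

End approximating_tower.

(** * Flatness near every transformation *)

Section flat_near.
Context (R : realType) d (X : measurableType d) (mu : probability X R).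
Hypotheses (sX : standard_borel R X) (nmu : nonatomic mu).

(** Both differences are images under [T] of points at which [S] and [T] are
    told apart by the set [S @` B]. *)
Lemma symdiff_of_labels (S T : mptrans mu) (B Q : set X) (e : R) :
  measurable B -> measurable Q -> (mu Q <= e%:E)%E ->
  (forall x, ~ Q x -> (B x <-> (S @` B) (T x))) ->
  (mu ((T @` B) `+` (S @` B)) <= e%:E)%E.
Proof.
move=> mB mQ Qe lab; apply: le_trans Qe; rewrite -(mptrans_image_mu T mQ).
apply: le_measure; rewrite ?inE; [exact: measurable_symdiff|exact: mptrans_measurable_image|].
move=> y [[[x Bx Txy] nS]|[SBy nT]].
  exists x => //; rewrite -Txy in nS; apply: contrapT => nQ; apply: nS.
  by apply/(lab x nQ).
have [Ti TK TiK] := mptrans_bij T.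
exists (Ti y); last exact: TiK.
apply: contrapT => nQ; apply: nT; exists (Ti y); last exact: TiK.
by apply/(lab _ nQ); rewrite TiK.
Qed.

(** The labels record membership in the sets [B i] and [S0 @` B i], which
    decide closeness to [S0], and in the sets [A j], which decide the averages. *)
Lemma flat_near (S0 : mptrans mu) (l : nat) (B : 'I_l -> set X) (delta0 : R)
    (k : nat) (A : 'I_k -> set X) (eps : R) :
  (forall i, measurable (B i)) -> (forall j, measurable (A j)) ->
  0 < delta0 -> 0 < eps ->
  exists T0 : mptrans mu,
    (forall i, (mu ((T0 @` B i) `+` (S0 @` B i)) < delta0%:E)%E) /\
    exists (P : nat) (F : nat -> set X) (delta1 : R),
    [/\ 0 < delta1, forall t, measurable (F t) &
      forall S : mptrans mu,
      (forall t, (t < P)%N -> (mu ((S @` F t) `+` (T0 @` F t)) < delta1%:E)%E) ->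
      eventually_flat mu S (fun j => \1_(A j)) eps].
Proof.
move=> mB mA delta00 eps0.
(* The error is at most delta + 2 k lam + 2 P / N with delta = e1, and the
   exceptional set has measure at most 2 k e1 / lam; the choices of [lam] and
   [e1] make each contribution a fraction of eps. *)
pose lam := eps / (8 * k.+1%:R).
have k1 : 0 < k.+1%:R :> R by rewrite ltr0n.
have lam0 : 0 < lam by rewrite divr_gt0// mulr_gt0.
pose e1 := Num.min (delta0 / 4) (Num.min (eps / 4) (eps * lam / (2 * k.+1%:R))).
have e10 : 0 < e1.
  by rewrite !lt_min !divr_gt0 ?mulr_gt0.
have e1d : e1 <= delta0 / 4 by rewrite ge_min lexx.
have e1e : e1 <= eps / 4 by rewrite !ge_min lexx orbT.
have e1l : e1 <= eps * lam / (2 * k.+1%:R) by rewrite !ge_min lexx !orbT.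
pose L : finType := ({ffun 'I_l -> bool} * {ffun 'I_l -> bool} * {ffun 'I_k -> bool})%type.
pose lab x : L := (indicators B x, indicators (fun i => S0 @` B i) x, indicators A x).
have mlab a : measurable [set x | lab x = a].
  case: a => [[u v] w].
  rewrite (_ : [set _ | _] = [set x | indicators B x = u] `&`
     [set x | indicators (fun i => S0 @` B i) x = v] `&` [set x | indicators A x = w]).
    do 2?apply: measurableI; apply: measurable_indicators => // i.
    exact: mptrans_measurable_image.
  by apply/seteqP; split=> x /=; [case=> -> -> ->|case=> [[e2 e3] e4]; rewrite /lab e2 e3 e4].
have phi1 (j : 'I_k) (a : L) : `|(a.2 j)%:R| <= 1 :> R.
  by case: (a.2 j); rewrite ?normr0 ?normr1.
have [T0 [P [F [w [a [[P0 Fper mF T0F a1] Fw off [Q [mQ Qe Qlab]] word]]]]]] :=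
  word_tower sX nmu S0 mlab e10 phi1.
exists T0; split.
  move=> i; apply: (@le_lt_trans _ _ (2 * e1)%:E); last by rewrite lte_fin; lra.
  apply: (symdiff_of_labels (mB i) mQ Qe) => x nQ.
  have h : lab (T0 x) = lab (S0 x) := Qlab x nQ.
  have := congr1 (fun a : L => a.1.2 i) h; rewrite /lab /= !ffunE => e.
  split=> [Bx|TB].
    by apply/asboolP; rewrite e; apply/asboolP; exists x.
  have : `[< (S0 @` B i) (S0 x) >] by rewrite -e; apply/asboolP.
  by move=> /asboolP[y By /(bij_inj (mptrans_bij S0)) <-].
(* There are P levels, and each is followed for k P steps. *)
pose delta1 := e1 / (k.+1 * P * P)%:R.
have kP : 0 < (k.+1 * P * P)%:R :> R by rewrite ltr0n !muln_gt0 P0.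
exists P, F, delta1; split=> //; first by rewrite divr_gt0.
move=> S near.
have mS : measurable_fun setT S by exact: mptrans_measurable.
have pS D : measurable D -> mu (S @^-1` D) = mu D by exact: mptrans_preserving.
have fw (j : 'I_k) t x : F t x -> \1_(A j) x = ((w t).2 j)%:R :> R.
  move=> Ft; have <- := Fw t x Ft; rewrite /lab /= ffunE indicE.
  by have [Ax|Ax] := pselect (A j x); [rewrite mem_set// asboolT|rewrite memNset// asboolF].
have near' t : (t < P)%N -> (mu ((S @` F t) `+` (T0 @` F t)) <= delta1%:E)%E.
  by move=> tP; apply/ltW/near.
have [E [mE muE win]] := near_tower_windows P0 Fper mF T0F fw off word near'.
have muE' : (mu E <= (2 * e1)%:E)%E.
  apply: le_trans muE _; rewrite lee_fin (_ : 2 * e1 = e1 + e1) ?lerD2l; last by ring.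
  rewrite mulrA -natrM /delta1 mulrCA -[leRHS]mulr1 ler_pM2l// ler_pdivrMr// mul1r ler_nat.
  by rewrite -!mulnA leq_mul.
have A1 (j : 'I_k) x : `|\1_(A j) x| <= 1 :> R.
  by rewrite indicE; case: (_ \in _); rewrite ?normr0 ?normr1.
have [W [mW muW Wout]] := flat_of_windows mS pS A1 P0 mE lam0 a1 (ltW e10) win.
exists a, (Num.truncn (8 * P%:R / eps)).+1, W; split=> //.
- have fW : mu W \is a fin_num by exact: fin_num_measure.
  have fE : mu E \is a fin_num by exact: fin_num_measure.
  move: muW muE'; rewrite -(fineK fW) -(fineK fE) -!EFinM !lee_fin => h1 h2.
  rewrite -(ler_pM2l lam0); apply: le_trans h1 _.
  apply: (@le_trans _ _ (k.+1%:R * (2 * e1))).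
    by apply: ler_pM => //; [exact: fine_ge0|rewrite ler_nat].
  have h3 : e1 * (2 * k.+1%:R) <= eps * lam by move: e1l; rewrite ler_pdivlMr ?mulr_gt0.
  by rewrite (_ : k.+1%:R * (2 * e1) = e1 * (2 * k.+1%:R)) ?[lam * eps]mulrC//; ring.
- move=> x nW N NM.
  have N0 : (0 < N)%N by apply: leq_trans NM.
  apply: le_trans (Wout x nW N N0) _.
  have Nr : 0 < N%:R :> R by rewrite ltr0n.
  have h1 : 2 * P%:R / N%:R <= eps / 4.
    rewrite ler_pdivrMr//.
    have : 8 * P%:R / eps < N%:R.
      by apply: lt_le_trans (truncnS_gt _) _; rewrite ler_nat.
    by rewrite ltr_pdivrMr// => h; nra.
  have h2 : k%:R * lam <= eps / 8.
    have kk : k%:R <= k.+1%:R :> R by rewrite ler_nat.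
    apply: (@le_trans _ _ (k.+1%:R * lam)); first by rewrite ler_wpM2r// ltW.
    rewrite le_eqVlt; apply/orP; left; apply/eqP; rewrite /lam; field.
    by rewrite gt_eqF.
  lra.
Qed.

End flat_near.

(** * Density in the weak topology *)

Section weak.
Context (R : realType) d (X : measurableType d) (mu : probability X R).

Lemma Aut_class_surj (a : Aut mu) : exists S : mptrans mu, a = Aut_class S.
Proof. by exists (generic_quotient.repr a); rewrite /Aut_class reprK. Qed.

Lemma weak_ball_open (A : set X) (T : mptrans mu) (e : R) :
  measurable A -> open (weak_ball (A, T, e)).
Proof.
move=> mA; exists [set weak_ball (A, T, e)]; last exact: bigcup_set1.
by move=> _ ->; exact: (@finI_from1 _ _ _ (@weak_ball R d X mu) (A, T, e)).
Qed.

(** Basic open sets are finite intersections of weak balls; recentering them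
    at [S0] and taking the least radius gives the required [delta]. *)
Lemma weak_nbhd (O : set (Aut mu)) (S0 : mptrans mu) :
  open O -> O (Aut_class S0) ->
  exists (l : nat) (B : 'I_l -> set X) (delta : R),
    [/\ forall i, measurable (B i), 0 < delta &
     forall S : mptrans mu,
       (forall i, (mu ((S @` B i) `+` (S0 @` B i)) < delta%:E)%E) -> O (Aut_class S)].
Proof.
case=> F FD FV; rewrite -FV => -[W FW WS0].
have [J JD JW] := FD W FW.
pose I : choiceType := (set X * mptrans mu * R)%type.
pose s0 : seq I := finmap.enum_fset J.
have ball1 (i : I) : i \in s0 -> measurable i.1.1 /\ exists2 e : R, 0 < e &
    forall S : mptrans mu, (mu ((S @` i.1.1) `+` (S0 @` i.1.1)) < e%:E)%E ->
      weak_ball i (Aut_class S).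
  case: i => [[A T] e] iJ; have mA : measurable A by have := JD _ iJ; rewrite inE.
  split=> //=.
  have S0i : weak_ball (A, T, e) (Aut_class S0) by move: WS0; rewrite -JW => /(_ _ iJ).
  move/(weak_ballP _ _ _ mA) : S0i => S0e.
  have fin : mu ((S0 @` A) `+` (T @` A)) \is a fin_num.
    by apply: fin_num_measure; exact: measurable_symdiff.
  exists (e - fine (mu ((S0 @` A) `+` (T @` A)))).
    by rewrite subr_gt0 -lte_fin fineK.
  move=> S Se; apply/weak_ballP => //.
  apply: (le_lt_trans (symdiff_triangle S S0 T mA)).
  by rewrite -lteBrDr// -[X in (_ - X)%E]fineK// -EFinB.
have list (s : seq I) : {subset s <= s0} -> exists2 delta : R, 0 < delta &
    forall i, i \in s -> measurable i.1.1 /\ forall S : mptrans mu,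
      (mu ((S @` i.1.1) `+` (S0 @` i.1.1)) < delta%:E)%E -> weak_ball i (Aut_class S).
  elim: s => [|i s IH] sJ; first by exists 1.
  have [|e e0 he] := IH; first by move=> x xs; apply: sJ; rewrite inE xs orbT.
  have [mi [e' e'0 he']] := ball1 i (sJ i (mem_head _ _)).
  exists (Num.min e e'); first by rewrite lt_min e0.
  move=> x; rewrite inE => /orP[/eqP ->|xs].
    split=> // S hS; apply: he'; apply: lt_le_trans hS _.
    by rewrite lee_fin ge_min lexx orbT.
  have [mx hx] := he x xs; split=> // S hS; apply: hx; apply: lt_le_trans hS _.
  by rewrite lee_fin ge_min lexx.
have [e e0 he] := list s0 (fun i iJ => iJ).
exists (size s0), (fun i => (nth (set0, idmp mu, 0) s0 i).1.1), e.
have nJ (i : 'I_(size s0)) :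
    nth (set0, idmp mu, 0) s0 i \in s0 by rewrite mem_nth.
split=> //; first by move=> i; case: (he _ (nJ i)).
move=> S hS; suff WS : (W : set (Aut mu)) (Aut_class S) by exists W.
rewrite -JW => i iJ.
have iJ' : (i : I) \in s0 by exact: iJ.
have [_ h] := he i iJ'; apply: h.
have lt : (index i s0 < size s0)%N by rewrite index_mem.
by have := hS (Ordinal lt); rewrite /= nth_index.
Qed.

End weak.

Section residual_flat.
Context (R : realType) d (X : measurableType d) (mu : probability X R).
Hypotheses (sX : standard_borel R X) (nmu : nonatomic mu).

(** The union of the open sets consisting of flat transformations, open by
    construction. *)
Definition flat_interior (k : nat) (A : 'I_k -> set X) (eps : R) : set (Aut mu) :=
  \bigcup_(V in [set V | open V /\ forall S : mptrans mu, V (Aut_class S) ->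
     eventually_flat mu S (fun j => \1_(A j)) eps]) V.

Lemma flat_interior_open k (A : 'I_k -> set X) eps : open (flat_interior A eps).
Proof. by apply: bigcup_open => V []. Qed.

Lemma flat_interior_dense k (A : 'I_k -> set X) eps :
  (forall j, measurable (A j)) -> 0 < eps -> dense (flat_interior A eps).
Proof.
move=> mA eps0 O [a Oa] oO; have [S0 aS0] := Aut_class_surj a.
rewrite aS0 in Oa; have [l [B [delta [mB delta0 near]]]] := weak_nbhd oO Oa.
have [T0 [T0near [P [F [delta1 [delta10 mF flat]]]]]] :=
  flat_near sX nmu S0 mB mA delta0 eps0.
exists (Aut_class T0); split; first exact: near.
exists (\big[setI/setT]_(t < P) weak_ball (F t, T0, delta1)).
  split.
    apply: (big_ind open); [exact: openT|exact: openI|move=> t _].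
    exact: weak_ball_open.
  move=> S hS; apply: flat => t tP; apply/weak_ballP => //.
  by move: hS; rewrite (bigD1 (Ordinal tP))//= => -[].
elim/big_ind: _ => // t _.
apply/weak_ballP => //; rewrite symdiff_ae_eq ?ae_eq_mp_refl ?lte_fin//.
Qed.

(** There are countably many tuples of indices and tolerances, coded here by
    [seq (seq nat) * nat]. *)
Lemma residual_flat (pi : seq nat -> set X) : (forall s, measurable (pi s)) ->
  exists G : set (Aut mu), residual G /\ forall T : mptrans mu, G (Aut_class T) ->
    forall (k : nat) (s : 'I_k -> seq nat) (eps : R), 0 < eps ->
      eventually_flat mu T (fun j => \1_(pi (s j))) eps.
Proof.
move=> mpi.
pose O (i : seq (seq nat) * nat) : set (Aut mu) :=
  flat_interior (fun j : 'I_(size i.1) => pi (nth [::] i.1 j)) (i.2.+1%:R^-1).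
pose U n : set (Aut mu) := if unpickle n is Some i then O i else setT.
exists (\bigcap_n U n); split.
  exists U; split=> // n; rewrite /U; case: unpickle => [i|].
    split; first exact: flat_interior_open.
    by apply: flat_interior_dense => //; rewrite invr_gt0 ltr0n.
  by split; [exact: openT|move=> V [a Va] _; exists a].
move=> T GT k s eps eps0.
pose n := Num.truncn eps^-1.
have ne : n.+1%:R^-1 <= eps.
  by rewrite invf_ple ?posrE// ltW//; exact: truncnS_gt.
have := GT (pickle ([seq s j | j <- enum 'I_k], n)) I.
rewrite /U pickleK => -[V [oV hV] VT].
have sk : size [seq s j | j <- enum 'I_k] = k by rewrite size_map size_enum_ord.
have cast m (f : 'I_m -> X -> R) (g : 'I_k -> X -> R) e : m = k ->
    (forall j j', nat_of_ord j = nat_of_ord j' -> f j = g j') ->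
    eventually_flat mu T f e -> eventually_flat mu T g e.
  move=> mk; move: f; rewrite mk => f fg.
  by have -> : f = g by apply/funext => j; exact: fg.
have flat : eventually_flat mu T (fun j => \1_(pi (s j))) (n.+1%:R^-1).
  apply: cast sk _ (hV T VT) => j j' jj'.
  by rewrite /= jj' (nth_map j') ?size_enum_ord// nth_ord_enum.
move: flat => [c [M [W [mW muW h]]]]; exists c, M, W; split=> //.
  by apply: le_trans muW _; rewrite lee_fin.
by move=> x nW N MN; apply: le_trans (h x nW N MN) ne.
Qed.

End residual_flat.

(** * A monotone class lemma for bounded functions *)

(** Dynkin's theorem gives the indicators, linearity the step functions, and
    a bounded function is uniformly approximated by step functions built on its
    superlevel sets. *)
Lemma bounded_function_class (R : realType) d (X : measurableType d)
    (mu : probability X R) (G : set (set X)) (H : (X -> R) -> Prop) :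
  @measurable d X = <<s G >> -> setI_closed G -> G setT ->
  (forall A, G A -> H \1_A) ->
  (forall (a b : R) g h, H g -> H h -> H (fun x => a * g x + b * h x)) ->
  (forall (g : X -> R) (C : R), measurable_fun setT g -> (forall x, `|g x| <= C) ->
     (forall eps : R, 0 < eps -> exists h : X -> R, [/\ measurable_fun setT h, forall x, `|h x| <= C,
        H h & (\int[mu]_x (`|g x - h x|)%:E <= eps%:E)%E]) -> H g) ->
  forall (g : X -> R) (C : R), measurable_fun setT g -> (forall x, `|g x| <= C) -> H g.
Proof.
move=> GE GI GT HG Hlin HL1.
have ext g h : g =1 h -> H g -> H h by move=> /funext ->.
have H1 : H (\1_[set: X]) by exact: HG.
have bI (A : set X) x : `|\1_A x| <= 1 :> R.
  by rewrite indicE; case: (_ \in _); rewrite ?normr0 ?normr1.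
have HC A : H \1_A -> H \1_(~` A).
  move=> HA; apply: ext (Hlin 1 (-1) _ _ H1 HA) => x.
  rewrite !indicE in_setT; have [Ax|nAx] := pselect (A x).
    by rewrite mem_set// memNset//=; lra.
  by rewrite memNset// mem_set//=; lra.
have H0 : H \1_set0 by rewrite -setCT; exact: HC.
have Hset A : measurable A -> H \1_A.
  rewrite GE; apply: (@dynkin_induction _ X G (fun A => H \1_A) GE GI) => //.
    by move=> B mB; exact: HC.
  move=> F mF tF HF.
  have mU n : measurable (\bigcup_(i < n) F i) by apply: bigcup_measurable.
  have mUU : measurable (\bigcup_n F n) by exact: bigcupT_measurable.
  have HU n : H \1_(\bigcup_(i < n) F i).
    elim: n => [|n IH]; first by rewrite bigcup_mkord big_ord0.
    apply: ext (Hlin 1 1 _ _ IH (HF n)) => x; rewrite !mul1r.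
    rewrite !bigcup_mkord big_ord_recr /= -!bigcup_mkord !indicE in_setU.
    have [Ux|nUx] := pselect ((\bigcup_(i < n) F i) x); last first.
      by rewrite (memNset nUx) add0r.
    rewrite (mem_set Ux) /= memNset ?addr0// => Fx.
    case: Ux => i /= iltn Fi; have := tF i n I I; rewrite -/(F i `&` F n !=set0).
    by move=> h; move: iltn; rewrite h ?ltnn//; exists x.
  apply: (HL1 _ 1) => //.
  move=> eps eps0.
  have cv : (mu \o (fun n => \bigcup_(i < n) F i)) n @[n --> \oo] --> mu (\bigcup_n F n).
    have UU : \bigcup_n \bigcup_(i < n) F i = \bigcup_n F n.
      apply/seteqP; split=> x; first by move=> [n _ [i _ Fi]]; exists i.
      by move=> [n _ Fn]; exists n.+1 => //; exists n => /=.
    rewrite -UU; apply: nondecreasing_cvg_mu => //; first by rewrite UU.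
    apply/nondecreasing_seqP => n; apply/subsetPset => x [i /= iltn Fi].
    by exists i => //=; exact: ltnW.
  have fU n : mu (\bigcup_(i < n) F i) \is a fin_num by exact: fin_num_measure.
  have fUU : mu (\bigcup_n F n) \is a fin_num by exact: fin_num_measure.
  rewrite -(fineK fUU) in cv.
  have /fine_cvgP[_ /cvgrPdist_le /(_ _ eps0)[n _ /(_ n (leqnn n)) /= hn]] := cv.
  exists \1_(\bigcup_(i < n) F i); split=> //.
  have sub : \bigcup_(i < n) F i `<=` \bigcup_n F n by move=> x [i _ Fi]; exists i.
  rewrite (_ : (fun x => _) = (fun x => (\1_(\bigcup_n F n `\` \bigcup_(i < n) F i) x : R)%:E)); last first.
    apply/funext => x; congr EFin; rewrite !indicE in_setD.
    have [Ux|nUx] := pselect ((\bigcup_(i < n) F i) x).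
      by rewrite (mem_set Ux) (mem_set (sub _ Ux))/= subrr normr0.
    by rewrite (memNset nUx) andbT subr0 normr_nat.
  rewrite integral_indic//; last exact: measurableD.
  have e0 : mu (\bigcup_k F k) = (mu (\bigcup_k F k `\` \bigcup_(i < n) F i) +
      mu (\bigcup_(i < n) F i))%E.
    by have := measureDI mu mUU (mU n); rewrite ((setIidPr _ _).2 sub).
  have fD : mu (\bigcup_k F k `\` \bigcup_(i < n) F i) \is a fin_num.
    by apply: fin_num_measure; exact: measurableD.
  rewrite setIT; suff : (mu (\bigcup_k F k `\` \bigcup_(i < n) F i) <= eps%:E)%E by [].
  move: e0; rewrite -[X in (X <= _)%E](fineK fD).
  rewrite -{1}(fineK fD) -(fineK fUU) -(fineK (fU n)) -EFinD => -[e].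
  rewrite lee_fin; apply: le_trans hn; apply: le_trans (ler_norm _).
  by rewrite /= e addrK.
have Hsum (A : nat -> set X) (a : R) n : (forall i, measurable (A i)) ->
    H (fun x => \sum_(i < n) a * \1_(A i) x).
  move=> mA; elim: n => [|n IH].
    by apply: ext H0 => x; rewrite big_ord0 indicE in_set0.
  apply: ext (Hlin 1 a _ _ IH (Hset _ (mA n))) => x.
  by rewrite big_ord_recr /= mul1r.
move=> g C mg gC.
(* Shifting by [C'] makes the function nonnegative, so that its integer part
   counts superlevel sets. *)
pose C' : nat := (Num.truncn C).+1.
have gC' x : 0 <= g x + C'%:R <= (2 * C')%:R.
  have : C < C'%:R by exact: truncnS_gt.
  have := gC x; rewrite ler_norml natrM => /andP[h1 h2] h3; apply/andP; split; lra.
pose A m (i : nat) := [set x | i.+1%:R <= m.+1%:R * (g x + C'%:R)].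
have mA m i : measurable (A m i).
  have mh : measurable_fun setT (fun x => m.+1%:R * (g x + C'%:R)).
    by apply: measurable_funM => //; apply: measurable_funD => //; exact: measurable_cst.
  have -> : A m i = (fun x => m.+1%:R * (g x + C'%:R)) @^-1` `[i.+1%:R, +oo[.
    by apply/seteqP; split=> x; rewrite /A /preimage /= in_itv /= andbT.
  by rewrite -[X in measurable X]setTI; exact: mh.
pose gm m x : R := \sum_(i < m.+1 * (2 * C')) m.+1%:R^-1 * \1_(A m i) x - C'%:R.
have sumE m x : \sum_(i < m.+1 * (2 * C')) \1_(A m i) x =
    (Num.truncn (m.+1%:R * (g x + C'%:R)))%:R :> R.
  set t := m.+1%:R * _.
  have /andP[g0 g2] := gC' x.
  have t0 : 0 <= t by rewrite mulr_ge0.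
  have tK : (Num.truncn t <= m.+1 * (2 * C'))%N.
    rewrite -(ler_nat R); apply: le_trans (_ : t <= _).
      by case/andP: (truncn_itv t0).
    by rewrite [leRHS]natrM ler_pM2l ?ltr0n.
  have indE (i : nat) : \1_(A m i) x = (i < Num.truncn t)%N%:R :> R.
    rewrite indicE; congr (_%:R); congr nat_of_bool.
    rewrite truncn_ge_nat// -/t; apply/idP/idP; first by rewrite inE.
    by move=> h; rewrite inE.
  under eq_bigr do rewrite indE.
  rewrite -(big_mkord xpredT (fun i => (i < Num.truncn t)%N%:R)).
  rewrite (@big_cat_nat _ _ _ (Num.truncn t))//= big_nat (eq_bigr (fun=> 1)); last first.
    by move=> i /andP[_ ->].
  rewrite -big_nat [X in _ + X]big_nat [X in _ + X]big1 ?addr0; last first.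
    by move=> i /andP[h _]; rewrite ltnNge h.
  by rewrite big_const_nat subn0 iter_addr_0.
have gmE m x : gm m x <= g x <= gm m x + m.+1%:R^-1.
  have mp : 0 < m.+1%:R :> R by rewrite ltr0n.
  rewrite /gm -mulr_sumr sumE; set t := m.+1%:R * _.
  have t0 : 0 <= t by rewrite mulr_ge0//; case/andP: (gC' x).
  have gt : g x = m.+1%:R^-1 * t - C'%:R by rewrite /t mulKf ?gt_eqF// addrK.
  have /andP[h1 h2] := truncn_itv t0.
  have i0 : 0 < m.+1%:R^-1 :> R by rewrite invr_gt0.
  rewrite {1 2}gt lerD2r ler_pM2l// h1 /= addrAC lerD2r -{3}[m.+1%:R^-1]mulr1 -mulrDr ler_pM2l//.
  by rewrite natr1 ltW.
have Hgm m : H (gm m).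
  have h := Hlin 1 (- C'%:R) _ _ (Hsum (A m) m.+1%:R^-1 (m.+1 * (2 * C'))%N (mA m)) H1.
  by apply: ext h => x; rewrite /gm mul1r indicE in_setT mulr1.
have mgm m : measurable_fun setT (gm m).
  apply: measurable_funB; last exact: measurable_cst.
  by apply: measurable_sum => i; apply: measurable_funM => //; exact: measurable_indic.
apply: (HL1 g (C + 1)) => //; first by move=> x; apply: le_trans (gC x) _; rewrite lerDl.
move=> eps eps0; pose m := Num.truncn eps^-1.
have me : m.+1%:R^-1 <= eps by rewrite invf_ple ?posrE// ltW//; exact: truncnS_gt.
have m1 : m.+1%:R^-1 <= 1 :> R by rewrite invf_le1 ?ltr0n// ler1n.
exists (gm m); split=> //.
  move=> x; have /andP[h1 h2] := gmE m x; have := gC x.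
  by move: m1 h1 h2; rewrite !ler_norml; move: (_^-1) (gm m x) => i z m1 h1 h2 /andP[h3 h4]; apply/andP; split; lra.
apply: (@le_trans _ _ (\int[mu]_x (cst eps%:E x))%E).
  apply: ge0_le_integral => //.
  - apply/measurable_EFinP; apply: measurableT_comp => //; exact: measurable_funB.
  - move=> x _; rewrite lee_fin ler_norml; have /andP[h1 h2] := gmE m x.
    by move: me h1 h2; move: (_^-1) (gm m x) => i z me h1 h2; apply/andP; split; lra.
by rewrite integral_cst//= probability_setT mule1.
Qed.

(** * Averages of bounded real functions *)

(** A quantitative form of almost sure convergence: it passes to limits by
    plain estimates, with no need to discuss null sets at each stage. *)
Definition almost_cauchy (R : realType) d (X : measurableType d)
    (mu : probability X R) (u : nat -> X -> R) : Prop :=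
  forall eps : R, 0 < eps -> exists W : set X, [/\ measurable W, (mu W <= eps%:E)%E &
    forall x, ~ W x -> exists M : nat, forall N N' : nat,
      (M <= N)%N -> (M <= N')%N -> `|u N x - u N' x| <= eps].

Section almost_cauchy_lemmas.
Context (R : realType) d (X : measurableType d) (mu : probability X R).

(** A point at which the Cauchy property fails lies in all the exceptional sets
    of tolerance [1 / (i + 1)] from some [i] on, and these have arbitrarily
    small measure. *)
Lemma almost_cauchy_ae (u : nat -> X -> R) : almost_cauchy mu u ->
  {ae mu, forall x, cvgn (fun N => u N x)}.
Proof.
move=> cu.
have e0 (i : nat) : 0 < (i.+1%:R^-1 : R) by rewrite invr_gt0 ltr0n.
have [W WP] := choice (fun i => cu _ (e0 i)).
have h0 m : mu (\bigcap_(i in [set i | (m <= i)%N]) W i) = 0%E.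
  have mcap : measurable (\bigcap_(i in [set i | (m <= i)%N]) W i).
    by apply: bigcap_measurable => [|i _]; [exists m => /=|case: (WP i)].
  apply/eqP; rewrite eq_le measure_ge0 andbT; apply/lee_addgt0Pr => e e1.
  rewrite add0e; pose i := maxn m (Num.truncn e^-1).
  have [mW muW _] := WP i.
  apply: (@le_trans _ _ (mu (W i))).
    by apply: le_measure; rewrite ?inE// => x; apply => /=; exact: leq_maxl.
  apply: le_trans muW _; rewrite lee_fin invf_ple ?posrE//.
  by apply: ltW; apply: lt_le_trans (truncnS_gt _) _; rewrite ler_nat ltnS leq_maxr.
apply: (negligibleS (A := \bigcup_m \bigcap_(i in [set i | (m <= i)%N]) W i)); last first.
  apply: negligible_bigcup => m; apply/negligibleP; last exact: h0.
  by apply: bigcap_measurable => [|i _]; [exists m => /=|case: (WP i)].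
move=> x /= ncv; apply: contrapT => nU; apply: ncv.
apply: cauchy_cvg; apply: cauchy_exP => e e1.
pose m := Num.truncn e^-1.
have [i mi nWi] : exists2 i, (m <= i)%N & ~ W i x.
  apply: contrapT => h; apply: nU; exists m => // i /= mi.
  by apply: contrapT => nWi; apply: h; exists i.
have [_ _ /(_ x nWi)[M hM]] := WP i.
exists (u M x); exists M => // N /= MN; apply: le_lt_trans (hM _ _ (leqnn M) MN) _.
rewrite invf_plt ?posrE//; apply: lt_le_trans (truncnS_gt _) _.
by rewrite ler_nat ltnS.
Qed.

Lemma almost_cauchy_ext (u v : nat -> X -> R) : (forall N x, u N x = v N x) ->
  almost_cauchy mu u -> almost_cauchy mu v.
Proof.
move=> uv; suff -> : u = v by [].
by apply/funext => N; apply/funext => x.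
Qed.

Lemma almost_cauchy_lin (a b : R) (u v : nat -> X -> R) :
  almost_cauchy mu u -> almost_cauchy mu v ->
  almost_cauchy mu (fun N x => a * u N x + b * v N x).
Proof.
move=> cu cv eps eps0.
pose K := `|a| + `|b| + 1; have K0 : 0 < K by rewrite ltr_pwDr ?addr_ge0.
have K1 : 1 <= K by rewrite lerDr addr_ge0.
pose e := eps / (2 * K).
have e0 : 0 < e by rewrite divr_gt0// mulr_gt0.
have Ke : e * K = eps / 2 by rewrite /e; field; rewrite gt_eqF.
have ee : e + e <= eps.
  have : e <= e * K by rewrite ler_peMr// ltW.
  by rewrite Ke => h; lra.
have [W [mW muW Wu]] := cu e e0; have [V [mV muV Vv]] := cv e e0.
exists (W `|` V); split.
- exact: measurableU.
- apply: (@le_trans _ _ (mu W + mu V)%E); first exact: measureU2.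
  by apply: le_trans (leeD muW muV) _; rewrite -EFinD lee_fin.
- move=> x nWV; have [M1 h1] := Wu x (fun w => nWV (or_introl w)).
  have [M2 h2] := Vv x (fun w => nWV (or_intror w)).
  exists (maxn M1 M2) => N N'; rewrite !geq_max => /andP[a1 a2] /andP[b1 b2].
  have {}h1 := h1 _ _ a1 b1; have {}h2 := h2 _ _ a2 b2.
  have -> : a * u N x + b * v N x - (a * u N' x + b * v N' x) =
     a * (u N x - u N' x) + b * (v N x - v N' x) by ring.
  apply: le_trans (ler_normD _ _) _; rewrite !normrM.
  apply: (@le_trans _ _ (`|a| * e + `|b| * e)).
    by apply: lerD; apply: ler_wpM2l.
  rewrite -mulrDl; apply: (@le_trans _ _ (e * K)).
    by rewrite [X in X <= _]mulrC ler_wpM2l ?(ltW e0)// /K lerDl.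
  by rewrite Ke; lra.
Qed.

Lemma almost_cauchy_approx (u : nat -> X -> R) :
  (forall eps : R, 0 < eps -> exists2 v : nat -> X -> R, almost_cauchy mu v &
    exists W : set X, [/\ measurable W, (mu W <= eps%:E)%E &
      forall x, ~ W x -> forall N, `|u N x - v N x| <= eps]) ->
  almost_cauchy mu u.
Proof.
move=> app eps eps0.
have e0 : 0 < eps / 4 by rewrite divr_gt0.
have [v cv [W [mW muW Wu]]] := app _ e0; have [V [mV muV Vv]] := cv _ e0.
exists (W `|` V); split.
- exact: measurableU.
- apply: (@le_trans _ _ (mu W + mu V)%E); first exact: measureU2.
  by apply: le_trans (leeD muW muV) _; rewrite -EFinD lee_fin; lra.
- move=> x nWV; have h1 := Wu x (fun w => nWV (or_introl w)).
  have [M h2] := Vv x (fun w => nWV (or_intror w)).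
  exists M => N N' MN MN'.
  have := h1 N; have := h1 N'; have := h2 _ _ MN MN'.
  by rewrite !ler_norml => /andP[a1 a2] /andP[b1 b2] /andP[c1 c2]; apply/andP; split; lra.
Qed.

Lemma almost_cauchy_flat (T : X -> X) (k : nat) (f : 'I_k -> X -> R) :
  (forall eps : R, 0 < eps -> eventually_flat mu T f eps) ->
  almost_cauchy mu (real_average T f).
Proof.
move=> flat eps eps0; have e0 : 0 < eps / 2 by rewrite divr_gt0.
have [c [M [W [mW muW h]]]] := flat _ e0; exists W; split=> //.
  by apply: le_trans muW _; rewrite lee_fin; lra.
move=> x nW; exists M => N N' MN MN'; have := h x nW N MN; have := h x nW N' MN'.
by rewrite !ler_norml => /andP[a1 a2] /andP[b1 b2]; apply/andP; split; lra.
Qed.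

End almost_cauchy_lemmas.

Definition update (X : Type) (R : Type) (k : nat) (f : 'I_k -> X -> R) (j : 'I_k)
  (g : X -> R) : 'I_k -> X -> R := fun i => if i == j then g else f i.

Section bounded_average.
Context (R : realType) d (X : measurableType d) (mu : probability X R).
Variables (T : X -> X).
Hypothesis mT : measurable_fun setT T.
Hypothesis muT : forall A, measurable A -> mu (T @^-1` A) = mu A.

Lemma real_average_update (k : nat) (f : 'I_k -> X -> R) (j : 'I_k) (g : X -> R) N x :
  real_average T (update f j g) N x = N%:R^-1 * \sum_(0 <= n < N)
    g (iter (j.+1 * n) T x) * \prod_(i < k | i != j) f i (iter (i.+1 * n) T x).
Proof.
congr (_ * _); apply: eq_bigr => n _; rewrite (bigD1 j)//= /update eqxx; congr (_ * _).
by apply: eq_bigr => i /negbTE ->.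
Qed.

Lemma real_average_update_lin (k : nat) (f : 'I_k -> X -> R) (j : 'I_k) (a b : R)
    (g h : X -> R) N x :
  real_average T (update f j (fun x => a * g x + b * h x)) N x =
  a * real_average T (update f j g) N x + b * real_average T (update f j h) N x.
Proof.
rewrite !real_average_update ![_ * (N%:R^-1 * _)]mulrCA -mulrDr; congr (_ * _).
rewrite !mulr_sumr -big_split; apply: eq_bigr => n _ /=.
by rewrite mulrDl !mulrA.
Qed.

(** The averages of [g] and [h] differ at any time [N] by at most
    [K ^+ k] times the average of [`|g - h|] along the powers of [T^(j+1)], and
    the maximal inequality controls the latter for all [N] at once. *)
Lemma real_average_update_L1 (k : nat) (f : 'I_k -> X -> R) (j : 'I_k) (g : X -> R) (C K : R) :
  1 <= K -> (forall i x, `|f i x| <= K) ->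
  measurable_fun setT g -> (forall x, `|g x| <= C) ->
  (forall eps : R, 0 < eps -> exists h : X -> R,
     [/\ measurable_fun setT h, forall x, `|h x| <= C,
        almost_cauchy mu (real_average T (update f j h)) &
        (\int[mu]_x (`|g x - h x|)%:E <= eps%:E)%E]) ->
  almost_cauchy mu (real_average T (update f j g)).
Proof.
move=> K1 fK mg gC app; apply: almost_cauchy_approx => eps eps0.
have K0 : 0 < K by apply: lt_le_trans K1.
have Kk : 0 < K ^+ k by rewrite exprn_gt0.
pose lam := eps / K ^+ k; have lam0 : 0 < lam by rewrite divr_gt0.
have [h [mh hC ch gh]] := app (lam * eps) (mulr_gt0 lam0 eps0).
exists (real_average T (update f j h)) => //.
pose D x := `|g x - h x|.
have mD : measurable_fun setT D.
  by apply: measurableT_comp => //; exact: measurable_funB.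
have DC x : 0 <= D x <= C + C.
  by rewrite normr_ge0 /=; apply: le_trans (ler_normB _ _) _; exact: lerD.
have [W [mW Wle Wout]] := maximal_inequality (measurable_iter mT j.+1)
  (iter_preserving mT muT j.+1) mD DC lam0.
exists W; split=> //.
  have fW : mu W \is a fin_num by exact: fin_num_measure.
  move: (le_trans Wle gh); rewrite -(fineK fW) -EFinM !lee_fin.
  by rewrite ler_pM2l.
move=> x nW N; rewrite !real_average_update -mulrBr -sumrB.
have [->|N0] := posnP N; first by rewrite big_geq// mulr0 normr0 ltW.
have Nr : 0 < N%:R :> R by rewrite ltr0n.
rewrite normrM normfV [ `|N%:R| ]gtr0_norm// [X in X <= _]mulrC ler_pdivrMr//.
apply: le_trans (ler_norm_sum _ _ _) _.
apply: (@le_trans _ _ (\sum_(0 <= n < N) D (iter (j.+1 * n) T x) * K ^+ k)).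
  apply: ler_sum => n _; rewrite -mulrBl normrM /D ler_wpM2l//.
  rewrite normr_prod; apply: (@le_trans _ _ (\prod_(i < k | i != j) K)).
    by apply: ler_prod => i _; rewrite normr_ge0 fK.
  rewrite prodr_const ler_weXn2l//.
  by apply: leq_trans (max_card _) _; rewrite card_ord.
rewrite -mulr_suml -ler_pdivlMr//.
apply: le_trans (_ : lam * N%:R <= _); last by rewrite /lam mulrAC.
apply: le_trans (Wout x nW N).
by rewrite le_eqVlt; apply/orP; left; apply/eqP; apply: eq_bigr => n _; rewrite -iterM mulnC.
Qed.

Variable pi : seq nat -> set X.
Hypothesis piE : @measurable d X = <<s range pi >>.
Hypothesis piI : forall s s', pi s `&` pi s' = pi (s ++ s').
Hypothesis pi0 : pi [::] = setT.
Hypothesis flat : forall (k : nat) (s : 'I_k -> seq nat) (eps : R), 0 < eps ->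
  eventually_flat mu T (fun j => \1_(pi (s j))) eps.

(** Induction on the number [l] of positions occupied by arbitrary bounded
    functions, the other positions being occupied by indicators of sets of the
    pi-system. *)
Lemma bounded_real_average (k : nat) (f : 'I_k -> X -> R) (K : R) :
  (forall j, measurable_fun setT (f j)) -> (forall j x, `|f j x| <= K) ->
  almost_cauchy mu (real_average T f).
Proof.
move=> mf; wlog K1 : K / 1 <= K.
  move=> H fK; apply: (H (Num.max 1 K)); first by rewrite le_max lexx.
  by move=> j x; apply: le_trans (fK j x) _; rewrite le_max lexx orbT.
have key l : forall f : 'I_k -> X -> R, (forall j, measurable_fun setT (f j)) ->
    (forall j x, `|f j x| <= K) ->
    (forall j : 'I_k, (l <= j)%N -> exists s, f j = \1_(pi s)) ->
    almost_cauchy mu (real_average T f).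
  elim: l => [|l IH] g mg gK gpi.
    have [s sP] := choice (fun j => gpi j (leq0n j)).
    have -> : g = (fun j => \1_(pi (s j))) by apply/funext => j; exact: sP.
    by apply: almost_cauchy_flat => eps; exact: flat.
  have [lk|kl] := ltnP l k; last first.
    by apply: IH => // j lj; have := ltn_ord j; rewrite ltnNge (leq_trans kl lj).
  pose j := Ordinal lk.
  have -> : g = update g j (g j).
    by apply/funext => i; rewrite /update; case: eqP => // ->.
  apply: (@bounded_function_class R d X mu (range pi)
    (fun h => almost_cauchy mu (real_average T (update g j h))) piE _ _ _ _ _ (g j) K) => //.
  - by move=> A B [s _ <-] [s' _ <-]; exists (s ++ s') => //; rewrite piI.
  - by exists [::].
  - move=> A [s _ <-]; apply: IH.
    + move=> i; rewrite /update; case: eqP => // _; apply: measurable_indic.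
      by rewrite piE; apply: sub_sigma_algebra; exists s.
    + move=> i x; rewrite /update; case: eqP => // _; apply: le_trans K1.
      by rewrite indicE; case: (_ \in _); rewrite ?normr0 ?normr1.
    + move=> i li; rewrite /update; case: eqP => [_|/eqP ij]; first by exists s.
      by apply: gpi; rewrite ltn_neqAle li andbT; apply: contra ij => /eqP e; apply/eqP/val_inj.
  - move=> a b h1 h2 c1 c2; apply: almost_cauchy_ext (almost_cauchy_lin a b c1 c2) => N x.
    by rewrite real_average_update_lin.
  - by move=> h C mh hC app; exact: (real_average_update_L1 K1 gK mh hC app).
move=> fK; apply: (key k) => // j kj; have := ltn_ord j.
by rewrite ltnNge kj.
Qed.

End bounded_average.

(** * Complex-valued functions and the theorem *)

Lemma normc_ge_Im (R : rcfType) (x : R[i]) : (`|complex.Im x|%:C)%C <= `|x|.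
Proof.
by case: x => a b; simpc; rewrite -sqrtr_sqr ler_wsqrtr // lerDr sqr_ge0.
Qed.

Lemma cvg_complex_real (R : realType) (u : nat -> R) (l : R) :
  u @ \oo --> l -> ((fun N => (u N)%:C%C) : nat -> R[i]^o) @ \oo --> (l%:C%C : R[i]^o).
Proof.
move=> /cvgrPdist_lt ul; apply/cvgrPdist_lt => e e0.
have eE : e = ((complex.Re e)%:C)%C.
  by rewrite RRe_real// realE ltW.
have e0' : 0 < complex.Re e by move: e0; rewrite ltcE => /andP[].
have := ul _ e0'; apply: filterS => N h.
rewrite eE -raddfB normc_def /= expr0n addr0 sqrtr_sqr ltcR.
exact: h.
Qed.

Lemma cvg_complex_sum (R : realType) (I : finType) (c : I -> R[i]) (u : I -> nat -> R) :
  (forall i, cvgn (u i)) ->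
  cvgn ((fun N => \sum_i c i * (u i N)%:C%C) : nat -> R[i]^o).
Proof.
move=> cu.
suff : ((fun N => \sum_i c i * (u i N)%:C%C) : nat -> R[i]^o) @ \oo -->
    ((\sum_i c i * (limn (u i))%:C%C) : R[i]^o) by move=> h; apply/cvg_ex; eexists; exact: h.
elim: (index_enum I) => [|i r IH].
  under eq_fun do rewrite big_nil.
  rewrite big_nil; exact: cvg_cst.
under eq_fun do rewrite big_cons.
rewrite big_cons; apply: cvgD; last exact: IH.
by apply: cvgMl_tmp; apply: cvg_complex_real; exact: cu.
Qed.

(** Writing each factor as real part plus i times imaginary part turns a
    product of complex functions into a finite combination of products of real
    functions. *)
Lemma complex_product_expand (R : realType) (I : finType) (z : I -> R[i]) :
  \prod_j z j = \sum_(h : {ffun I -> bool})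
    (\prod_j (if h j then 'i%C else 1)) *
    ((\prod_j (if h j then complex.Im (z j) else complex.Re (z j)))%:C)%C.
Proof.
transitivity (\prod_j \sum_(b : bool) (if b then 'i%C * (complex.Im (z j))%:C%C
    else (complex.Re (z j))%:C%C)).
  by apply: eq_bigr => j _; rewrite big_bool /= {1}[z j]complexE addrC.
rewrite bigA_distr_bigA; apply: eq_bigr => h _.
rewrite rmorph_prod -big_split; apply: eq_bigr => j _ /=.
by case: (h j); rewrite ?mul1r.
Qed.

(** Preimages of a null set under the iterates are null, and they are countably many. *)
Lemma ae_orbit (R : realType) d (X : measurableType d) (mu : probability X R) (T : X -> X)
    (Q : X -> Prop) : measurable_fun setT T ->
  (forall A, measurable A -> mu (T @^-1` A) = mu A) ->
  {ae mu, forall x, Q x} -> {ae mu, forall x, forall n, Q (iter n T x)}.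
Proof.
move=> mT muT [N [mN N0 sub]]; apply/ae_foralln => n.
exists (iter n T @^-1` N); split.
- by rewrite -[X in measurable X]setTI; apply: (measurable_iter mT).
- exact: etrans (iter_preserving mT muT n mN) N0.
- by move=> x /= nQ; apply: sub.
Qed.

Theorem theorem3p11 (R : realType) (d : measure_display) (X : measurableType d)
    (mu : probability X R) (hX : standard_borel R X) (hmu : nonatomic mu) :
  exists G : set (Aut mu), residual G /\
    forall T : mptrans mu, G (Aut_class T) ->
    forall (k : nat), (0 < k)%N ->
    forall f : 'I_k -> X -> R[i], (forall j, Linfty mu (f j)) ->
    {ae mu, forall x,
       cvgn ((fun N => multiple_average T f N x) : nat -> R[i]^o)}.
Proof.
have [A [_ [mE _ _ _]]] := standard_borel_code hX.
pose pi (s : seq nat) : set X := \big[setI/setT]_(i <- s) A i.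
have mA n : measurable (A n) by rewrite mE; apply: sub_sigma_algebra; exists n.
have mpi s : measurable (pi s).
  apply: (big_ind measurable) => [|B C|i _]; [exact: measurableT|exact: measurableI|exact: mA].
have piE : @measurable d X = <<s range pi >>.
  apply/seteqP; split=> [B|].
    rewrite mE; move: B; apply: smallest_sub; first exact: smallest_sigma_algebra.
    move=> _ [n _ <-]; apply: sub_sigma_algebra; exists [:: n] => //.
    by rewrite /pi big_seq1.
  apply: smallest_sub; first exact: sigma_algebra_measurable.
  by move=> _ [s _ <-].
have piI s s' : pi s `&` pi s' = pi (s ++ s') by rewrite /pi big_cat.
have pi0 : pi [::] = setT by rewrite /pi big_nil.
have [G [rG flatG]] := residual_flat hX hmu mpi.
exists G; split=> // T GT k _ f Lf.
have mT : measurable_fun setT T by exact: mptrans_measurable.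
have muT B : measurable B -> mu (T @^-1` B) = mu B by exact: mptrans_preserving.
have bnd j : exists M : R, {ae mu, forall x, `|f j x| <= (M%:C)%C} by case: (Lf j).
have [M MP] := choice bnd.
pose K := \sum_j `|M j|.
have MK j : M j <= K.
  by rewrite /K (bigD1 j)//= (le_trans (ler_norm _))// lerDl sumr_ge0.
have K0 : 0 <= K by rewrite sumr_ge0.
(* Representatives are bounded only almost everywhere; truncation makes them
   bounded everywhere and changes nothing along almost every orbit. *)
pose clamp (t : R) := Num.min K (Num.max (- K) t).
have clampE t : `|t| <= K -> clamp t = t.
  by rewrite ler_norml => /andP[h1 h2]; rewrite /clamp max_r// min_r.
have clampK t : `|clamp t| <= K.
  rewrite ler_norml /clamp le_min ge_min lexx /= le_max lexx /= andbT.
  by rewrite ge0_cp.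
pose g (b : bool) (j : 'I_k) (x : X) : R :=
  clamp (if b then complex.Im (f j x) else complex.Re (f j x)).
have mg b j : measurable_fun setT (g b j).
  have [mRe mIm _] := Lf j.
  apply: measurable_minr; first exact: measurable_cst.
  apply: measurable_maxr; first exact: measurable_cst.
  by case: b.
pose u (h : {ffun 'I_k -> bool}) := real_average T (fun j => g (h j) j).
have cu : {ae mu, forall x h, cvgn (fun N => u h N x)}.
  apply: filter_forall => h; apply: almost_cauchy_ae.
  apply: (bounded_real_average mT muT piE piI pi0 (flatG T GT) (K := K)) => [j|j x].
    exact: mg.
  exact: clampK.
have bound : {ae mu, forall x, forall n, forall j, `|f j (iter n T x)| <= (K%:C)%C}.
  apply: (ae_orbit (Q := fun x => forall j, `|f j x| <= (K%:C)%C) mT muT).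
  apply: filter_forall => j; apply: filterS (MP j) => x h.
  by apply: le_trans h _; rewrite lecR.
apply: filterS2 cu bound => x cux bx.
suff -> : (fun N => multiple_average T f N x) = (fun N => \sum_(h : {ffun 'I_k -> bool})
    (\prod_j (if h j then 'i%C else 1)) * (u h N x)%:C%C) :> (nat -> R[i]^o).
  exact: cvg_complex_sum.
apply/funext => N; rewrite /multiple_average.
under eq_bigr do rewrite complex_product_expand.
rewrite exchange_big /= mulr_sumr; apply: eq_bigr => h _.
rewrite -mulr_sumr mulrCA; congr (_ * _).
rewrite /u /real_average rmorphM rmorph_sum fmorphV rmorph_nat; congr (_ * _).
apply: eq_bigr => n _; congr (_%:C%C); apply: eq_bigr => j _.
have hb := bx (j.+1 * n)%N j; rewrite /g; case: (h j); rewrite clampE//.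
  by rewrite -lecR; apply: le_trans hb; exact: normc_ge_Im.
by rewrite -lecR; apply: le_trans hb; exact: normc_ge_Re.
Qed.
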